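(* Assume that $X$ is of Pareto-type with index $\alpha\in(0,1)$, i.e. $1-F(x)\sim x^{-\alpha}\ell(x)$ as $x\to\infty$ with $\ell$ slowly varying, and that the counting process $\{N(t);\,t\geq 0\}$ $\mathcal{D}$-averages in time to the random variable $\Lambda$. Define $(a_t)_{t>0}$ by $\lim_{t\to\infty}t\,a_t^{-\alpha}\ell(a_t)=1$. Then $$\frac{1}{a_t}\,C_{N(t)}\stackrel{\mathcal{D}}{\longrightarrow}\frac{U_\alpha}{V_\alpha}\quad\text{and}\quad\frac{1}{a_t}\,\widehat{\mathrm{D}(X)}\stackrel{\mathcal{D}}{\longrightarrow}\frac{U_\alpha}{V_\alpha}\quad\text{as } t\rightarrow\infty,$$ where the joint distribution of the random vector $(U_\alpha,V_\alpha)^\prime$ is determined by $$\mathbb{E}\left\{e^{-rU_\alpha-sV_\alpha}\right\}=\mathbb{E}\left\{e^{-\delta_\alpha(r,s)\,\Lambda}\right\},\quad r>0,\ s\geq 0,$$ with $$\delta_\alpha(r,s):=2\,e^{\frac{s^2}{4r}}\int_0^\infty e^{-\left(u+\frac{s}{2\sqrt r}\right)^2}\left(u+\frac{s}{2\sqrt r}\right)\left(\frac{u}{\sqrt r}\right)^{-\alpha}du .$$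
   Context: $X$ is a positive random variable with distribution function $F$; $X_1,X_2,\ldots$ are i.i.d. copies of $X$; $\{N(t);\,t\geq 0\}$ is a counting process (nonnegative integer-valued, nondecreasing in $t$) independent of the $X_i$'s. For fixed $t\ge0$, $C_{N(t)}:=\frac{X_1^2+\cdots+X_{N(t)}^2}{X_1+\cdots+X_{N(t)}}$ if $N(t)\ge1$ and $C_{N(t)}:=0$ otherwise. The sample dispersion based on $X_1,\ldots,X_{N(t)}$ is $\widehat{\mathrm{D}(X)}:=S^2/\overline X$, where $\overline X:=\frac{1}{N(t)}\sum_{i=1}^{N(t)}X_i$ and $S^2:=\frac{1}{N(t)}\sum_{i=1}^{N(t)}(X_i-\overline X)^2$; on $\{N(t)=0\}$ it is set to $0$. $X$ (or $F$) is of Pareto-type with index $\alpha>0$ if $1-F(x)\sim x^{-\alpha}\ell(x)$ as $x\to\infty$ for a slowly varying function $\ell$. The counting process $\mathcal{D}$-averages in time to $\Lambda$ if $N(t)/t\stackrel{\mathcal{D}}{\longrightarrow}\Lambda$ (convergence in distribution) as $t\to\infty$, where $\mathbb{P}[\Lambda>0]=1$.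
   Formalization: The family a_t is additionally required to tend to infinity as t tends to infinity; the normalisation t a_t^{-α} ℓ(a_t) → 1 alone permits a bounded a_t when ℓ comes close to zero near a finite point, and then the convergence fails. *)

(* Defs.v *)
From HB Require Import structures.
From mathcomp Require Export all_boot all_order all_algebra.
From mathcomp Require Import finmap.
From mathcomp Require Export all_classical all_reals all_analysis.

Set Implicit Arguments.
Unset Strict Implicit.
Unset Printing Implicit Defensive.

Import Order.TTheory GRing.Theory Num.Theory.
Import numFieldTopology.Exports numFieldNormedType.Exports.

Local Open Scope classical_set_scope.
Local Open Scope ring_scope.

(* Convergence in distribution, as t -> +oo, of the family of real random
   variables Y t on (T, P) to the real random variable Z on (T', Q): the
   distribution functions converge at every continuity point of that of Z.
   Y t and Z are plain functions, to be used only when they are measurable;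
   pushforward P (Y t) `]-oo, x] is then the cdf of Y t at x. *)
Definition cvg_in_distribution {d d' : measure_display}
    {T : measurableType d} {T' : measurableType d'} {R : realType}
    (P : probability T R) (Y : R -> T -> R)
    (Q : probability T' R) (Z : T' -> R) : Prop :=
  forall x : R,
    {for x, continuous (fun y : R => pushforward Q Z `]-oo, y])} ->
    pushforward P (Y t) `]-oo, x] @[t --> +oo] --> pushforward Q Z `]-oo, x].

Definition mutually_independent {d : measure_display} {T : measurableType d}
    {R : realType} (P : probability T R) (Xs : nat -> {RV P >-> R}) : Prop :=
  forall (J : {fset nat}) (B : nat -> set R),
    (forall i, measurable (B i)) ->
    P (\bigcap_(i in [set` J]) (Xs i @^-1` B i)) =
    (\prod_(i <- J) P (Xs i @^-1` B i))%E.

Definition iid_copies {d : measure_display} {T : measurableType d}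
    {R : realType} (P : probability T R) (X : {RV P >-> R})
    (Xs : nat -> {RV P >-> R}) : Prop :=
  mutually_independent Xs /\
  forall (i : nat) (B : set R), measurable B ->
    distribution P (Xs i) B = distribution P X B.

(* Only the times t >= 0 are relevant. *)
Definition counting_process {d : measure_display} {T : measurableType d}
    {R : realType} (P : probability T R) (N : R -> {RV P >-> nat}) : Prop :=
  forall (w : T) (s t : R), 0 <= s -> s <= t -> (N s w <= N t w)%N.

(* The sigma-algebra generated by the sequence (X_i) and the one generated by
   the whole process (N(t), t >= 0) are independent. *)
Definition process_independent {d : measure_display} {T : measurableType d}
    {R : realType} (P : probability T R) (N : R -> {RV P >-> nat})
    (Xs : nat -> {RV P >-> R}) : Prop :=
  forall A B : set T,
    <<s [set A' | exists (t : R) (K : set nat), 0 <= t /\ A' = N t @^-1` K] >> A ->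
    <<s [set B' | exists (i : nat) (S : set R),
                    measurable S /\ B' = Xs i @^-1` S] >> B ->
    P (A `&` B) = (P A * P B)%E.

Definition slowly_varying {R : realType} (ell : R -> R) : Prop :=
  (exists A : R, measurable_fun `[A, +oo[ ell /\ forall x, A <= x -> 0 < ell x) /\
  forall lam : R, 0 < lam -> ell (lam * x) / ell x @[x --> +oo] --> (1 : R).

Definition pareto_type {d : measure_display} {T : measurableType d}
    {R : realType} (P : probability T R) (X : {RV P >-> R})
    (alpha : R) (ell : R -> R) : Prop :=
  slowly_varying ell /\
  (1 - fine (cdf X x)) / (x `^ (- alpha) * ell x) @[x --> +oo] --> (1 : R).

Definition D_averages_in_time {d d' : measure_display}
    {T : measurableType d} {T' : measurableType d'} {R : realType}
    (P : probability T R) (N : R -> {RV P >-> nat})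
    (Q : probability T' R) (Lambda : {RV Q >-> R}) : Prop :=
  cvg_in_distribution P (fun t w => (N t w)%:R / t) Q Lambda /\
  Q [set w | 0 < Lambda w] = 1%E.

(* The sequence X_1, X_2, ... is indexed from 0. *)
Definition C_stat {d : measure_display} {T : measurableType d} {R : realType}
    (P : probability T R) (Xs : nat -> {RV P >-> R}) (N : R -> {RV P >-> nat})
    (t : R) (w : T) : R :=
  if (1 <= N t w)%N then
    (\sum_(i < N t w) Xs i w ^+ 2) / (\sum_(i < N t w) Xs i w)
  else 0.

Definition sample_mean {d : measure_display} {T : measurableType d}
    {R : realType} (P : probability T R) (Xs : nat -> {RV P >-> R})
    (n : nat) (w : T) : R :=
  n%:R^-1 * \sum_(i < n) Xs i w.

Definition sample_variance {d : measure_display} {T : measurableType d}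
    {R : realType} (P : probability T R) (Xs : nat -> {RV P >-> R})
    (n : nat) (w : T) : R :=
  n%:R^-1 * \sum_(i < n) (Xs i w - sample_mean Xs n w) ^+ 2.

Definition sample_dispersion {d : measure_display} {T : measurableType d}
    {R : realType} (P : probability T R) (Xs : nat -> {RV P >-> R})
    (N : R -> {RV P >-> nat}) (t : R) (w : T) : R :=
  if (1 <= N t w)%N then
    sample_variance Xs (N t w) w / sample_mean Xs (N t w) w
  else 0.

Definition delta {R : realType} (alpha r s : R) : R :=
  let c := s / (2 * Num.sqrt r) in
  2 * expR (s ^+ 2 / (4 * r)) *
  \int[lebesgue_measure]_(u in `]0, +oo[)
    (expR (- (u + c) ^+ 2) * (u + c) * (u / Num.sqrt r) `^ (- alpha)).

(* U and V need not be assumed nonnegative: both expectations are always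
   defined in [0, +oo], and the identity forces U, V >= 0 almost surely. *)
Definition has_UV_transform {d d' : measure_display}
    {T : measurableType d} {T' : measurableType d'} {R : realType}
    (alpha : R) (Q : probability T R) (Lambda : {RV Q >-> R})
    (P : probability T' R) (U V : {RV P >-> R}) : Prop :=
  forall r s : R, 0 < r -> 0 <= s ->
    ('E_P[fun w => expR (- r * U w - s * V w)])%E =
    ('E_Q[fun w => expR (- delta alpha r s * Lambda w)])%E.

(* Main.v *)
(** Let S1 and S2 be the sums of the first N(t) sample values and of their
    squares. Given N(t), the transform of (S2 / a_t^2, S1 / a_t) is phi_t ^ N(t),
    where regular variation and the layer cake formula give
    t * (1 - phi_t) -> delta alpha r s; so it tends to E exp (- delta Lambda).

    In the coordinates z = exp (- U), w = exp (- (U + V)) the values of the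
    transform at r = i + j, s = j are the moments E [z^i w^j]. Bernstein
    polynomials on the unit square turn the convergence of moments into bounds
    for the events {0 <= G (z, w)} with G Lipschitz, and make the joint law unique.
    The event {C <= a_t x} is {w <= z ^ (1 + 1 / x)} in these coordinates, and the
    dispersion is C minus the sample mean, which is negligible with respect to a_t.

    The limit is realized as U = Lambda^(2 / alpha) * \sum_i Gamma_i^(- 2 / alpha) and
    V = Lambda^(1 / alpha) * \sum_i Gamma_i^(- 1 / alpha), where Gamma_1 < Gamma_2 < ...
    are the points of a unit rate Poisson process: delta alpha r s is the integral
    over y > 0 of 1 - exp (- r y^(- 2 / alpha) - s y^(- 1 / alpha)). The exponential
    gaps are read off the binary digits of a single uniform variable. *)
Require Import Defs.
From HB Require Import structures.
From mathcomp Require Import all_boot all_order all_algebra.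
From mathcomp Require Import finmap.
From mathcomp Require Import all_classical all_reals all_analysis measurable_realfun.
From mathcomp Require Import ring lra.

Set Implicit Arguments.
Unset Strict Implicit.
Unset Printing Implicit Defensive.

Import Order.TTheory GRing.Theory Num.Theory.
Import numFieldTopology.Exports numFieldNormedType.Exports.

Local Open Scope classical_set_scope.
Local Open Scope ring_scope.

(** * Moments of random variables in the unit square *)

(** The transform is given for [r > 0] only, and [delta alpha 0 s] is a meaningless default value,
    so the variable [exp (- V)] is out of reach. This is the origin of the second coordinate
    [exp (- (U + V))]: every monomial other than 1 then has [r = i + j > 0]. Both coordinates live
    in a compact square, so polynomial approximation replaces tightness and any continuity theorem
    for Laplace transforms. Only upper bounds for closed events are produced. Applied to [C <= x]
    and to [C >= x], they enclose the distribution function, and its continuity at [x] closes the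
    gap. Moments can only be compared with those of a law already at hand, so the limit is built
    rather than extracted by compactness. The condition [alpha < 1] makes y^(-1/alpha) integrable at
    infinity, that is, the sum of the jumps finite. The layer cake formula has a second use: it
    reduces independence of exponential functionals to independence of events, since the
    exponentials become integrals of indicators of rays. *)

Section Bernstein.
Context {R : realType}.
Implicit Types (x y c d : R) (h : nat -> nat -> R).

Definition bernstein_step x y h (k l : nat) : R :=
  x * (y * h k.+1 l.+1 + (1 - y) * h k.+1 l) +
  (1 - x) * (y * h k l.+1 + (1 - y) * h k l).

(* The expectation of h (k + S) (l + S'), for independent binomial variables S
   and S' with n trials and success probabilities x and y. *)
Definition bernstein n x y h : nat -> nat -> R := iter n (bernstein_step x y) h.

Lemma ler_bernstein n x y h h' : 0 <= x <= 1 -> 0 <= y <= 1 ->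
  (forall k l, h k l <= h' k l) ->
  forall k l, bernstein n x y h k l <= bernstein n x y h' k l.
Proof.
move=> /andP[x0 x1] /andP[y0 y1] hh'; elim: n => //= n IH k l.
by rewrite /bernstein_step lerD ?ler_wpM2l ?subr_ge0// lerD ?ler_wpM2l ?subr_ge0//.
Qed.

Lemma bernstein_affine n x y a b h k l :
  bernstein n x y (fun k l => a * h k l + b) k l = a * bernstein n x y h k l + b.
Proof.
elim: n k l => //= n IH k l; rewrite {1}/bernstein_step.
rewrite -/(bernstein n x y (fun k l => a * h k l + b)) !IH /bernstein_step.
rewrite /bernstein; ring.
Qed.

(** A second moment about a point is squared bias plus binomial variance. From [k = l = 0] with
    [c = n x] and [d = n y] only the variances stay, which is what Chebyshev's argument needs. *)
Lemma bernstein_square n x y c d k l :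
  bernstein n x y (fun k l => (k%:R - c) ^+ 2 + (l%:R - d) ^+ 2) k l =
  ((k%:R + n%:R * x - c) ^+ 2 + n%:R * (x * (1 - x))) +
  ((l%:R + n%:R * y - d) ^+ 2 + n%:R * (y * (1 - y))).
Proof.
elim: n k l => [k l|n IH k l]; first by rewrite /= !mul0r !addr0.
rewrite /= -/(bernstein n x y _) /bernstein_step !IH -!natr1; ring.
Qed.

(** Chebyshev's proof of the Weierstrass theorem: the Lipschitz bound is weakened to a quadratic
    one, whose binomial average is a variance. Frequencies are clipped at 1 because [ler_bernstein]
    compares functions at all [k] and [l], while [f] is controlled on the unit square only. *)
Lemma bernstein_approx (f : R -> R -> R) (M e : R) : 0 <= M -> 0 < e ->
  (forall a b x y, 0 <= a <= 1 -> 0 <= b <= 1 -> 0 <= x <= 1 -> 0 <= y <= 1 ->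
     `|f a b - f x y| <= M * (`|a - x| + `|b - y|)) ->
  exists n, forall x y, 0 <= x <= 1 -> 0 <= y <= 1 ->
    `|bernstein n x y (fun k l => f (Num.min (k%:R / n%:R) 1)
                                    (Num.min (l%:R / n%:R) 1)) 0%N 0%N - f x y|
      <= e.
Proof.
move=> M0 e0 fM.
(* The final error is at most [M * ep] from the variances plus [2 * M * ep] from the two
   coordinates; [M + 1] keeps the denominator positive when [M = 0]. *)
pose ep := e / (3 * (M + 1)).
have ep0 : 0 < ep by rewrite divr_gt0// mulr_gt0// ltr_wpDl.
have [n nep] : exists n : nat, ep ^- 2 < n%:R.
  exists (Num.truncn (ep ^- 2)).+1.
  by rewrite truncnS_gt// .
have n0 : 0 < n%:R :> R by rewrite (lt_trans _ nep)// invr_gt0 exprn_gt0.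
exists n => x y x01 y01.
set h := fun k l => f _ _.
pose q k l : R := (k%:R - n%:R * x) ^+ 2 + (l%:R - n%:R * y) ^+ 2.
pose A := M / (ep * n%:R ^+ 2).
have A0 : 0 <= A by rewrite divr_ge0// mulr_ge0// ltW.
have absle (t : R) : `|t| <= ep + t ^+ 2 / ep.
  have [tep|lt] := leP `|t| ep.
    by rewrite (le_trans tep)// lerDl divr_ge0 ?sqr_ge0// ltW.
  apply: (@le_trans _ _ (t ^+ 2 / ep)); last by rewrite lerDr ltW.
  by rewrite ler_pdivlMr// -real_normK ?num_real// expr2 ler_wpM2l// ltW.
have cl01 (k : nat) : 0 <= (Num.min (k%:R / n%:R) 1 : R) <= 1.
  by rewrite ge_min lexx orbT le_min ler01 divr_ge0.
have cl (k : nat) z : 0 <= z <= 1 ->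
    `|Num.min (k%:R / n%:R) 1 - z| <= ep + (k%:R - n%:R * z) ^+ 2 / (ep * n%:R ^+ 2).
  move=> /andP[z0 z1].
  have -> : (k%:R - n%:R * z) ^+ 2 / (ep * n%:R ^+ 2) = (k%:R / n%:R - z) ^+ 2 / ep.
    by field; rewrite !gt_eqF.
  apply: le_trans (absle _); have [//|lt1] := leP (k%:R / n%:R : R) 1.
  rewrite !ger0_norm ?subr_ge0//; first by rewrite lerD2r ltW.
  exact: (le_trans z1 (ltW lt1)).
have dif k l : `|h k l - f x y| <= A * q k l + 2 * M * ep.
  apply: le_trans (fM _ _ _ _ (cl01 k) (cl01 l) x01 y01) _.
  apply: le_trans (ler_wpM2l M0 (lerD (cl k x x01) (cl l y y01))) _.
  rewrite /A /q le_eqVlt; apply/orP; left; apply/eqP.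
  by field; rewrite !gt_eqF.
have Bq : bernstein n x y q 0%N 0%N <= n%:R / 2.
  rewrite bernstein_square !add0r !subrr expr0n/= !add0r -mulrDr ler_wpM2l//.
  move: x01 y01 => /andP[? ?] /andP[? ?].
  have := sqr_ge0 (x - 2^-1); have := sqr_ge0 (y - 2^-1); lra.
have fin : A * (n%:R / 2) + 2 * M * ep <= e.
  have -> : A * (n%:R / 2) = M * (ep^-1 / (2 * n%:R)).
    by rewrite /A; field; rewrite !gt_eqF.
  have : ep^-1 / (2 * n%:R) <= ep.
    rewrite ler_pdivrMr ?mulr_gt0// -(ler_pM2r ep0) mulVf ?gt_eqF//.
    have : 1 < n%:R * ep ^+ 2 by rewrite -ltr_pdivrMr ?exprn_gt0// div1r.
    lra.
  move=> /(ler_wpM2l M0) H; apply: (le_trans (lerD H (lexx _))).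
  have -> : e = 3 * (M + 1) * ep by rewrite /ep; field; rewrite gt_eqF// ltr_wpDl.
  have : 0 <= M * ep by rewrite mulr_ge0// ltW.
  lra.
rewrite ler_norml; apply/andP; split.
- rewrite lerBrDr addrC.
  have lo k l : - A * q k l + (f x y - 2 * M * ep) <= h k l.
    by have := dif k l; rewrite ler_norml => /andP[+ _]; lra.
  have := ler_bernstein n x01 y01 lo 0%N 0%N; rewrite bernstein_affine.
  apply: le_trans; have := ler_wpM2l A0 Bq; lra.
- rewrite lerBlDr.
  have hi k l : h k l <= A * q k l + (f x y + 2 * M * ep).
    by have := dif k l; rewrite ler_norml => /andP[_]; lra.
  have := ler_bernstein n x01 y01 hi 0%N 0%N; rewrite bernstein_affine => /le_trans.
  apply; have := ler_wpM2l A0 Bq; lra.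
Qed.

End Bernstein.

Lemma bounded_integrable {d} {T : measurableType d} {R : realType}
    (mu : {finite_measure set T -> \bar R}) (f : T -> R) (M : R) :
  measurable_fun setT f -> (forall x, `|f x| <= M) ->
  mu.-integrable setT (EFin \o f).
Proof.
move=> mf fM; apply: measurable_bounded_integrable => //.
  by rewrite -ge0_fin_numE// fin_num_measure.
exists M; split; first exact: num_real.
by move=> N MN t _ /=; rewrite (le_trans (fM t))// ltW.
Qed.

Lemma measurable_ler_set {d} {T : measurableType d} {R : realType} (f g : T -> R) :
  measurable_fun setT f -> measurable_fun setT g ->
  measurable [set t | f t <= g t].
Proof.
move=> mf mg; have := measurable_fun_ler mf mg measurableT (Y := [set true]) I.
by rewrite setTI; congr measurable; apply/seteqP; split => t.
Qed.

Lemma measurable_ltr_set {d} {T : measurableType d} {R : realType} (f g : T -> R) :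
  measurable_fun setT f -> measurable_fun setT g ->
  measurable [set t | f t < g t].
Proof.
move=> mf mg; have := measurable_fun_ltr mf mg measurableT (Y := [set true]) I.
by rewrite setTI; congr measurable; apply/seteqP; split => t.
Qed.

Lemma ae_prob1 {d} {T : measurableType d} {R : realType} (P : probability T R) (A : set T) :
  measurable A -> P A = 1%E -> {ae P, forall w, A w}.
Proof.
by move=> mA A1; exists (~` A); split; [exact: measurableC|rewrite probability_setC// A1 subee|].
Qed.

(** * From convergence of mixed moments to bounds on probabilities *)

Section moment_convergence.
Context {R : realType} {d d' : measure_display} {T : measurableType d}
  {T' : measurableType d'}.
Variables (P : probability T R) (Q : probability T' R).
Variables (z w : nat -> T -> R) (zl wl : T' -> R).
Hypothesis mz : forall n, measurable_fun setT (z n).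
Hypothesis mw : forall n, measurable_fun setT (w n).
Hypothesis mzl : measurable_fun setT zl.
Hypothesis mwl : measurable_fun setT wl.
Hypothesis z01 : forall n t, 0 <= z n t <= 1.
Hypothesis w01 : forall n t, 0 <= w n t <= 1.
Hypothesis zl01 : forall t, 0 <= zl t <= 1.
Hypothesis wl01 : forall t, 0 <= wl t <= 1.
Hypothesis moments : forall i j,
  \int[P]_t (z n t ^+ i * w n t ^+ j) @[n --> \oo] -->
  \int[Q]_t (zl t ^+ i * wl t ^+ j).

(** Boundedness is asked on the unit square only, where all the variables take their values:
    monomials are unbounded elsewhere. *)
Let test_function (F : R -> R -> R) := [/\
  measurable_fun setT (fun p : R * R => F p.1 p.2),
  exists M : R, forall x y : R, 0 <= x <= 1 -> 0 <= y <= 1 -> `|F x y| <= M &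
  \int[P]_t F (z n t) (w n t) @[n --> \oo] --> \int[Q]_t F (zl t) (wl t)].

Let measurable_pair2 d1 (U : measurableType d1) (F : R -> R -> R) (f g : U -> R) :
  measurable_fun setT (fun p : R * R => F p.1 p.2) ->
  measurable_fun setT f -> measurable_fun setT g ->
  measurable_fun setT (fun t => F (f t) (g t)).
Proof.
move=> mF mf mg.
have -> : (fun t => F (f t) (g t)) =
  (fun p : R * R => F p.1 p.2) \o (fun t => (f t, g t)) by [].
by apply: measurableT_comp => //; exact: measurable_fun_pair.
Qed.

Let integrable_n (F : R -> R -> R) (M : R) n : measurable_fun setT (fun p : R * R => F p.1 p.2) ->
  (forall x y : R, 0 <= x <= 1 -> 0 <= y <= 1 -> `|F x y| <= M) ->
  P.-integrable setT (EFin \o (fun t => F (z n t) (w n t))).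
Proof.
move=> mF FM; apply: (@bounded_integrable _ _ _ _ _ M).
  exact: measurable_pair2.
by move=> t; exact: FM.
Qed.

Let integrable_l (F : R -> R -> R) (M : R) : measurable_fun setT (fun p : R * R => F p.1 p.2) ->
  (forall x y : R, 0 <= x <= 1 -> 0 <= y <= 1 -> `|F x y| <= M) ->
  Q.-integrable setT (EFin \o (fun t => F (zl t) (wl t))).
Proof.
move=> mF FM; apply: (@bounded_integrable _ _ _ _ _ M).
  exact: measurable_pair2.
by move=> t; exact: FM.
Qed.

Let test_functionD F G : test_function F -> test_function G ->
  test_function (fun x y => F x y + G x y).
Proof.
move=> [mF [M FM] cF] [mG [N GN] cG]; split.
- exact: (measurable_funD mF mG).
- exists (M + N) => x y x01 y01.
  by rewrite (le_trans (ler_normD _ _))// lerD ?FM ?GN.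
- rewrite RintegralD//; [|exact: (integrable_l mF FM)|exact: (integrable_l mG GN)].
  rewrite [X in X @ _ --> _](_ : _ = (fun n => \int[P]_t F (z n t) (w n t) +
    \int[P]_t G (z n t) (w n t))); first exact: cvgD.
  apply/funext => n; rewrite RintegralD//.
    exact: (integrable_n n mF FM).
  exact: (integrable_n n mG GN).
Qed.

Let test_functionZ c F : test_function F -> test_function (fun x y => c * F x y).
Proof.
move=> [mF [M FM] cF]; split.
- exact: (measurable_funM (measurable_cst c) mF).
- exists (`|c| * M) => x y x01 y01.
  by rewrite normrM ler_wpM2l ?FM.
- rewrite RintegralZl//; last exact: (integrable_l mF FM).
  rewrite [X in X @ _ --> _](_ : _ = (fun n => c * \int[P]_t F (z n t) (w n t))).
    by apply: cvgM => //; exact: cvg_cst.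
  apply/funext => n; rewrite RintegralZl//.
  exact: (integrable_n n mF FM).
Qed.

(** A Bernstein step multiplies by [x] or [1 - x] and by [y] or [1 - y]; the arbitrary monomial in
    front lets the induction absorb these factors. *)
Let test_function_bernstein m h i j k l :
  test_function (fun x y => x ^+ i * y ^+ j * bernstein m x y h k l).
Proof.
elim: m i j k l => [i j k l|m IH i j k l].
  rewrite (_ : (fun _ _ => _) = (fun x y : R => h k l * (x ^+ i * y ^+ j))); last first.
    by apply/funext => x; apply/funext => y; rewrite mulrC.
  apply: test_functionZ; split.
  - exact: (measurable_funM (measurable_funX i measurable_fst) (measurable_funX j measurable_snd)).
  - exists 1 => x y /andP[x0 x1] /andP[y0 y1].
    rewrite ger0_norm ?mulr_ge0 ?exprn_ge0//.
    by rewrite mulr_ile1 ?exprn_ge0 ?exprn_ile1.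
  - exact: moments.
rewrite (_ : (fun _ _ => _) = (fun x y : R =>
    (x ^+ i.+1 * y ^+ j.+1 * bernstein m x y h k.+1 l.+1 +
     (x ^+ i.+1 * y ^+ j * bernstein m x y h k.+1 l +
      -1 * (x ^+ i.+1 * y ^+ j.+1 * bernstein m x y h k.+1 l))) +
    ((x ^+ i * y ^+ j.+1 * bernstein m x y h k l.+1 +
      -1 * (x ^+ i.+1 * y ^+ j.+1 * bernstein m x y h k l.+1)) +
     ((x ^+ i * y ^+ j * bernstein m x y h k l +
      -1 * (x ^+ i.+1 * y ^+ j * bernstein m x y h k l)) +
      (-1 * (x ^+ i * y ^+ j.+1 * bernstein m x y h k l) +
       x ^+ i.+1 * y ^+ j.+1 * bernstein m x y h k l))))).
  by do ! apply: test_functionD => //; do ? apply: test_functionZ.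
apply/funext => x; apply/funext => y /=.
rewrite /= -/(bernstein m x y h) /bernstein_step !exprS; ring.
Qed.

(** A Bernstein polynomial is uniformly [e / 3]-close to [F] on the square, so it moves each
    integral by at most [e / 3], whatever the probability; its own integrals converge as
    combinations of moments. *)
Lemma cvg_integral_lipschitz (F : R -> R -> R) (M : R) : 0 <= M ->
  measurable_fun setT (fun p : R * R => F p.1 p.2) ->
  (forall a b x y : R, 0 <= a <= 1 -> 0 <= b <= 1 -> 0 <= x <= 1 -> 0 <= y <= 1 ->
     `|F a b - F x y| <= M * (`|a - x| + `|b - y|)) ->
  \int[P]_t F (z n t) (w n t) @[n --> \oo] --> \int[Q]_t F (zl t) (wl t).
Proof.
move=> M0 mF FM; apply/cvgrPdist_le => e e0.
have e3 : 0 < e / 3 by rewrite divr_gt0.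
have [m Hm] := bernstein_approx M0 e3 FM.
set h := fun k l => _ in Hm.
have : test_function (fun x y => bernstein m x y h 0%N 0%N).
  have := test_function_bernstein m h 0 0 0 0.
  rewrite (_ : (fun _ _ => _) = (fun x y => bernstein m x y h 0%N 0%N))//.
  by apply/funext => x; apply/funext => y; rewrite !expr0 !mul1r.
set B := fun x y => _ => -[mB [N BN] cB].
have FN x y : 0 <= x <= 1 -> 0 <= y <= 1 -> `|F x y| <= e / 3 + N.
  move=> x01 y01; have -> : F x y = B x y - (B x y - F x y) by ring.
  by rewrite (le_trans (ler_normB _ _))// addrC lerD ?BN// Hm.
have close d1 (U : measurableType d1) (mu : probability U R) (f g : U -> R) :
    measurable_fun setT f -> measurable_fun setT g ->
    (forall t, 0 <= f t <= 1) -> (forall t, 0 <= g t <= 1) ->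
    `|\int[mu]_t F (f t) (g t) - \int[mu]_t B (f t) (g t)| <= e / 3.
  move=> mf mg f01 g01.
  have iF : mu.-integrable setT (EFin \o (fun t => F (f t) (g t))).
    apply: (@bounded_integrable _ _ _ _ _ (e / 3 + N)).
      exact: measurable_pair2.
    by move=> t; exact: FN.
  have iB : mu.-integrable setT (EFin \o (fun t => B (f t) (g t))).
    apply: (@bounded_integrable _ _ _ _ _ N).
      exact: measurable_pair2.
    by move=> t; exact: BN.
  rewrite -RintegralB//.
  apply: (le_trans (le_normr_Rintegral _ _)) => //.
    by have := integrableB measurableT iF iB.
  apply: (@le_trans _ _ (\int[mu]_t (cst (e / 3) t))).
    apply: le_Rintegral => //.
    - by have := integrable_norm (integrableB measurableT iF iB).
    - by apply: (@bounded_integrable _ _ _ _ _ (e / 3)) => // t; rewrite ger0_norm// ltW.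
    - by move=> t _ /=; rewrite distrC; exact: Hm.
  rewrite Rintegral_cst//.
  rewrite (_ : fine _ = 1) ?mulr1//; exact: (congr1 fine (probability_setT mu)).
near=> n.
have := close _ _ Q _ _ mzl mwl zl01 wl01.
have := close _ _ P _ _ (mz n) (mw n) (z01 n) (w01 n).
have : `|\int[Q]_t B (zl t) (wl t) - \int[P]_t B (z n t) (w n t)| <= e / 3.
  by near: n; move/cvgrPdist_le : cB; apply.
rewrite !ler_norml; lra.
Unshelve. all: by end_near. Qed.

(** The closed-set half of the portmanteau theorem. A Lipschitz ramp lies above the indicator of
    [0 <= G] and below that of [- k.+1%:R^-1 < G], and the latter events decrease to [0 <= G] under
    the limit law. *)
Lemma limsup_prob_ge0 (G : R -> R -> R) (M e : R) : 0 <= M -> 0 < e ->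
  measurable_fun setT (fun p : R * R => G p.1 p.2) ->
  (forall a b x y : R, 0 <= a <= 1 -> 0 <= b <= 1 -> 0 <= x <= 1 -> 0 <= y <= 1 ->
     `|G a b - G x y| <= M * (`|a - x| + `|b - y|)) ->
  \forall n \near \oo,
    (P [set t | (0 <= G (z n t) (w n t))%R] <=
     Q [set t | (0 <= G (zl t) (wl t))%R] + e%:E)%E.
Proof.
move=> M0 e0 mG GM.
pose clip (u : R) := Num.min 1 (Num.max 0 u).
have clipE u : [\/ u <= 0 /\ clip u = 0, 1 <= u /\ clip u = 1 | 0 <= u <= 1 /\ clip u = u].
  rewrite /clip; have [u0|u0] := leP u 0.
    by apply: Or31; rewrite min_r.
  have [u1|u1] := leP 1 u; first exact: Or32.
  by apply: Or33; rewrite !ltW.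
have clip_lip u v : `|clip u - clip v| <= `|u - v|.
  have := ler_norm (u - v); have := ler_norm (v - u); rewrite (distrC v u) ler_norml.
  by case: (clipE u) => -[? ->]; case: (clipE v) => -[? ->]; lra.
have clip01 u : 0 <= clip u <= 1 by case: (clipE u) => -[? ->]; lra.
pose E k := [set t | - k.+1%:R^-1 < G (zl t) (wl t)].
have mGl : measurable_fun setT (fun t => G (zl t) (wl t)) by exact: measurable_pair2.
have mGn n : measurable_fun setT (fun t => G (z n t) (w n t)) by exact: measurable_pair2.
have mE k : measurable (E k).
  exact: (measurable_ltr_set (f := cst _)).
have EG : \bigcap_k E k = [set t | 0 <= G (zl t) (wl t)].
  apply/seteqP; split => t /= Et; last first.
    by move=> k _ /=; rewrite /E /=; apply: lt_le_trans Et; rewrite oppr_lt0 invr_gt0.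
  rewrite leNgt; apply/negP => G0.
  have /= := Et (Num.truncn (- G (zl t) (wl t))^-1) I.
  rewrite /E/= => H; have : (- G (zl t) (wl t))^-1 <= (Num.truncn (- G (zl t) (wl t))^-1).+1%:R.
    by rewrite ltW// truncnS_gt.
  rewrite invf_ple ?posrE ?oppr_gt0// ?invr_gt0// ?ltr0n//. 
  by rewrite lerNr leNgt H.
have cE : Q (E k) @[k --> \oo] --> Q [set t | (0 <= G (zl t) (wl t))%R].
  rewrite -EG; apply: nonincreasing_cvg_mu => //.
  - by rewrite -ge0_fin_numE// fin_num_measure.
  - by rewrite EG; exact: (measurable_ler_set (f := cst _)).
  - move=> m n mn; apply/subsetPset => t; rewrite /E/=; apply: le_lt_trans.
    by rewrite lerN2 lef_pV2 ?posrE// ler_nat.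
have [k Hk] : exists k, (Q (E k) < Q [set t | (0 <= G (zl t) (wl t))%R] + (e / 2)%:E)%E.
  have : \forall k \near \oo, (Q (E k) < Q [set t | (0 <= G (zl t) (wl t))%R] + (e / 2)%:E)%E.
    have fQ A : measurable A -> (Q A \is a fin_num)%E by exact: fin_num_measure.
    have H : (Q [set t | (0 <= G (zl t) (wl t))%R] <
        Q [set t | (0 <= G (zl t) (wl t))%R] + (e / 2)%:E)%E.
      rewrite lteDl ?lte_fin ?divr_gt0// fQ//.
      exact: (measurable_ler_set (f := cst _)).
    exact: (cE _ (open_ereal_lt' H)).
  by move=> [k _ /(_ k (leqnn _))]; exists k.
pose F x y := clip (1 + k.+1%:R * G x y).
have mclip : measurable_fun setT clip.
  apply: measurable_minr => //; exact: measurable_maxr.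
have mF : measurable_fun setT (fun p : R * R => F p.1 p.2).
  apply: measurableT_comp => //; apply: measurable_funD => //.
  by apply: measurable_funM.
have FM : forall a b x y, 0 <= a <= 1 -> 0 <= b <= 1 -> 0 <= x <= 1 -> 0 <= y <= 1 ->
     `|F a b - F x y| <= k.+1%:R * M * (`|a - x| + `|b - y|).
  move=> a b x y a01 b01 x01 y01; apply: le_trans (clip_lip _ _) _.
  have -> : 1 + k.+1%:R * G a b - (1 + k.+1%:R * G x y) = k.+1%:R * (G a b - G x y).
    by ring.
  by rewrite normrM ger0_norm// -mulrA ler_wpM2l// GM.
have kM0 : 0 <= k.+1%:R * M by rewrite mulr_ge0.
have cF := cvg_integral_lipschitz kM0 mF FM.
have bF x y : `|F x y| <= 1.
  by have /andP[? ?] := clip01 (1 + k.+1%:R * G x y); rewrite ger0_norm.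
have iFn n : P.-integrable setT (EFin \o (fun t => F (z n t) (w n t))).
  by apply: (@integrable_n _ 1).
have iFl : Q.-integrable setT (EFin \o (fun t => F (zl t) (wl t))).
  by apply: (@integrable_l _ 1).
have upQ : ((\int[Q]_t F (zl t) (wl t))%:E <= Q (E k))%E.
  rewrite /Rintegral fineK; last exact: integrable_fin_num iFl.
  rewrite -[E k]setIT -integral_indic//.
  apply: ge0_le_integral => //.
  - by move=> t _; rewrite lee_fin; have /andP[] := clip01 (1 + k.+1%:R * G (zl t) (wl t)).
  - by apply/measurable_EFinP; exact: measurable_pair2.
  - by apply/measurable_EFinP.
  - move=> t _; rewrite lee_fin /F indicE; case: (boolP (t \in E k)) => [_|].
      by have /andP[] := clip01 (1 + k.+1%:R * G (zl t) (wl t)).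
    rewrite notin_setE /E /= => /negP; rewrite -leNgt => H.
    have := ler_wpM2l (ler0n R k.+1) H; rewrite mulrN mulfV ?gt_eqF//.
    by case: (clipE (1 + k.+1%:R * G (zl t) (wl t))) => -[? ->]; lra.
have loP n : (P [set t | (0 <= G (z n t) (w n t))%R] <= (\int[P]_t F (z n t) (w n t))%:E)%E.
  rewrite /Rintegral fineK; last exact: (integrable_fin_num _ (iFn n)).
  have mA : measurable [set t | 0 <= G (z n t) (w n t)].
    by exact: (measurable_ler_set (f := cst _)).
  rewrite -[X in P X]setIT -integral_indic//.
  apply: ge0_le_integral => //.
  - by apply/measurable_EFinP.
  - by apply/measurable_EFinP; exact: measurable_pair2.
  - move=> t _; rewrite lee_fin /F indicE; case: (boolP (t \in _)) => [|_]; last first.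
      by have /andP[] := clip01 (1 + k.+1%:R * G (z n t) (w n t)).
    rewrite inE /= => H; have : 0 <= k.+1%:R * G (z n t) (w n t) by rewrite mulr_ge0.
    by case: (clipE (1 + k.+1%:R * G (z n t) (w n t))) => -[? ->]; lra.
near=> n.
apply: (le_trans (loP n)).
have : \int[P]_t F (z n t) (w n t) <= \int[Q]_t F (zl t) (wl t) + e / 2.
  have : `|\int[Q]_t F (zl t) (wl t) - \int[P]_t F (z n t) (w n t)| <= e / 2.
    by near: n; move/cvgrPdist_le : cF; apply; rewrite divr_gt0.
  by rewrite ler_norml; lra.
rewrite -lee_fin => /le_trans; apply; rewrite EFinD.
apply: (@le_trans _ _ ((Q (E k)) + (e / 2)%:E)%E); first exact: leeD.
rewrite {2}(splitr e) EFinD addeA leeD//.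
exact: ltW.
Unshelve. all: by end_near. Qed.

End moment_convergence.

(** Closed upper rays are stable under intersection, generate the Borel sets and exhaust the line,
    so the uniqueness theorem for measures applies. *)
Lemma eq_measure_ray {R : realType} (m1 m2 : {measure set R -> \bar R}) :
  (m1 setT < +oo)%E -> (forall x, m1 `[x, +oo[%classic = m2 `[x, +oo[%classic) ->
  forall A, measurable A -> m1 A = m2 A.
Proof.
move=> m1y m12 A mA.
apply: (measure_unique (@RGenCInfty.G R) (fun k => `[- k%:R, +oo[%classic)) => //.
- exact: RGenCInfty.measurableE.
- move=> _ _ [x ->] [y ->]; exists (Num.max x y); apply/seteqP; split => t /=.
    by rewrite !in_itv/= !andbT ge_max => -[-> ->].
  by rewrite !in_itv/= !andbT ge_max => /andP[].
- by move=> k; exists (- k%:R).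
- apply/seteqP; split => // x _; exists (Num.truncn `|x|).+1 => //=.
  rewrite in_itv/= andbT lerNl (le_trans (ler_norm _))// normrN.
  by rewrite ltW// truncnS_gt.
- by move=> _ [x ->]; exact: m12.
- by move=> k; apply: le_lt_trans m1y; apply: le_measure; rewrite ?inE.
Qed.

(** * Mixed moments determine a law on the unit square *)

Section moment_uniqueness.
Context {R : realType} {d d' : measure_display} {T : measurableType d}
  {T' : measurableType d'}.
Variables (P : probability T R) (Q : probability T' R).

(** Rays are replaced by Borel sets one coordinate at a time: the measures are restricted to an
    event of the other coordinate and compared by [eq_measure_ray]. *)
Let eq_rect (z w : T -> R) (zl wl : T' -> R) :
  measurable_fun setT z -> measurable_fun setT w ->
  measurable_fun setT zl -> measurable_fun setT wl ->
  (forall a b, P [set t | a <= z t /\ b <= w t] = Q [set t | a <= zl t /\ b <= wl t]) ->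
  forall A B, measurable A -> measurable B ->
    P (z @^-1` A `&` w @^-1` B) = Q (zl @^-1` A `&` wl @^-1` B).
Proof.
move=> mz mw mzl mwl H.
pose z' : {mfun T >-> R} := HB.pack z (isMeasurableFun.Build _ _ _ _ z mz).
pose w' : {mfun T >-> R} := HB.pack w (isMeasurableFun.Build _ _ _ _ w mw).
pose zl' : {mfun T' >-> R} := HB.pack zl (isMeasurableFun.Build _ _ _ _ zl mzl).
pose wl' : {mfun T' >-> R} := HB.pack wl (isMeasurableFun.Build _ _ _ _ wl mwl).
have mpre d1 (U : measurableType d1) (f : U -> R) C : measurable_fun setT f ->
    measurable C -> measurable (f @^-1` C).
  by move=> mf mC; rewrite -[X in measurable X]setTI; exact: mf.
have step A b : measurable A ->
    P (z @^-1` A `&` w @^-1` `[b, +oo[%classic) = Q (zl @^-1` A `&` wl @^-1` `[b, +oo[%classic).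
  move=> mA.
  have mD := mpre _ _ w _ mw (measurable_itv `[b, +oo[).
  have mDl := mpre _ _ wl _ mwl (measurable_itv `[b, +oo[).
  apply: (@eq_measure_ray _ (pushforward (mrestr P mD) z') (pushforward (mrestr Q mDl) zl')) => //.
    by rewrite /= /pushforward /mrestr /= preimage_setT setTI (le_lt_trans (probability_le1 _ _)) ?ltry.
  move=> a; rewrite /= /pushforward /mrestr /=.
  have := H a b; congr (_ = _); [congr (P _)|congr (Q _)]; apply/seteqP; split => t /=;
    by rewrite !in_itv/= !andbT.
move=> A B mA mB.
have mD := mpre _ _ z _ mz mA; have mDl := mpre _ _ zl _ mzl mA.
rewrite setIC [in RHS]setIC.
apply: (@eq_measure_ray _ (pushforward (mrestr P mD) w') (pushforward (mrestr Q mDl) wl')) => //.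
  by rewrite /= /pushforward /mrestr /= preimage_setT setTI (le_lt_trans (probability_le1 _ _)) ?ltry.
by move=> b; rewrite /= /pushforward /mrestr /= setIC step// setIC.
Qed.

Lemma eq_joint_distribution (z w : T -> R) (zl wl : T' -> R) :
  measurable_fun setT z -> measurable_fun setT w ->
  measurable_fun setT zl -> measurable_fun setT wl ->
  (forall a b, P [set t | a <= z t /\ b <= w t] = Q [set t | a <= zl t /\ b <= wl t]) ->
  forall C : set (R * R), measurable C ->
    P [set t | C (z t, w t)] = Q [set t | C (zl t, wl t)].
Proof.
move=> mz mw mzl mwl H C mC.
have mf : measurable_fun setT (fun t => (z t, w t)) by exact: measurable_fun_pair.
have mg : measurable_fun setT (fun t => (zl t, wl t)) by exact: measurable_fun_pair.
pose f : {mfun T >-> (R * R)%type} := HB.pack (fun t => (z t, w t)) (isMeasurableFun.Build _ _ _ _ _ mf).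
pose g : {mfun T' >-> (R * R)%type} := HB.pack (fun t => (zl t, wl t)) (isMeasurableFun.Build _ _ _ _ _ mg).
pose S : set (set (R * R)) := [set C | exists A, measurable A /\ exists B, measurable B /\ C = A `*` B].
apply: (@measure_unique _ _ _ S (fun=> setT) _ _ _ _ (pushforward P f) (pushforward Q g)) => //.
- rewrite measurable_prod_measurableType //; congr (<<s _ >>).
  rewrite predeqE; split => [[A mA [B mB <-]]|[A [mA [B [mB ->]]]]].
    by exists A; split => //; exists B.
  by exists A => //; exists B.
- move=> /= _ _ [X1 [mX1 [X2 [mX2 ->]]]] [Y1 [mY1 [Y2 [mY2 ->]]]].
  rewrite -setXI; exists (X1 `&` Y1); split; first exact: measurableI.
  by exists (X2 `&` Y2); split => //; exact: measurableI.
- by move=> _; exists setT; split => //; exists setT; split => //; rewrite setXTT.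
- by rewrite bigcup_const//; exists 0%N.
- by move=> _ [A [mA [B [mB ->]]]]; have := eq_rect mz mw mzl mwl H mA mB.
- by move=> _; rewrite /= /pushforward /= preimage_setT (le_lt_trans (probability_le1 _ _)) ?ltry.
Qed.

End moment_uniqueness.

(** The limit theorem for constant sequences: [min (x - a) (y - b)] is 1-Lipschitz and nonnegative
    exactly on the quadrant. Exchanging the two sides then gives equality. *)
Lemma prob_ge_moments_le {R : realType} {d d' : measure_display} {T : measurableType d}
    {T' : measurableType d'} (P : probability T R) (Q : probability T' R)
    (z w : T -> R) (zl wl : T' -> R) (a b : R) :
  measurable_fun setT z -> measurable_fun setT w ->
  measurable_fun setT zl -> measurable_fun setT wl ->
  (forall t, 0 <= z t <= 1) -> (forall t, 0 <= w t <= 1) ->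
  (forall t, 0 <= zl t <= 1) -> (forall t, 0 <= wl t <= 1) ->
  (forall i j, \int[P]_t (z t ^+ i * w t ^+ j) = \int[Q]_t (zl t ^+ i * wl t ^+ j)) ->
  (P [set t | (a <= z t /\ b <= w t)%R] <= Q [set t | (a <= zl t /\ b <= wl t)%R])%E.
Proof.
move=> mz mw mzl mwl z01 w01 zl01 wl01 mom.
apply/lee_addgt0Pr => e e0.
pose G (x y : R) := Num.min (x - a) (y - b).
have GE x y : (0 <= G x y) = (a <= x) && (b <= y).
  by rewrite /G le_min !subr_ge0.
have := @limsup_prob_ge0 _ _ _ _ _ P Q (fun=> z) (fun=> w) zl wl (fun=> mz)
  (fun=> mw) mzl mwl (fun=> z01) (fun=> w01) zl01 wl01 _ G 1 e ler01 e0.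
move=> /(_ _ _ _)[].
- by move=> i j; rewrite mom; exact: cvg_cst.
- by apply: measurable_minr; apply: measurable_funB.
- move=> x y x' y' _ _ _ _; rewrite mul1r /G.
  have := ler_norm (x - x'); have := ler_norm (x' - x); rewrite (distrC x' x).
  have := ler_norm (y - y'); have := ler_norm (y' - y); rewrite (distrC y' y).
  have := normr_ge0 (y - y'); have := normr_ge0 (x - x').
  rewrite ler_norml; case: (leP (x - a)) => ?; case: (leP (x' - a)) => ? *; lra.
- move=> N _ /(_ N (leqnn _)); congr (_ <= _ + _)%E.
    by congr (P _); apply/seteqP; split => t /=; rewrite GE => /andP.
  by congr (Q _); apply/seteqP; split => t /=; rewrite GE => /andP.
Qed.

Lemma eq_joint_distribution_moments {R : realType} {d d' : measure_display}
    {T : measurableType d} {T' : measurableType d'} (P : probability T R)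
    (Q : probability T' R) (z w : T -> R) (zl wl : T' -> R) :
  measurable_fun setT z -> measurable_fun setT w ->
  measurable_fun setT zl -> measurable_fun setT wl ->
  (forall t, 0 <= z t <= 1) -> (forall t, 0 <= w t <= 1) ->
  (forall t, 0 <= zl t <= 1) -> (forall t, 0 <= wl t <= 1) ->
  (forall i j, \int[P]_t (z t ^+ i * w t ^+ j) = \int[Q]_t (zl t ^+ i * wl t ^+ j)) ->
  forall C : set (R * R), measurable C ->
    P [set t | C (z t, w t)] = Q [set t | C (zl t, wl t)].
Proof.
move=> mz mw mzl mwl z01 w01 zl01 wl01 mom; apply: eq_joint_distribution => // a b.
apply/eqP; rewrite eq_le; apply/andP; split; exact: prob_ge_moments_le.
Qed.

(** * Two independent uniform variables from one *)

Section uniform01_def.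
Context {R : realType}.

Let id_mfun : {RV (uniform_prob (@ltr01 R)) >-> R} :=
  HB.pack (fun x : measurableTypeR R => (x : R))
    (isMeasurableFun.Build _ _ (measurableTypeR R) R (fun x => x) (@measurable_id _ R setT)).

(* The pushforward by the identity only changes the display of the measurable
   structure of the real numbers. *)
Definition uniform01 : probability R R := distribution (uniform_prob (@ltr01 R)) id_mfun.

Lemma integral_uniform01 (f : R -> \bar R) :
  measurable_fun setT f -> (forall x, 0 <= f x)%E ->
  (\int[uniform01]_x f x = \int[lebesgue_measure]_(x in `[0%R, 1%R[) f x)%E.
Proof.
move=> mf f0; rewrite ge0_integral_distribution//= integral_uniform//.
rewrite subr0 invr1 mul1e integral_itv_bndo_bndc//.
exact: measurable_funTS.
Qed.

End uniform01_def.

Section uniform01.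
Context {R : realType}.
Notation U := (@uniform01 R).

Lemma eq_integral_uniform01 (f g : R -> \bar R) :
  measurable_fun setT f -> (forall x, 0 <= f x)%E ->
  measurable_fun setT g -> (forall x, 0 <= g x)%E ->
  (forall x, 0 <= x < 1 -> f x = g x) ->
  (\int[U]_x f x = \int[U]_x g x)%E.
Proof.
move=> mf f0 mg g0 fg; rewrite !integral_uniform01//.
by apply: eq_integral => x; rewrite inE/= in_itv/=; exact: fg.
Qed.

Lemma uniform01_ray x : U `[x, +oo[%classic = (Num.max 0 (Num.min 1 (1 - x)))%:E.
Proof.
rewrite -[X in U X]setIT -integral_indic// integral_uniform01//; last first.
  exact/measurable_EFinP/measurable_indic.
rewrite integral_indic// -set_itvI/= lebesgue_measure_itv/=.
rewrite joinEtotal.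
case: ifPn; rewrite lte_fin => H; last first.
  congr (_%:E); rewrite max_l// ge_min; apply/orP; right.
  move: H; rewrite -leNgt; case: (leP x 0) => ?; rewrite ?maxElt; lra.
rewrite -EFinB; congr (_%:E).
move: H; rewrite maxEle; case: ifPn => x0 ?.
  by rewrite min_l ?max_r//; lra.
by move: x0; rewrite -ltNge => x0; rewrite min_r ?max_r//; lra.
Qed.

(** The uniform law is the mean of its images under the two inverse branches of the doubling map.
    The identity is doubled so that no division occurs in the extended reals; the measures are
    compared on rays. *)
Lemma integral_uniform01_halves (f : R -> \bar R) :
  measurable_fun setT f -> (forall x, 0 <= f x)%E ->
  (\int[U]_x f x + \int[U]_x f x =
   \int[U]_x f (x / 2)%R + \int[U]_x f ((1 + x) / 2)%R)%E.
Proof.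
move=> mf f0.
have mh0 : measurable_fun setT (fun x : R => x / 2) by exact: measurable_funM.
have mh1 : measurable_fun setT (fun x : R => (1 + x) / 2).
  by apply: measurable_funM => //; exact: measurable_funD.
pose h0 : {RV U >-> R} := HB.pack (fun x : R => x / 2) (isMeasurableFun.Build _ _ _ _ _ mh0).
pose h1 : {RV U >-> R} := HB.pack (fun x : R => (1 + x) / 2) (isMeasurableFun.Build _ _ _ _ _ mh1).
transitivity (\int[measure_add (distribution U h0) (distribution U h1)]_x f x)%E; last first.
  rewrite ge0_integral_measure_add//; congr (_ + _)%E.
    by rewrite ge0_integral_distribution.
  by rewrite ge0_integral_distribution.
rewrite -ge0_integral_measure_add//.
apply: eq_measure_integral => A mA _.
apply: (@eq_measure_ray _ (measure_add U U) (measure_add (distribution U h0) (distribution U h1))) => //.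
  rewrite [X in (X < _)%E]measure_addE lte_add_pinfty// (le_lt_trans (probability_le1 _ _)) ?ltry//.
move=> x; rewrite [LHS]measure_addE [RHS]measure_addE /= /distribution /pushforward /=.
have -> : (fun y : R => y / 2) @^-1` `[x, +oo[%classic = `[2 * x, +oo[%classic.
  apply/seteqP; split => t /=; rewrite !in_itv/= !andbT; lra.
have -> : (fun y : R => (1 + y) / 2) @^-1` `[x, +oo[%classic = `[2 * x - 1, +oo[%classic.
  apply/seteqP; split => t /=; rewrite !in_itv/= !andbT; lra.

rewrite !uniform01_ray -!EFinD; congr (_%:E).
case: (leP 1 (1 - x)) => ?; case: (leP 1 (1 - 2 * x)) => ?;
  case: (leP 1 (1 - (2 * x - 1))) => ?; do ?case: leP => ?; lra.
Qed.

(** [g] and [h] have to match the two branches of [f] on [[0, 1[] only, since this interval carries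
    the law. *)
Lemma Rintegral_uniform01_halves (f g h : R -> R) (M : R) :
  measurable_fun setT f -> measurable_fun setT g -> measurable_fun setT h ->
  (forall x, 0 <= f x <= M) -> (forall x, 0 <= g x) -> (forall x, 0 <= h x) ->
  (forall x, 0 <= x < 1 -> f (x / 2) = g x) ->
  (forall x, 0 <= x < 1 -> f ((1 + x) / 2) = h x) ->
  \int[U]_x f x = (\int[U]_x g x + \int[U]_x h x) / 2.
Proof.
move=> mf mg mh f0M g0 h0 fg fh.
have mh0 : measurable_fun setT (fun x : R => x / 2) by exact: measurable_funM.
have mh1 : measurable_fun setT (fun x : R => (1 + x) / 2).
  by apply: measurable_funM => //; exact: measurable_funD.
have fM x : `|f x| <= M by have /andP[? ?] := f0M x; rewrite ger0_norm.
have f0 x : (0 <= (f x)%:E)%E by rewrite lee_fin; have /andP[] := f0M x.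
have fin (k : R -> R) : measurable_fun setT k -> (\int[U]_x (f (k x))%:E \is a fin_num)%E.
  move=> mk; have : U.-integrable setT (EFin \o (f \o k)).
    exact: (@bounded_integrable _ _ _ U (f \o k) M (measurableT_comp mf mk) (fun x => fM (k x))).
  exact: integrable_fin_num.
have fE (k l : R -> R) : measurable_fun setT k -> measurable_fun setT l ->
    (forall x, 0 <= l x) -> (forall x, 0 <= x < 1 -> f (k x) = l x) ->
    (\int[U]_x (f (k x))%:E = \int[U]_x (l x)%:E)%E.
  move=> mk ml l0 kl; apply: eq_integral_uniform01 => //.
  - by apply/measurable_EFinP; exact: measurableT_comp.
  - exact/measurable_EFinP.
  - by move=> x /kl ->.
have mEf : measurable_fun setT (EFin \o f) by exact/measurable_EFinP.
have := @integral_uniform01_halves (EFin \o f) mEf f0; rewrite /=.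
rewrite (fE _ _ mh0 mg g0 fg) (fE _ _ mh1 mh h0 fh).
have ff : (\int[U]_x (f x)%:E \is a fin_num)%E by exact: fin.
have fg' : (\int[U]_x (g x)%:E \is a fin_num)%E by rewrite -(fE _ _ mh0 mg)//; exact: fin.
have fh' : (\int[U]_x (h x)%:E \is a fin_num)%E by rewrite -(fE _ _ mh1 mh)//; exact: fin.
move=> /(congr1 fine); rewrite (fineD ff ff) (fineD fg' fh') /Rintegral => H.
by rewrite -H; field.
Qed.

End uniform01.

(** * Splitting a binary expansion into digits of odd and even rank *)

Section digits.
Context {R : realType}.
Notation U := (@uniform01 R).

Definition first_digit (x : R) : R := if 2^-1 <= x then 1 else 0.

Definition digit_shift (x : R) : R := 2 * x - first_digit x.

(** The components exchange roles at each digit: the first collects the digits of odd rank, the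
    second those of even rank. Values stay in [[0, 1]] even for [x] outside the unit interval, so
    the limits exist everywhere. *)
Fixpoint split_digits_approx (n : nat) (x : R) : R * R :=
  if n is m.+1 then
    let y := split_digits_approx m (digit_shift x) in
    ((first_digit x + y.2) / 2, y.1)
  else (0, 0).

Definition digits1 (x : R) : R := limn (fun n => (split_digits_approx n x).1).

Definition digits2 (x : R) : R := limn (fun n => (split_digits_approx n x).2).

Let first_digit01 x : 0 <= first_digit x <= 1.
Proof. by rewrite /first_digit; case: ifP => _; rewrite ?lexx ?ler01. Qed.

Let approx01 n x : 0 <= (split_digits_approx n x).1 <= 1 /\
  0 <= (split_digits_approx n x).2 <= 1.
Proof.
elim: n x => [|n IH] x /=; first by rewrite lexx ler01.
by have [] := IH (digit_shift x); have := first_digit01 x; split => //; lra.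
Qed.

Let approx_nd n x : (split_digits_approx n x).1 <= (split_digits_approx n.+1 x).1 /\
  (split_digits_approx n x).2 <= (split_digits_approx n.+1 x).2.
Proof.
elim: n x => [|n IH] x; first by have [/andP[? _] /andP[? _]] := approx01 1 x.
have [H1 H2] := IH (digit_shift x).
by split; [rewrite /= ler_pM2r// lerD2l|].
Qed.

Let cvg_approx1 x : (split_digits_approx n x).1 @[n --> \oo] --> digits1 x.
Proof.
apply: nondecreasing_is_cvgn.
  by apply/nondecreasing_seqP => n; have [] := approx_nd n x.
by exists 1 => _ [n _ <-]; have [/andP[]] := approx01 n x.
Qed.

Let cvg_approx2 x : (split_digits_approx n x).2 @[n --> \oo] --> digits2 x.
Proof.
apply: nondecreasing_is_cvgn.
  by apply/nondecreasing_seqP => n; have [] := approx_nd n x.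
by exists 1 => _ [n _ <-]; have [_ /andP[]] := approx01 n x.
Qed.

Let measurable_first_digit : measurable_fun setT first_digit.
Proof.
apply: measurable_fun_if => //; exact: (measurable_fun_ler (f := cst _)).
Qed.

Let measurable_digit_shift : measurable_fun setT digit_shift.
Proof.
apply: measurable_funB; first exact: measurable_funM.
exact: measurable_first_digit.
Qed.

Let measurable_approx n : measurable_fun setT (fun x => (split_digits_approx n x).1) /\
  measurable_fun setT (fun x => (split_digits_approx n x).2).
Proof.
elim: n => [|n [IH1 IH2]]; first by split; exact: measurable_cst.
split => /=.
  apply: measurable_funM => //; apply: measurable_funD.
    exact: measurable_first_digit.
  exact: (measurableT_comp IH2 measurable_digit_shift).
exact: (measurableT_comp IH1 measurable_digit_shift).
Qed.

Lemma measurable_digits1 : measurable_fun setT digits1.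
Proof.
apply: (measurable_fun_cvg (h := fun n x => (split_digits_approx n x).1)).
  by move=> n; have [] := measurable_approx n.
by move=> x _; exact: cvg_approx1.
Qed.

Lemma measurable_digits2 : measurable_fun setT digits2.
Proof.
apply: (measurable_fun_cvg (h := fun n x => (split_digits_approx n x).2)).
  by move=> n; have [] := measurable_approx n.
by move=> x _; exact: cvg_approx2.
Qed.

Lemma digits1_ge0_le1 x : 0 <= digits1 x <= 1.
Proof.
apply/andP; split.
  by apply: (cvgr_to_ge (cvg_approx1 (x := x))); apply: nearW => n; have [/andP[]] := approx01 n x.
by apply: (cvgr_to_le (cvg_approx1 (x := x))); apply: nearW => n; have [/andP[]] := approx01 n x.
Qed.

Lemma digits2_ge0_le1 x : 0 <= digits2 x <= 1.
Proof.
apply/andP; split.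
  by apply: (cvgr_to_ge (cvg_approx2 (x := x))); apply: nearW => n; have [_ /andP[]] := approx01 n x.
by apply: (cvgr_to_le (cvg_approx2 (x := x))); apply: nearW => n; have [_ /andP[]] := approx01 n x.
Qed.

Let digits1E x : digits1 x = (first_digit x + digits2 (digit_shift x)) / 2.
Proof.
apply: cvg_lim => //; rewrite -cvg_shiftS /=.
by apply: cvgM; [apply: cvgD; [exact: cvg_cst|exact: cvg_approx2]|exact: cvg_cst].
Qed.

Let digits2E x : digits2 x = digits1 (digit_shift x).
Proof.
by apply: cvg_lim => //; rewrite -cvg_shiftS /=; exact: cvg_approx1.
Qed.

Let digits_half0 x : 0 <= x < 1 ->
  digits1 (x / 2) = digits2 x / 2 /\ digits2 (x / 2) = digits1 x.
Proof.
move=> /andP[x0 x1]; rewrite [digits1 (_ / 2)]digits1E [digits2 (_ / 2)]digits2E.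
have -> : digit_shift (x / 2) = x - first_digit (x / 2).
  by rewrite /digit_shift; field.
have -> : first_digit (x / 2) = 0 by rewrite /first_digit ifF//; apply/negbTE; lra.
by rewrite subr0 add0r.
Qed.

Let digits_half1 x : 0 <= x < 1 ->
  digits1 ((1 + x) / 2) = (1 + digits2 x) / 2 /\ digits2 ((1 + x) / 2) = digits1 x.
Proof.
move=> /andP[x0 x1]; rewrite [digits1 (_ / 2)]digits1E [digits2 (_ / 2)]digits2E.
have -> : digit_shift ((1 + x) / 2) = 1 + x - first_digit ((1 + x) / 2).
  by rewrite /digit_shift; field.
have -> : first_digit ((1 + x) / 2) = 1 by rewrite /first_digit ifT//; lra.
by have -> : 1 + x - 1 = x by ring.
Qed.

(* Halving maps [(x, y)] to [(y / 2, x)] or [((1 + y) / 2, x)]: a system of moments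
   with this self-similarity is determined by its value at [(0, 0)]. *)
Let moment_recursion (m : nat -> nat -> R) := forall i j,
  m i j = (2^-1 ^+ i * m j i +
           2^-1 ^+ i * \sum_(k < i.+1) (m j k) *+ 'C(i, k)) / 2.

(** Induction on the total degree. Terms of lower degree cancel in the difference of two solutions,
    which leaves x_ij = 2^(-i) x_ji; used twice, this gives x_ij = 2^(-i-j) x_ij, hence 0. *)
Let moment_recursion_uniq m m' : moment_recursion m -> moment_recursion m' ->
  m 0%N 0%N = m' 0%N 0%N -> forall i j, m i j = m' i j.
Proof.
move=> rm rm' m00; suff: forall n i j, (i + j <= n)%N -> m i j = m' i j.
  by move=> H i j; exact: (H (i + j)%N).
elim => [|n IH] i j; first by rewrite leqn0 addn_eq0 => /andP[/eqP -> /eqP ->].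
move=> ijn; have [ijn'|nij] := leqP (i + j) n; first exact: IH.
have red a b : (a + b <= n.+1)%N ->
    m a b - m' a b = 2^-1 ^+ a * (m b a - m' b a).
  move=> abn; rewrite rm rm' !big_ord_recr/= binn !mulr1n.
  have -> : \sum_(k < a) m b k *+ 'C(a, k) = \sum_(k < a) m' b k *+ 'C(a, k).
    apply: eq_bigr => k _; rewrite IH// -ltnS (leq_trans _ abn)//.
    by rewrite addnC ltn_add2r.
  by field.
have := red i j ijn; rewrite (red j i) 1?addnC//.
set x := m i j - m' i j => H.
suff : x = 0 by move=> /eqP; rewrite subr_eq0 => /eqP.
have : x * (1 - 2^-1 ^+ (i + j)) = 0 by rewrite exprD mulrBr mulr1 {1}H; ring.
move=> /eqP; rewrite mulf_eq0 => /orP[/eqP//|].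
rewrite subr_eq0 eq_sym => /eqP H1.
have : (2^-1 : R) ^+ (i + j) < 1.
  by rewrite exprn_ilt1// -?lt0n ?(leq_trans _ nij)//; lra.
by rewrite H1 ltxx.
Qed.

Let digits_moment i j := \int[U]_x (digits1 x ^+ i * digits2 x ^+ j).

Let expr01 (x : R) n : 0 <= x <= 1 -> 0 <= x ^+ n <= 1.
Proof. by move=> /andP[x0 x1]; rewrite exprn_ge0// exprn_ile1. Qed.

Let mulr01 (x y : R) : 0 <= x <= 1 -> 0 <= y <= 1 -> 0 <= x * y <= 1.
Proof. by move=> /andP[x0 x1] /andP[y0 y1]; rewrite mulr_ge0// mulr_ile1. Qed.

Let integrable_prod (f g : R -> R) i j : measurable_fun setT f -> measurable_fun setT g ->
  (forall x, 0 <= f x <= 1) -> (forall x, 0 <= g x <= 1) ->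
  U.-integrable setT (EFin \o (fun x => f x ^+ i * g x ^+ j)).
Proof.
move=> mf mg f01 g01; apply: (@bounded_integrable _ _ _ _ _ 1).
  by apply: measurable_funM; apply: measurable_funX.
move=> x; have /andP[? ?] := mulr01 (expr01 i (f01 x)) (expr01 j (g01 x)).
by rewrite ger0_norm.
Qed.

(** Binomial expansion under the integral, in the shape of the second term of [moment_recursion]. *)
Let sum_prod (f g : R -> R) i j : measurable_fun setT f -> measurable_fun setT g ->
  (forall x, 0 <= f x <= 1) -> (forall x, 0 <= g x <= 1) ->
  \int[U]_x (((1 + f x) / 2) ^+ i * g x ^+ j) =
  2^-1 ^+ i * \sum_(k < i.+1) (\int[U]_x (g x ^+ j * f x ^+ k)) *+ 'C(i, k).
Proof.
move=> mf mg f01 g01.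
have gen (r : seq nat) : U.-integrable setT (EFin \o
    (fun x => \sum_(k <- r) (g x ^+ j * f x ^+ k) *+ 'C(i, k))) /\
  \int[U]_x (\sum_(k <- r) (g x ^+ j * f x ^+ k) *+ 'C(i, k)) =
  \sum_(k <- r) (\int[U]_x (g x ^+ j * f x ^+ k)) *+ 'C(i, k).
  elim: r => [|k r [IH1 IH2]].
    split; last first.
      rewrite big_nil -[RHS](mul0r (fine (U setT))) -Rintegral_cst//.
      by apply: eq_Rintegral => x _; rewrite big_nil.
    have := @integrable0 _ _ R U setT.
    by apply: eq_integrable => // x _ /=; rewrite big_nil.
  have ik : U.-integrable setT (EFin \o (fun x => 'C(i, k)%:R * (g x ^+ j * f x ^+ k))).
    have := integrableZl measurableT 'C(i, k)%:R (integrable_prod j k mg mf g01 f01).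
    by apply: eq_integrable => // x _ /=; rewrite EFinM.
  have E x : \sum_(k0 <- k :: r) (g x ^+ j * f x ^+ k0) *+ 'C(i, k0) =
     'C(i, k)%:R * (g x ^+ j * f x ^+ k) + \sum_(k0 <- r) (g x ^+ j * f x ^+ k0) *+ 'C(i, k0).
    by rewrite big_cons mulr_natl.
  split.
    have := integrableD measurableT ik IH1.
    by apply: eq_integrable => // x _ /=; rewrite E EFinD.
  rewrite (eq_Rintegral U (fun x _ => E x)) RintegralD// IH2 big_cons; congr (_ + _).
  by rewrite RintegralZl ?mulr_natl//; exact: integrable_prod.
have [IH1 IH2] := gen (index_iota 0 i.+1).
rewrite -(big_mkord predT (fun k => (\int[U]_x (g x ^+ j * f x ^+ k)) *+ 'C(i, k))) -IH2.
rewrite -RintegralZl//; apply: eq_Rintegral => x _.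
rewrite big_mkord exprMn exprDn [LHS]mulrAC [LHS]mulrC; congr (_ * _).
rewrite [LHS]mulrC mulr_sumr.
by apply: eq_bigr => k _; rewrite expr1n mul1r mulrnAr.
Qed.

Let digits_moment_recursion : moment_recursion digits_moment.
Proof.
move=> i j; rewrite /digits_moment.
have m1 := measurable_digits1; have m2 := measurable_digits2.
have ge01 := digits1_ge0_le1; have ge02 := digits2_ge0_le1.
have half01 x : 0 <= (1 + digits2 x) / 2 <= 1 by have := ge02 x; lra.
rewrite (@Rintegral_uniform01_halves _ _
  (fun x => 2^-1 ^+ i * (digits1 x ^+ j * digits2 x ^+ i))
  (fun x => ((1 + digits2 x) / 2) ^+ i * digits1 x ^+ j) 1).
- rewrite RintegralZl//; last exact: integrable_prod.
  by congr ((_ + _) / _); rewrite sum_prod.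
- by apply: measurable_funM; apply: measurable_funX.
- by apply: measurable_funM => //; apply: measurable_funM; apply: measurable_funX.
- apply: measurable_funM; apply: measurable_funX => //.
  by apply: measurable_funM => //; apply: measurable_funD.
- by move=> x; apply: mulr01; exact: expr01.
- move=> x; rewrite mulr_ge0 ?exprn_ge0//.
  by have /andP[] := mulr01 (expr01 j (ge01 x)) (expr01 i (ge02 x)).
- move=> x.
  by have /andP[] := mulr01 (expr01 i (half01 x)) (expr01 j (ge01 x)).
- by move=> x /digits_half0[-> ->]; rewrite exprMn; ring.
- by move=> x /digits_half1[-> ->].
Qed.

(** The identity on the carrier [[0, 1[] of the uniform law, with values in [[0, 1]] on the whole
    line as the moment theorem requires. *)
Let clip (x : R) := Num.max 0 (Num.min 1 x).

Let clip01 x : 0 <= clip x <= 1.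
Proof. by rewrite /clip le_max lexx ge_max ler01 ge_min lexx. Qed.

Let measurable_clip : measurable_fun setT clip.
Proof. by apply: measurable_maxr => //; exact: measurable_minr. Qed.

Let clip_id x : 0 <= x < 1 -> clip x = x.
Proof. by move=> /andP[x0 x1]; rewrite /clip min_r ?max_r// ltW. Qed.

(** The trivial factor [clip x ^+ 0] gives the integrand the two-variable shape of [integrable_prod]
    and [sum_prod]. *)
Let uniform_moment i := \int[U]_x (clip x ^+ i * clip x ^+ 0).

(** Halving gives a recursion for one uniform variable; the other factor [uniform_moment j] is a
    constant and passes through. *)
Let prod_moment_recursion :
  moment_recursion (fun i j => uniform_moment i * uniform_moment j).
Proof.
move=> i j.
have mc := measurable_clip; have c01 := clip01.
have half0 x : 0 <= x < 1 -> clip (x / 2) = clip x / 2.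
  by move=> x01; rewrite !clip_id//; lra.
have half1 x : 0 <= x < 1 -> clip ((1 + x) / 2) = (1 + clip x) / 2.
  by move=> x01; rewrite !clip_id//; lra.
have half01 x : 0 <= (1 + clip x) / 2 <= 1 by have := clip01 x; lra.
have H : uniform_moment i =
   (2^-1 ^+ i * uniform_moment i +
     2^-1 ^+ i * \sum_(k < i.+1) (uniform_moment k) *+ 'C(i, k)) / 2.
  rewrite {1}/uniform_moment (@Rintegral_uniform01_halves _ _
    (fun x => 2^-1 ^+ i * (clip x ^+ i * clip x ^+ 0))
    (fun x => ((1 + clip x) / 2) ^+ i * clip x ^+ 0) 1).
  - rewrite RintegralZl//; last exact: integrable_prod.
    congr ((_ + _) / _); rewrite sum_prod//; congr (_ * _).
    apply: eq_bigr => k _; congr (_ *+ _).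
    by apply: eq_Rintegral => x _; rewrite mulrC.
  - by apply: measurable_funM; apply: measurable_funX.
  - by apply: measurable_funM => //; apply: measurable_funM; apply: measurable_funX.
  - apply: measurable_funM; apply: measurable_funX => //.
    by apply: measurable_funM => //; apply: measurable_funD.
  - by move=> x; apply: mulr01; exact: expr01.
  - move=> x; rewrite mulr_ge0 ?exprn_ge0//.
    by have /andP[] := mulr01 (expr01 i (clip01 x)) (expr01 0 (clip01 x)).
  - move=> x.
    by have /andP[] := mulr01 (expr01 i (half01 x)) (expr01 0 (clip01 x)).
  - by move=> x /half0 ->; rewrite exprMn !expr0; ring.
  - by move=> x /half1 ->; rewrite !expr0.
rewrite [X in X * _]H mulrAC; congr (_ / _); rewrite mulrDl -!mulrA; congr (_ + _).
  by congr (_ * _); rewrite mulrC.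
congr (_ * _); rewrite mulr_suml; apply: eq_bigr => k _.
by rewrite mulrnAl mulrC.
Qed.

Let digits_momentE i j : digits_moment i j = uniform_moment i * uniform_moment j.
Proof.
apply: (moment_recursion_uniq digits_moment_recursion prod_moment_recursion).
have one : \int[U]_x (cst 1 x) = 1.
  rewrite Rintegral_cst// mul1r; exact: (congr1 fine (probability_setT U)).
have um0 : uniform_moment 0 = 1.
  by rewrite -[RHS]one; apply: eq_Rintegral => x _; rewrite !expr0 mulr1.
rewrite um0 mulr1 -[RHS]one; apply: eq_Rintegral => x _.
by rewrite !expr0 mulr1.
Qed.

(** The mixed moments of the two digit families factor, so their joint law is a product of uniform
    laws. This yields independence without an infinite product space: [digits1] is spent on one
    variable, and [digits2] remains a full source for the next ones. *)
Lemma integral_digits (F : R * R -> \bar R) : measurable_fun setT F ->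
  (forall p, 0 <= F p)%E ->
  (\int[U]_x F (digits1 x, digits2 x) = \int[U]_x \int[U]_y F (x, y))%E.
Proof.
move=> mF F0.
have mc := measurable_clip.
have mclip2 : measurable_fun setT (fun p : R * R => (clip p.1, clip p.2)).
  apply: measurable_fun_pair; first exact: (measurableT_comp mc measurable_fst).
  exact: (measurableT_comp mc measurable_snd).
have md2 : measurable_fun setT (fun x : R => (digits1 x, digits2 x)).
  by apply: measurable_fun_pair; [exact: measurable_digits1|exact: measurable_digits2].
pose UU : probability (R * R)%type R := (U \x U)%E.
pose f : {RV U >-> (R * R)%type} := HB.pack (fun x : R => (digits1 x, digits2 x)) (isMeasurableFun.Build _ _ _ _ _ md2).
pose g : {RV UU >-> (R * R)%type} := HB.pack (fun p : R * R => (clip p.1, clip p.2)) (isMeasurableFun.Build _ _ _ _ _ mclip2).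
have -> : (\int[U]_x F (digits1 x, digits2 x) = \int[UU]_p F (clip p.1, clip p.2))%E.
  have := @ge0_integral_distribution _ _ _ _ _ U f F mF F0.
  have := @ge0_integral_distribution _ _ _ _ _ UU g F mF F0.
  rewrite /= => <- <-; apply: eq_measure_integral => A mA _.
  rewrite /= /distribution /pushforward /=.
  apply: (@eq_joint_distribution_moments _ _ _ _ _ U UU digits1 digits2
    (fun p => clip p.1) (fun p => clip p.2)) => //.
  - exact: measurable_digits1.
  - exact: measurable_digits2.
  - exact: (measurableT_comp mc measurable_fst).
  - exact: (measurableT_comp mc measurable_snd).
  - exact: digits1_ge0_le1.
  - exact: digits2_ge0_le1.
  - move=> i j; rewrite -/(digits_moment i j) digits_momentE /Rintegral.
    rewrite /UU fubini_tonelli1; last 2 first.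
    + apply/measurable_EFinP; apply: measurable_funM; apply: measurable_funX; exact: measurableT_comp.
    + move=> p; rewrite lee_fin.
      by have /andP[] := mulr01 (expr01 i (clip01 p.1)) (expr01 j (clip01 p.2)).
    have ic k : (\int[U]_y (clip y ^+ k)%:E = (uniform_moment k)%:E)%E.
      rewrite /uniform_moment /Rintegral fineK.
        by apply: eq_integral => y _; rewrite expr0 mulr1.
      by have := integrable_prod k 0 measurable_clip measurable_clip clip01 clip01; exact: integrable_fin_num.
    have mck k : measurable_fun setT (fun y : R => (clip y ^+ k)%:E).
      by apply/measurable_EFinP; apply: measurable_funX.
    have c0 k y : (0 <= (clip y ^+ k)%:E)%E.
      by rewrite lee_fin; have /andP[] := expr01 k (clip01 y).
    have um_ge0 : (0 <= (uniform_moment j)%:E)%E by rewrite -ic integral_ge0.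
    rewrite (eq_integral (fun x => (uniform_moment j)%:E * (clip x ^+ i)%:E)%E); last first.
      move=> x _; rewrite /fubini_F /= -ic muleC -ge0_integralZl//.
    by rewrite ge0_integralZl// ic -EFinM mulrC.
have mF2 : measurable_fun setT (fun p : R * R => F (clip p.1, clip p.2)).
  exact: (measurableT_comp mF mclip2).
(* After Tonelli, [clip] disappears because both integrals see [[0, 1[] only. *)
apply: (eq_trans (fubini_tonelli1 _ mF2 (fun p => F0 _))).
apply: eq_integral_uniform01.
- exact: measurable_fun_fubini_tonelli_F.
- by move=> x; exact: integral_ge0.
- exact: measurable_fun_fubini_tonelli_F.
- by move=> x; exact: integral_ge0.
move=> x x01; apply: eq_integral_uniform01 => //.
- exact: (measurableT_comp mF2 (measurable_pair1 x)).
- exact: (measurableT_comp mF (measurable_pair1 x)).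
- by move=> y y01 /=; rewrite !clip_id.
Qed.

End digits.

(** * The exponent delta as an integral over the jumps *)

Section layer_cake.
Context {R : realType}.
Notation mu := (@lebesgue_measure R).

(** Tonelli on the region [0 < u < Z x]. The weight [g] will carry the other factors of a product
    when independence is used. *)
Lemma layer_cake {d} {T : measurableType d} (m : {sigma_finite_measure set T -> \bar R})
    (g Z : T -> R) (k : R -> R) :
  measurable_fun setT g -> measurable_fun setT Z -> measurable_fun setT k ->
  (forall x, 0 <= g x) -> (forall u, 0 <= k u) ->
  (\int[m]_x ((g x)%:E * \int[mu]_(u in `]0%R, Z x[) (k u)%:E) =
   \int[mu]_(u in `]0%R, +oo[)
     ((k u)%:E * \int[m]_x (g x * \1_[set x | u < Z x]%R x)%:E))%E.
Proof.
move=> mg mZ mk g0 k0.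
pose f (p : T * measurableTypeR R) : \bar R :=
  (g p.1 * (k p.2 * (\1_(`]0, +oo[) p.2 * \1_([set p : T * R | p.2 < Z p.1]) p)))%:E.
have mf : measurable_fun setT f.
  apply/measurable_EFinP; apply: measurable_funM.
    exact: (measurableT_comp mg measurable_fst).
  apply: measurable_funM; first exact: (measurableT_comp mk measurable_snd).
  apply: measurable_funM.
    by apply: measurableT_comp => //; exact: measurable_indic.
  apply: measurable_indic; apply: measurable_ltr_set.
    exact: measurable_snd.
  exact: (measurableT_comp mZ measurable_fst).
have f0 p : (0 <= f p)%E by rewrite lee_fin !mulr_ge0.
have i1 (u : R) : \1_(`]0, +oo[%classic) u = (0 < u)%R%:R :> R.
  by rewrite indicE mem_setE in_itv/= andbT.
have i2 x u : \1_([set p : T * R | p.2 < Z p.1]) (x, u) = (u < Z x)%R%:R :> R.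
  by rewrite indicE; congr ((nat_of_bool _)%:R); apply/idP/idP; rewrite inE.
have i3 x u : \1_[set x | u < Z x] x = (u < Z x)%R%:R :> R.
  by rewrite indicE; congr ((nat_of_bool _)%:R); apply/idP/idP; rewrite inE.
have fE x u : f (x, u) = (g x * (k u * ((0 < u)%R%:R * (u < Z x)%R%:R)))%:E.
  by rewrite /f i1 i2.
have := @fubini_tonelli _ _ T (measurableTypeR R) R m mu f mf f0.
rewrite /fubini_F /fubini_G => H.
transitivity (\int[m]_x \int[mu]_y f (x, y))%E.
  apply: eq_integral => x _; rewrite -ge0_integralZl//; last 3 first.
  - by apply/measurable_EFinP; exact: measurable_funTS.
  - by move=> u _; rewrite lee_fin.
  - by rewrite lee_fin.
  rewrite integral_mkcond; apply: eq_integral => u _.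
  rewrite fE patchE mem_setE in_itv/=.
  by case: (0 < u); case: (u < Z x); rewrite /= ?mulr0 ?mul0r ?mulr1 ?mulr0 ?EFinM.
rewrite H [RHS]integral_mkcond; apply: eq_integral => u _.
rewrite patchE mem_setE in_itv/= andbT; case: ifPn => [u0|/negbTE u0]; last first.
  by apply: integral0_eq => x _; rewrite fE u0 mul0r !mulr0.
rewrite -ge0_integralZl//; last 3 first.
- apply/measurable_EFinP; apply: measurable_funM => //; apply: measurable_indic.
  exact: measurable_ltr_set.
- by move=> x _; rewrite lee_fin mulr_ge0.
- by rewrite lee_fin.
apply: eq_integral => x _; rewrite fE u0 mul1r -EFinM i3; congr (_%:E).
by rewrite mulrCA.
Qed.

(** The derivative in [u] of [1 - expR (- (p * u ^+ 2 + 2 * c * u))]. For [p = 1] it is, up to the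
    power factor, the integrand of [delta] with its square completed; for [p = 0] and [c = 2^-1] it
    is the exponential density. *)
Definition quad_kernel (p c u : R) : R :=
  2 * (p * u + c) * expR (- (p * u ^+ 2 + 2 * c * u)).

Lemma measurable_quad_kernel p c : measurable_fun setT (quad_kernel p c).
Proof.
apply: measurable_funM.
  by apply: measurable_funM => //; apply: measurable_funD => //; exact: measurable_funM.
apply: measurableT_comp => //; apply: measurableT_comp => //.
apply: measurable_funD; apply: measurable_funM => //; exact: measurable_funX.
Qed.

Lemma continuous_quad_kernel p c : continuous (quad_kernel p c).
Proof.
move=> x; rewrite /quad_kernel; apply: cvgM.
  apply: cvgM; first exact: cvg_cst.
  by apply: cvgD; [apply: cvgM; [exact: cvg_cst|exact: cvg_id]|exact: cvg_cst].
apply: continuous_comp; last exact: continuous_expR.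
apply: cvgN; apply: cvgD; apply: cvgM; try exact: cvg_cst; last exact: cvg_id.
exact: exprn_continuous.
Qed.

Lemma integral_quad_kernel p c z : 0 <= p -> 0 <= c -> 0 <= z ->
  (\int[mu]_(u in `]0%R, z[) (quad_kernel p c u)%:E =
   (1 - expR (- (p * z ^+ 2 + 2 * c * z)))%:E)%E.
Proof.
move=> p0 c0; rewrite le_eqVlt => /predU1P[<-|z0].
  by rewrite set_itvoo0 integral_set0 expr0n/= !mulr0 addr0 oppr0 expR0 subrr.
pose F u := - expR (- (p * u ^+ 2 + 2 * c * u)).
have cF : continuous F.
  move=> x; apply: cvgN; apply: continuous_comp; last exact: continuous_expR.
  apply: cvgN; apply: cvgD; apply: cvgM; try exact: cvg_cst; last exact: cvg_id.
  exact: exprn_continuous.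
have dF x : is_derive x (1 : R) F (quad_kernel p c x).
  rewrite /F /quad_kernel.
  apply: is_derive_eq; rewrite /GRing.scale /=; ring.
rewrite integral_itv_obnd_cbnd; last first.
  by apply/measurable_EFinP; apply: measurable_funTS; exact: measurable_quad_kernel.
rewrite integral_itv_bndo_bndc; last first.
  by apply/measurable_EFinP; apply: measurable_funTS; exact: measurable_quad_kernel.
rewrite (@continuous_FTC2 _ _ F)//.
- rewrite /F expr0n/= !mulr0 addr0 oppr0 expR0 -EFinB; congr (_%:E); ring.
- by apply: continuous_subspaceT; exact: continuous_quad_kernel.
- split.
  + by move=> x _; have [] := dF x.
  + by apply: cvg_at_right_filter; exact: cF.
  + by apply: cvg_at_left_filter; exact: cF.
- by move=> x _; rewrite derive1E; have [] := dF x.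
Qed.

Lemma quad_kernel_ge0 p c u : 0 <= p -> 0 <= c -> 0 <= u -> 0 <= quad_kernel p c u.
Proof.
by move=> p0 c0 u0; rewrite mulr_ge0 ?expR_ge0// mulr_ge0// addr_ge0// mulr_ge0.
Qed.

Lemma laplace_layer_cake {d} {T : measurableType d}
    (m : {sigma_finite_measure set T -> \bar R}) (g Z : T -> R) (p c : R) :
  0 <= p -> 0 <= c ->
  measurable_fun setT g -> measurable_fun setT Z ->
  (forall x, 0 <= g x) -> (forall x, 0 <= Z x) ->
  (\int[m]_x (g x * (1 - expR (- (p * Z x ^+ 2 + 2 * c * Z x))))%:E =
   \int[mu]_(u in `]0%R, +oo[)
     ((quad_kernel p c u)%:E * \int[m]_x (g x * \1_[set x | u < Z x]%R x)%:E))%E.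
Proof.
move=> p0 c0 mg mZ g0 Z0.
(* [layer_cake] asks for a kernel nonnegative on the whole line, while only [u > 0] is
   integrated. *)
pose k u := Num.max 0 (quad_kernel p c u).
have kE u : 0 <= u -> k u = quad_kernel p c u.
  by move=> u0; rewrite /k max_r// quad_kernel_ge0.
have mk : measurable_fun setT k.
  by apply: measurable_maxr => //; exact: measurable_quad_kernel.
transitivity (\int[m]_x ((g x)%:E * \int[mu]_(u in `]0%R, Z x[) (k u)%:E))%E.
  apply: eq_integral => x _; rewrite EFinM -integral_quad_kernel//; congr (_ * _)%E.
  by apply: eq_integral => u; rewrite inE/= in_itv/= => /andP[u0 _]; rewrite kE// ltW.
rewrite layer_cake//; last by move=> u; rewrite /k le_max lexx.
by apply: eq_integral => u; rewrite inE/= in_itv/= andbT => u0; rewrite kE// ltW.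
Qed.

End layer_cake.

(** * Integrals of powers against the kernel *)

Section powR_integrals.
Context {R : realType}.
Notation mu := (@lebesgue_measure R).
Implicit Types (x y u rho p c b : R).

Lemma ltr_powR_inv x y rho : 0 < x -> 0 < y -> 0 < rho ->
  (x < y `^ (- rho^-1)) = (y < x `^ (- rho)).
Proof.
move=> x0 y0 rho0.
rewrite -ltr_ln ?posrE ?powR_gt0// -[RHS]ltr_ln ?posrE ?powR_gt0// !ln_powR.
rewrite -(ltr_pM2l rho0) mulrA mulrN mulfV ?gt_eqF// mulN1r ltrNr mulNr.
by [].
Qed.

Lemma is_derive_continuous (f : R -> R) x (df : R) :
  is_derive x (1 : R) f df -> f y @[y --> x] --> f x.
Proof.
by move=> [dfx _]; apply: differentiable_continuous; exact/derivable1_diffP.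
Qed.

Lemma cvgr_powRNy r : 0 < r -> y `^ (- r) @[y --> +oo] --> (0 : R).
Proof.
move=> r0; apply/cvgrPdist_le => e e0; near=> y.
have y0 : 0 < y by near: y; exact: nbhs_pinfty_gt.
rewrite sub0r normrN ger0_norm ?powR_ge0//.
rewrite leNgt -[r]invrK ltr_powR_inv ?invr_gt0// -leNgt.
by near: y; apply: nbhs_pinfty_ge; exact: num_real.
Unshelve. all: by end_near. Qed.

Lemma integral_powRN_lty b : 1 < b ->
  (\int[mu]_(y in `[1%R, +oo[) (y `^ (- b))%:E < +oo)%E.
Proof.
move=> b1; have b0 : 0 < b - 1 by rewrite subr_gt0.
have isd y : 0 < y -> is_derive y (1 : R) (fun y => - (b - 1)^-1 * y `^ (- (b - 1))) (y `^ (- b)).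
  move=> y0; have H := is_derive1_powR (- (b - 1)) y0.
  apply: is_derive_eq; rewrite /GRing.scale /=.
  have -> : - (b - 1) - 1 = - b by ring.
  by field; rewrite gt_eqF.
rewrite (@ge0_continuous_FTC2y _ _ (fun y => - (b - 1)^-1 * y `^ (- (b - 1))) _ 0).
- by rewrite -EFinB ltry.
- by move=> y _; exact: powR_ge0.
- apply: continuous_in_subspaceT => y; rewrite inE/= in_itv/= andbT => y1.
  have y0 : 0 < y by apply: lt_le_trans y1.
  exact: is_derive_continuous (is_derive1_powR (- b) y0).
- rewrite -[X in _ --> X](mulr0 (- (b - 1)^-1)); apply: cvgM; first exact: cvg_cst.
  exact: cvgr_powRNy.
- by move=> y y1; have [] := isd y (lt_trans ltr01 y1).
- by apply: cvg_at_right_filter; exact: is_derive_continuous (isd 1 ltr01).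
- move=> y; rewrite in_itv/= andbT => y1; rewrite derive1E.
  by have [] := isd y (lt_trans ltr01 y1).
Qed.

(** The primitive tends to 0 at infinity: for [u >= 1] its absolute value is at most
    [expR (- ((p + 2 * c) * u))], whence the strict condition. *)
Lemma integral_quad_kernel_lty p c : 0 <= p -> 0 <= c -> 0 < p + 2 * c ->
  (\int[mu]_(u in `]0%R, +oo[) (quad_kernel p c u)%:E < +oo)%E.
Proof.
move=> p0 c0 pc0.
pose F u := - expR (- (p * u ^+ 2 + 2 * c * u)).
have dF x : is_derive x (1 : R) F (quad_kernel p c x).
  rewrite /F /quad_kernel.
  by apply: is_derive_eq; rewrite /GRing.scale /=; ring.
rewrite integral_itv_obnd_cbnd; last first.
  by apply/measurable_EFinP; apply: measurable_funTS; exact: measurable_quad_kernel.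
rewrite (@ge0_continuous_FTC2y _ _ F _ 0).
- by rewrite -EFinB ltry.
- by move=> y y0; exact: quad_kernel_ge0.
- by apply: continuous_subspaceT; exact: continuous_quad_kernel.
- rewrite -oppr0; apply: cvgN; apply: (@squeeze_cvgr _ _ _ _ (fun=> 0) (fun u => expR (- ((p + 2 * c) * u)))).
  + near=> u; rewrite expR_ge0/= ler_expR lerN2 mulrDl lerD2r ler_wpM2l//.
    by rewrite expr2 ler_pMr//; near: u; apply: nbhs_pinfty_ge; exact: num_real.
  + exact: cvg_cst.
  + have H : (p + 2 * c) * u @[u --> +oo] --> +oo by apply: gt0_cvgMry => //; exact: cvg_id.
    exact: (cvg_comp _ _ H (@cvgr_expR R)).
- by move=> x _; have [] := dF x.
- by apply: cvg_at_right_filter; exact: is_derive_continuous (dF 0).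
- by move=> x _; rewrite derive1E; have [] := dF x.
Unshelve. all: by end_near. Qed.

(** Layer cake for Lebesgue measure on the half-line and the decreasing function b y^(-1/rho), whose
    superlevel set at [u] is an interval of length (u/b)^(-rho). *)
Lemma integral_quad_kernel_powR b c rho : 0 < b -> 0 <= c -> 0 < rho ->
  (\int[mu]_(u in `]0%R, +oo[) (quad_kernel 1 c u * (u / b) `^ (- rho))%:E =
   \int[mu]_(y in `]0%R, +oo[)
     (1 - expR (- ((b * y `^ (- rho^-1)) ^+ 2 + 2 * c * (b * y `^ (- rho^-1)))))%:E)%E.
Proof.
move=> b0 c0 rho0.
pose Z (y : measurableTypeR R) : R := b * y `^ (- rho^-1).
have mZ : measurable_fun setT Z.
  by apply: measurable_funM => //; exact: measurable_powR.
have mg : measurable_fun setT (\1_(`]0, +oo[%classic) : measurableTypeR R -> R).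
  exact: measurable_indic.
have Z0 y : 0 <= Z y by rewrite mulr_ge0 ?powR_ge0// ltW.
have := @laplace_layer_cake R _ (measurableTypeR R) mu _ Z 1 c ler01 c0 mg mZ _ Z0.
move=> /(_ (fun=> ler0n _ _)) H; apply/esym.
rewrite integral_mkcond; transitivity (\int[mu]_y (\1_(`]0, +oo[%classic) y *
  (1 - expR (- (1 * Z y ^+ 2 + 2 * c * Z y))))%:E)%E.
  apply: eq_integral => y _; rewrite patchE indicE; case: ifPn => _; rewrite ?mul1r//.
  by rewrite mul0r.
rewrite H; apply: eq_integral => u; rewrite inE/= in_itv/= andbT => u0.
rewrite [RHS]EFinM; congr (_ * _)%E.
have ub0 : 0 < u / b by rewrite divr_gt0.
transitivity (\int[mu]_y (\1_(`]0%R, (u / b) `^ (- rho)[%classic) y)%:E)%E.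
  apply: eq_integral => y _.
  transitivity ((\1_(`]0, +oo[ `&` [set x | u < Z x]) y : R)%:E); first by rewrite indicI.
  congr ((\1_(_) _)%:E).
  apply/seteqP; split => t /=; rewrite !in_itv/= ?andbT.
    by move=> [t0 H1]; rewrite t0 -ltr_powR_inv// ltr_pdivrMr// mulrC.
  move=> /andP[t0]; rewrite t0 -ltr_powR_inv// ltr_pdivrMr// mulrC.
  by [].
have := lebesgue_measure_itv (`]0, (u / b) `^ (- rho)[) .
rewrite /= lte_fin powR_gt0// oppr0 adde0 => <-.
by rewrite integral_indic// setIT.
Qed.

(** In the variable [y] the integrand is at most 1 on []0, 1[] and at most a multiple of y^(-1/rho)
    on [[1, +oo[], which is integrable there because [rho < 1]. *)
Lemma integral_quad_kernel_powR_lty b c rho : 0 < b -> 0 <= c -> 0 < rho < 1 ->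
  (\int[mu]_(u in `]0%R, +oo[) (quad_kernel 1 c u * (u / b) `^ (- rho))%:E < +oo)%E.
Proof.
move=> b0 c0 /andP[rho0 rho1]; rewrite integral_quad_kernel_powR//.
have rhoV : 1 < rho^-1 by rewrite invf_gt1.
have mpow : measurable_fun setT (fun y : R => y `^ (- rho^-1)) by exact: measurable_powR.
pose G y := (b * y `^ (- rho^-1)) ^+ 2 + 2 * c * (b * y `^ (- rho^-1)).
have G0 y : 0 <= G y.
  by rewrite addr_ge0 ?sqr_ge0// !mulr_ge0// ?powR_ge0// ltW.
have mG : measurable_fun setT (fun y => (1 - expR (- G y))%:E).
  apply/measurable_EFinP; apply: measurable_funB => //.
  apply: measurableT_comp => //; apply: measurableT_comp => //.
  apply: measurable_funD; last by apply: measurable_funM => //; exact: measurable_funM.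
  by apply: measurable_funX; exact: measurable_funM.
have e01 y : 0 <= 1 - expR (- G y) <= 1.
  by rewrite subr_ge0 expR_le1 oppr_le0 G0/= lerBlDr lerDl expR_ge0.
have -> : `]0, +oo[%classic = `]0, 1[ `|` `[1, +oo[ :> set R.
  by rewrite -itv_bndbnd_setU// bnd_simp.
rewrite ge0_integral_setU//=; last 3 first.
- exact: measurable_funTS.
- by move=> y _; rewrite lee_fin; have /andP[] := e01 y.
- apply/disj_setPS => y [/=]; rewrite !in_itv/= andbT => /andP[_ y1] /(lt_le_trans y1).
  by rewrite ltxx.
apply: lte_add_pinfty.
  apply: (@le_lt_trans _ _ (\int[mu]_(y in `]0%R, 1%R[) 1)%E).
    apply: ge0_le_integral => //.
    - by move=> y _; rewrite lee_fin; have /andP[] := e01 y.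
    - exact: measurable_funTS.
    - by move=> y _; rewrite lee_fin; have /andP[] := e01 y.
  by rewrite integral_cst//= mul1e lebesgue_measure_itv/= lte_fin ltr01 oppr0 adde0 ltry.
apply: (@le_lt_trans _ _ (\int[mu]_(y in `[1%R, +oo[) ((b ^+ 2 + 2 * c * b) * y `^ (- rho^-1))%:E)%E).
  apply: ge0_le_integral => //.
  - by move=> y _; rewrite lee_fin; have /andP[] := e01 y.
  - exact: measurable_funTS.
  - by apply: measurable_funTS; apply/measurable_EFinP; exact: measurable_funM.
  - move=> y /=; rewrite in_itv/= andbT => y1; rewrite lee_fin.
    apply: (@le_trans _ _ (G y)).
      by have := expR_ge1Dx (- G y); lra.
    have p1 : y `^ (- rho^-1) <= 1.
      by rewrite -[leRHS](powRr0 y) ler_powR// oppr_le0 invr_ge0 ltW.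
    rewrite /G [leRHS]mulrDl; apply: lerD; last by rewrite mulrA.
    rewrite exprMn ler_wpM2l ?sqr_ge0// expr2 ler_piMr ?powR_ge0//.
under eq_integral do rewrite EFinM.
rewrite ge0_integralZl//=.
- apply: lte_mul_pinfty => //.
  + by rewrite lee_fin addr_ge0 ?sqr_ge0// !mulr_ge0// ltW.
  + exact: integral_powRN_lty.
- by apply: measurable_funTS; exact/measurable_EFinP.
- by move=> y _; rewrite lee_fin powR_ge0.
- by rewrite lee_fin addr_ge0 ?sqr_ge0// !mulr_ge0// ltW.
Qed.

End powR_integrals.

Lemma powR_invN {R : realType} (x r : R) : 0 <= x -> x^-1 `^ (- r) = x `^ r.
Proof. by move=> x0; rewrite -powR_inv1// -powRrM mulrNN mul1r. Qed.

Section delta.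
Context {R : realType}.
Notation mu := (@lebesgue_measure R).
Variables (alpha r s : R).
Hypotheses (alpha01 : 0 < alpha < 1) (r0 : 0 < r) (s0 : 0 <= s).

Let c := s / (2 * Num.sqrt r).

Let sr0 : 0 < Num.sqrt r. Proof. by rewrite sqrtr_gt0. Qed.

Let c0 : 0 <= c. Proof. by rewrite divr_ge0// mulr_ge0// ltW. Qed.

(** Completion of the square, with c^2 = s^2 / (4 r). Finiteness has to come first: the real-valued
    integral in [delta] would read an infinite value as 0. *)
Lemma deltaE : (delta alpha r s)%:E =
  (\int[mu]_(u in `]0%R, +oo[)
     (quad_kernel 1 (s / (2 * Num.sqrt r)) u * (u / Num.sqrt r) `^ (- alpha))%:E)%E.
Proof.
have := @integral_quad_kernel_powR_lty R _ _ _ sr0 c0 alpha01; rewrite -/c.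
pose h u := expR (- (u + c) ^+ 2) * (u + c) * (u / Num.sqrt r) `^ (- alpha).
have h0 u : 0 < u -> 0 <= h u.
  by move=> u0; rewrite /h mulr_ge0 ?powR_ge0// mulr_ge0 ?expR_ge0// addr_ge0 ?c0// ltW.
have mh : measurable_fun setT h.
  apply: measurable_funM; last first.
    apply: (measurableT_comp (measurable_powR (R := R) (- alpha))).
    exact: measurable_funM.
  apply: measurable_funM; last exact: measurable_funD.
  apply: measurableT_comp => //; apply: measurableT_comp => //.
  by apply: measurable_funX; exact: measurable_funD.
pose K := 2 * expR (s ^+ 2 / (4 * r)).
have K0 : 0 < K by rewrite mulr_gt0// expR_gt0.
have cE : c ^+ 2 = s ^+ 2 / (4 * r).
  rewrite /c expr_div_n exprMn sqr_sqrtr ?ltW//; congr (_ / (_ * _)); ring.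
have -> : (\int[mu]_(u in `]0%R, +oo[) (quad_kernel 1 c u * (u / Num.sqrt r) `^ (- alpha))%:E
   = K%:E * \int[mu]_(u in `]0%R, +oo[) (h u)%:E)%E.
  rewrite -ge0_integralZl//=; last 3 first.
  - by apply: measurable_funTS; exact/measurable_EFinP.
  - by move=> u; rewrite /= in_itv/= andbT => u0; rewrite lee_fin h0.
  - by rewrite lee_fin ltW.
  apply: eq_integral => u _; rewrite -EFinM /K /h -cE; congr (_%:E).
  rewrite /quad_kernel.
  have -> : - (1 * u ^+ 2 + 2 * c * u) = c ^+ 2 + (- (u + c) ^+ 2) by ring.
  rewrite expRD; ring.
have : (0 <= \int[mu]_(u in `]0%R, +oo[) (h u)%:E)%E.
  by apply: integral_ge0 => u; rewrite /= in_itv/= andbT => u0; rewrite lee_fin h0.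
rewrite /delta /Rintegral -/c -/K -/h.
case: (\int[mu]_(u in `]0%R, +oo[) (h u)%:E)%E => [v|_|//] //.
by rewrite gt0_muley ?lte_fin// ltxx.
Qed.

Definition jump_weight y := r * y `^ (- alpha^-1) ^+ 2 + s * y `^ (- alpha^-1).

(** The substitution has [b = Num.sqrt r], so that [b ^+ 2 = r] and [2 * c * b = s]. *)
Lemma delta_jump_weight : (delta alpha r s)%:E =
  (\int[mu]_(y in `]0%R, +oo[) (1 - expR (- jump_weight y))%:E)%E.
Proof.
have [a0 _] := andP alpha01.
rewrite deltaE (integral_quad_kernel_powR sr0 c0 a0); apply: eq_integral => y _.
congr ((1 - expR (- _))%:E); rewrite /jump_weight exprMn sqr_sqrtr ?ltW//; congr (_ + _).
by rewrite mulrA; congr (_ * _); rewrite /c; field; rewrite gt_eqF.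
Qed.

Lemma delta_ge0 : 0 <= delta alpha r s.
Proof.
rewrite -lee_fin delta_jump_weight integral_ge0// => y _.
rewrite lee_fin subr_ge0 expR_le1 oppr_le0 addr_ge0// mulr_ge0 ?sqr_ge0 ?powR_ge0//.
exact: ltW.
Qed.

End delta.

(** The ratio [s / (2 * Num.sqrt r)] is unchanged, and only the factor (u / sqrt r)^(-alpha) picks
    up [lam]. A mixture over [Lambda] thus becomes a random rescaling of one fixed pair. *)
Lemma delta_scale {R : realType} (alpha r s lam : R) :
  0 < alpha < 1 -> 0 < r -> 0 <= s -> 0 < lam ->
  delta alpha (r * lam `^ alpha^-1 ^+ 2) (s * lam `^ alpha^-1) = lam * delta alpha r s.
Proof.
move=> alpha01 r0 s0 lam0; have [a0 _] := andP alpha01.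
set k := lam `^ alpha^-1; have k0 : 0 < k by rewrite powR_gt0.
have kA : k `^ alpha = lam by rewrite /k -powRrM mulVf ?gt_eqF// powRr1// ltW.
have sr0 : 0 < Num.sqrt r by rewrite sqrtr_gt0.
have rk0 : 0 < r * k ^+ 2 by rewrite mulr_gt0// exprn_gt0.
have sk0 : 0 <= s * k by rewrite mulr_ge0// ltW.
have := deltaE alpha01 r0 s0; have := deltaE alpha01 rk0 sk0.
move: (delta _ _ _) (delta _ _ _) => D' D.
rewrite sqrtrM ?ltW// sqrtr_sqr ger0_norm ?ltW// => D'E DE.
apply/eqP; rewrite -eqe EFinM D'E DE; apply/eqP.
have -> : s * k / (2 * (Num.sqrt r * k)) = s / (2 * Num.sqrt r).
  by field; rewrite !gt_eqF.
have c0 : 0 <= s / (2 * Num.sqrt r) by rewrite divr_ge0// mulr_ge0// ltW.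
rewrite -ge0_integralZl; last 4 first.
- exact: measurable_itv.
- apply: measurable_funTS; apply/measurable_EFinP; apply: measurable_funM.
    exact: measurable_quad_kernel.
  apply: (measurableT_comp (measurable_powR (R := R) (- alpha))).
  exact: measurable_funM.
- move=> u; rewrite /= in_itv/= andbT => u0; rewrite lee_fin mulr_ge0 ?powR_ge0//.
  by rewrite quad_kernel_ge0// ltW.
- by rewrite lee_fin ltW.
apply: eq_integral => u; rewrite inE/= in_itv/= andbT => u0.
rewrite -EFinM mulrCA; congr ((_ * _)%:E).
have -> : u / (Num.sqrt r * k) = u / Num.sqrt r * k^-1 by field; rewrite !gt_eqF.
rewrite powRM ?divr_ge0 ?invr_ge0 ?ltW// mulrC; congr (_ * _).
by rewrite powR_invN ?(ltW k0).
Qed.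

(** * Regular variation and the transform of a single observation *)

Section regular_variation.
Context {R : realType}.
Variables (G ell : R -> R) (alpha : R).
Hypothesis alpha0 : 0 < alpha.
Hypothesis G_ni : forall x y, x <= y -> G y <= G x.
Hypothesis G_le1 : forall x, G x <= 1.
Hypothesis sv : slowly_varying ell.
Hypothesis G_ell : G x / (x `^ (- alpha) * ell x) @[x --> +oo] --> (1 : R).

Lemma slowly_varying_gt0_near : \forall x \near +oo, 0 < x `^ (- alpha) * ell x.
Proof.
have [[A [_ ellA]] _] := sv.
near=> x; rewrite mulr_gt0//.
  by rewrite powR_gt0//; near: x; exact: nbhs_pinfty_gt.
by apply: ellA; near: x; apply: nbhs_pinfty_ge; exact: num_real.
Unshelve. all: by end_near. Qed.

(** Positivity near infinity propagates downwards by monotonicity, so the quotients by [G] below are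
    genuine. *)
Lemma regularly_varying_gt0 x : 0 < G x.
Proof.
have H : \forall y \near +oo, 0 < G y.
  near=> y.
  have e0 : 0 < y `^ (- alpha) * ell y by near: y; exact: slowly_varying_gt0_near.
  suff : 0 < G y / (y `^ (- alpha) * ell y) by rewrite pmulr_lgt0 ?invr_gt0.
  by near: y; exact: (cvgr_gt _ G_ell _ ltr01).
have [y [xy Gy]] : exists y, x <= y /\ 0 < G y.
  have : \forall y \near +oo, x <= y /\ 0 < G y.
    near=> y; split; last by near: y.
    by near: y; apply: nbhs_pinfty_ge; exact: num_real.
  by move=> /pinfty_ex_gt0[y _ ?]; exists y.
exact: (lt_le_trans Gy (G_ni xy)).
Unshelve. all: by end_near. Qed.

Lemma regularly_varying_ratio lam : 0 < lam ->
  G (lam * x) / G x @[x --> +oo] --> lam `^ (- alpha).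
Proof.
move=> lam0; have [_ /(_ _ lam0) ell_lam] := sv.
have lamy : lam * x @[x --> +oo] --> +oo by apply: gt0_cvgMry => //; exact: cvg_id.
have G_lam := cvg_comp _ _ lamy G_ell.
have -> : lam `^ (- alpha) = 1 * lam `^ (- alpha) * 1 * 1^-1 by rewrite invr1 !mulr1 mul1r.
have H : G (lam * x) / ((lam * x) `^ (- alpha) * ell (lam * x)) * lam `^ (- alpha) *
    (ell (lam * x) / ell x) * (G x / (x `^ (- alpha) * ell x))^-1 @[x --> +oo] -->
    1 * lam `^ (- alpha) * 1 * 1^-1.
  apply: cvgM; last by apply: cvgV => //; exact: oner_neq0.
  by apply: cvgM => //; apply: cvgM => //; exact: cvg_cst.
apply: cvg_trans H; apply: near_eq_cvg; near=> x.
have e0 : 0 < x `^ (- alpha) * ell x by near: x; exact: slowly_varying_gt0_near.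
have el0 : 0 < (lam * x) `^ (- alpha) * ell (lam * x).
  by near: x; exact: (lamy _ slowly_varying_gt0_near).
have x0 : 0 < x by near: x; exact: nbhs_pinfty_gt.
have G0 := regularly_varying_gt0 x.
have xa : 0 < x `^ (- alpha) by exact: powR_gt0.
have la : 0 < lam `^ (- alpha) by exact: powR_gt0.
move: e0 el0; rewrite /= powRM ?ltW//.
rewrite pmulr_rgt0// => e0; rewrite pmulr_rgt0 ?mulr_gt0// => el0.
by field; rewrite !gt_eqF.
Unshelve. all: by end_near. Qed.

(* Iterating [G (x / 2) <= 2 `^ rho * G x] down from [x]. *)
Lemma potter_bound rho : alpha < rho -> exists A C, [/\ 0 < A, 0 < C &
  forall x y, A <= x -> 0 < y <= 1 -> G (x * y) <= C * y `^ (- rho) * G x].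
Proof.
move=> arho.
have rho0 : 0 < rho by exact: lt_trans arho.
have p21 : 1 < (2 : R) `^ rho.
  by rewrite -[ltLHS](powRr0 2) /powR gt_eqF// ltr_expR mul0r mulr_gt0// ln_gt0// ltr1n.
(* The limit of G(x/2) / G(x) is 2^alpha, strictly below 2^rho: this margin is what [alpha < rho]
   buys. *)
have lt2 : (2^-1 : R) `^ (- alpha) < 2 `^ rho.
  rewrite -[2^-1]powR_inv1// -powRrM mulrNN mul1r /powR gt_eqF// ltr_expR.
  by rewrite ltr_pM2r// ln_gt0// ltr1n.
have H : \forall x \near +oo, G (2^-1 * x) / G x <= 2 `^ rho.
  have h2 : (0 < 2^-1 :> R) by rewrite invr_gt0.
  exact: (cvgr_le _ (regularly_varying_ratio h2) _ lt2).
have [B [_ HB]] := H.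
pose A := Num.max B 0 + 1.
have A0 : 0 < A by rewrite ltr_wpDl// le_max lexx orbT.
have HA x : A <= x -> G (x / 2) <= 2 `^ rho * G x.
  move=> Ax; have /HB : B < x.
    by apply: lt_le_trans Ax; rewrite /A ltr_pwDr// le_max lexx.
  by rewrite /= ler_pdivrMr ?regularly_varying_gt0// mulrC.
(* Once halving leads below [A], the only bound left is [G <= 1]; it is compensated by
   [C0 * G x >= 1] for [x <= 2 * A]. *)
pose C0 := (G (2 * A))^-1.
have C00 : 0 < C0 by rewrite invr_gt0 regularly_varying_gt0.
have C0G x : x <= 2 * A -> 1 <= C0 * G x.
  move=> xA; rewrite mulrC ler_pdivlMr ?regularly_varying_gt0// mul1r.
  exact: G_ni.
have C01 : 1 <= C0.
  rewrite -(ler_pM2r (regularly_varying_gt0 (2 * A))) mul1r mulVf//.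
  by rewrite gt_eqF// regularly_varying_gt0.
have step k x : A <= x -> G (x / 2 ^+ k) <= C0 * (2 `^ rho) ^+ k * G x.
  elim: k x => [|k IH] x Ax.
    by rewrite expr0 divr1 mulr1 ler_peMl// ltW// regularly_varying_gt0.
  have [Ax2|xA] := leP A (x / 2).
    have -> : x / 2 ^+ k.+1 = x / 2 / 2 ^+ k by rewrite exprS invfM mulrA.
    apply: (le_trans (IH _ Ax2)); rewrite exprSr mulrA -[leRHS]mulrA ler_wpM2l//.
      by rewrite mulr_ge0 ?exprn_ge0 ?powR_ge0// ltW.
    exact: HA.
  apply: (le_trans (G_le1 _)).
  have xA2 : x <= 2 * A by lra.
  apply: (le_trans (C0G _ xA2)); rewrite ler_pM2r ?regularly_varying_gt0//.
  by rewrite ler_peMr ?(ltW C00)// exprn_ege1// ltW.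
exists A, (C0 * 2 `^ rho); split => //; first by rewrite mulr_gt0// powR_gt0.
move=> x y Ax /andP[y0 y1].
have x0 : 0 < x by exact: lt_le_trans Ax.
(* The least such [k] satisfies [2 ^+ k <= y^-1], so the power of 2^rho exceeds y^(-rho) by at most
   one factor, which enters the constant. *)
have ex : exists k : nat, y^-1 < 2 ^+ k.+1.
  exists (Num.truncn y^-1); apply: (lt_le_trans (truncnS_gt _)).
  by rewrite -natrX ler_nat ltnW// ltn_expl.
have [k ky kmin] := ex_minnP ex.
have yk : 2 ^+ k <= y^-1.
  case: k ky kmin => [_ _|k ky kmin]; first by rewrite expr0 invf_ge1.
  by rewrite leNgt; apply/negP => /kmin; rewrite ltnn.
apply: (@le_trans _ _ (G (x / 2 ^+ k.+1))).
  apply: G_ni; rewrite ler_wpM2l ?(ltW x0)// ltW// invf_plt ?posrE ?exprn_gt0//.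
apply: (le_trans (step _ _ Ax)); rewrite ler_pM2r ?regularly_varying_gt0//.
rewrite exprS mulrA ler_wpM2l ?mulr_ge0 ?powR_ge0 ?(ltW C00)//.
rewrite -powR_mulrn ?powR_ge0// powRAC powR_mulrn// powRN -powR_inv1 ?powR_ge0//.
rewrite powRAC powR_inv1 ?(ltW y0)//.
by rewrite ge0_ler_powR ?nnegrE ?exprn_ge0 ?invr_ge0 ?(ltW rho0) ?(ltW y0).
Qed.

Lemma regularly_varying_cvg (t b : nat -> R) u :
  b n @[n --> \oo] --> +oo -> t n * G (b n) @[n --> \oo] --> (1 : R) -> 0 < u ->
  t n * G (b n * u) @[n --> \oo] --> u `^ (- alpha).
Proof.
move=> by_ tG u0; rewrite -[u `^ _]mul1r.
have H : t n * G (b n) * (G (u * b n) / G (b n)) @[n --> \oo] --> 1 * u `^ (- alpha).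
  by apply: cvgM => //; exact: (cvg_comp _ _ by_ (regularly_varying_ratio u0)).
apply: cvg_trans H; apply: near_eq_cvg; apply: nearW => n /=.
have G0 := regularly_varying_gt0 (b n).
by rewrite [b n * u]mulrC; field; rewrite gt_eqF.
Qed.

(** Potter's bound for [u <= 1], monotonicity for [u > 1], and [t n * G (b n) <= 2] eventually. The
    rank from which the bound holds does not depend on [u], as a dominating function requires. *)
Lemma regularly_varying_dominated rho : alpha < rho ->
  exists2 C, 0 < C & forall t b : nat -> R,
    b n @[n --> \oo] --> +oo -> t n * G (b n) @[n --> \oo] --> (1 : R) ->
    \forall n \near \oo, forall u, 0 < u ->
      0 <= t n /\ t n * G (b n * u) <= C * (u `^ (- rho) + 1).
Proof.
move=> arho; have [A [C [A0 C0 potter]]] := potter_bound arho.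
exists (2 * C + 2); first by rewrite ltr_wpDl// mulr_ge0// ltW.
move=> t b by_ tG; near=> n => u u0.
have tG2 : t n * G (b n) <= 2 by near: n; apply: (cvgr_le 1 tG); rewrite ltr1n.
have tG0 : 0 < t n * G (b n) by near: n; exact: (cvgr_gt 1 tG _ ltr01).
have t0 : 0 < t n by rewrite -(pmulr_lgt0 _ (regularly_varying_gt0 (b n))).
have bA : A <= b n by near: n; move/cvgryPge : by_; exact.
have p0 : 0 <= u `^ (- rho) by exact: powR_ge0.
split; first exact: ltW.
have [u1|u1] := leP u 1.
  have u01 : 0 < u <= 1 by rewrite u0.
  have := ler_wpM2l (ltW t0) (potter _ _ bA u01).
  have : C * u `^ (- rho) * (t n * G (b n)) <= C * u `^ (- rho) * 2.
    by rewrite ler_wpM2l// mulr_ge0// ltW.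
  have -> : t n * (C * u `^ (- rho) * G (b n)) = C * u `^ (- rho) * (t n * G (b n)) by ring.
  move=> h1 h2; apply: (le_trans h2); apply: (le_trans h1); nra.
have : t n * G (b n * u) <= t n * G (b n).
  rewrite ler_wpM2l ?(ltW t0)// G_ni// ler_peMr ?(ltW u1)//.
  exact: (le_trans (ltW A0) bA).
move=> h; apply: (le_trans h); nra.
Unshelve. all: by end_near. Qed.

End regular_variation.

(** * The Laplace transform of a single observation *)

Section mark_transform.
Context {R : realType} {d : measure_display} {T : measurableType d}.
Variables (P : probability T R) (X : {RV P >-> R}).
Notation mu := (@lebesgue_measure R).

Definition tail (x : R) : R := 1 - fine (cdf X x).

Lemma tailE x : (tail x)%:E = P [set w | (x < X w)%R].
Proof.
rewrite /tail EFinB fineK; last by rewrite /cdf fin_num_measure.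
rewrite -[X in (X - _)%E](cdf_ccdf_1 X x) addeAC subee ?add0e; last by rewrite /cdf fin_num_measure.
rewrite /ccdf /distribution /pushforward; congr (P _); apply/seteqP.
by split => w /=; rewrite in_itv/= andbT.
Qed.

Lemma tail_ni x y : x <= y -> tail y <= tail x.
Proof.
move=> xy; rewrite -lee_fin !tailE; apply: le_measure; rewrite ?inE.
- exact: (measurable_ltr_set (f := cst _)).
- exact: (measurable_ltr_set (f := cst _)).
- by move=> w /=; exact: le_lt_trans.
Qed.

Lemma tail_ge0 x : 0 <= tail x.
Proof. by rewrite -lee_fin tailE. Qed.

Lemma tail_le1 x : tail x <= 1.
Proof.
rewrite -lee_fin tailE probability_le1//; exact: (measurable_ltr_set (f := cst _)).
Qed.

Lemma measurable_tail : measurable_fun setT tail.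
Proof.
by apply: nonincreasing_measurable => // x y xy; exact: tail_ni.
Qed.

(* The truncation only matters on the null event where [X <= 0]. *)
Definition mark (r s a x : R) : R :=
  expR (- (r * (Num.max 0 x / a) ^+ 2 + s * (Num.max 0 x / a))).

Lemma measurable_mark r s a : measurable_fun setT (mark r s a).
Proof.
have mm : measurable_fun setT (fun x : R => Num.max 0 x / a).
  by apply: measurable_funM => //; exact: measurable_maxr.
apply: measurableT_comp => //; apply: measurableT_comp => //.
by apply: measurable_funD; apply: measurable_funM => //; exact: measurable_funX.
Qed.

Lemma mark_ge0_le1 r s a x : 0 <= r -> 0 <= s -> 0 < a -> 0 <= mark r s a x <= 1.
Proof.
move=> r0 s0 a0; rewrite expR_ge0 expR_le1 oppr_le0 addr_ge0// mulr_ge0 ?sqr_ge0//.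
by rewrite divr_ge0 ?(ltW a0)// le_max lexx.
Qed.

Lemma markE r s a x : 0 < r -> 0 < a ->
  let Z := Num.sqrt r * (Num.max 0 x / a) in
  mark r s a x = expR (- (1 * Z ^+ 2 + 2 * (s / (2 * Num.sqrt r)) * Z)).
Proof.
move=> r0 a0 /=; have sr0 : 0 < Num.sqrt r by rewrite sqrtr_gt0.
rewrite /mark mul1r [(Num.sqrt r * _) ^+ 2]exprMn sqr_sqrtr ?ltW//; congr (expR (- (_ + _))).
by field; rewrite !gt_eqF.
Qed.

(** The positive part inside [mark] drops out of the level sets because the level
    [a * (u / Num.sqrt r)] is positive. *)
Lemma integral_mark_layer (g : T -> R) r s a (Y : {RV P >-> R}) :
  0 < r -> 0 <= s -> 0 < a -> measurable_fun setT g -> (forall w, 0 <= g w) ->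
  (\int[P]_w (g w * (1 - mark r s a (Y w)))%:E =
   \int[mu]_(u in `]0%R, +oo[) ((quad_kernel 1 (s / (2 * Num.sqrt r)) u)%:E *
      \int[P]_w (g w * \1_[set w | a * (u / Num.sqrt r) < Y w]%R w)%:E))%E.
Proof.
move=> r0 s0 a0 mg g0; have sr0 : 0 < Num.sqrt r by rewrite sqrtr_gt0.
have c0 : 0 <= s / (2 * Num.sqrt r) by rewrite divr_ge0// mulr_ge0// ltW.
pose Z w := Num.sqrt r * (Num.max 0 (Y w) / a).
have mZ : measurable_fun setT Z.
  by apply: measurable_funM => //; apply: measurable_funM => //; exact: measurable_maxr.
have Z0 w : 0 <= Z w by rewrite /Z mulr_ge0 ?(ltW sr0)// divr_ge0 ?(ltW a0)// le_max lexx.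
have -> : (\int[P]_w (g w * (1 - mark r s a (Y w)))%:E = \int[P]_w (g w *
    (1 - expR (- (1 * Z w ^+ 2 + 2 * (s / (2 * Num.sqrt r)) * Z w))))%:E)%E.
  by apply: eq_integral => w _; rewrite markE.
rewrite (laplace_layer_cake P ler01 c0 mg mZ g0 Z0).
apply: eq_integral => u; rewrite inE/= in_itv/= andbT => u0.
congr (_ * _)%E; apply: eq_integral => w _; congr ((_ * \1_(_) _)%:E).
have E0 : 0 < a * (u / Num.sqrt r) by rewrite mulr_gt0// divr_gt0.
have K v : (u < Z v) = (a * (u / Num.sqrt r) < Num.max 0 (Y v)).
  by rewrite /Z [_ * (_ / a)]mulrC -ltr_pdivrMr// ltr_pdivlMr// [_ * a]mulrC.
apply/seteqP; split => v /=; rewrite K lt_max.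
  by case/orP => // /(lt_trans E0); rewrite ltxx.
by move=> ->; rewrite orbT.
Qed.

Lemma integral_mark_tail r s a : 0 < r -> 0 <= s -> 0 < a ->
  (\int[P]_w (1 - mark r s a (X w))%:E =
   \int[mu]_(u in `]0%R, +oo[) (quad_kernel 1 (s / (2 * Num.sqrt r)) u *
      tail (a * (u / Num.sqrt r)))%:E)%E.
Proof.
move=> r0 s0 a0.
have := @integral_mark_layer (cst 1) r s a X r0 s0 a0 (measurable_cst _) (fun=> ler01).
under eq_integral do rewrite /= mul1r.
move=> ->; apply: eq_integral => u _; rewrite [RHS]EFinM; congr (_ * _)%E.
under eq_integral do rewrite /= mul1r.
rewrite integral_indic ?setIT ?tailE//; exact: (measurable_ltr_set (f := cst _)).
Qed.

Lemma integrable_mark r s a : 0 <= r -> 0 <= s -> 0 < a ->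
  P.-integrable setT (EFin \o (fun w => mark r s a (X w))).
Proof.
move=> r0 s0 a0; apply: (@bounded_integrable _ _ _ _ _ 1).
  by apply: measurableT_comp => //; exact: measurable_mark.
by move=> w; have /andP[? ?] := mark_ge0_le1 (X w) r0 s0 a0; rewrite ger0_norm.
Qed.

(** Dominated convergence in [integral_mark_tail]: with v = u / sqrt r, the product
    [t * tail (b * v)] tends to v^(-alpha) and is at most a multiple of v^(-rho) + 1, which the
    kernel integrates. *)
Lemma mark_transform_cvg (alpha r s : R) (ell : R -> R) (t b : nat -> R) :
  0 < alpha < 1 -> 0 < r -> 0 <= s -> slowly_varying ell ->
  tail x / (x `^ (- alpha) * ell x) @[x --> +oo] --> (1 : R) ->
  b n @[n --> \oo] --> +oo -> t n * tail (b n) @[n --> \oo] --> (1 : R) ->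
  t n * (1 - \int[P]_w mark r s (b n) (X w)) @[n --> \oo] --> delta alpha r s.
Proof.
move=> alpha01 r0 s0 sv tail_ell by_ tG; have /andP[alpha0 alpha1] := alpha01.
have sr0 : 0 < Num.sqrt r by rewrite sqrtr_gt0.
set c := s / (2 * Num.sqrt r).
have c0 : 0 <= c by rewrite divr_ge0// mulr_ge0// ltW.
(* Above [alpha] for Potter's bound, below 1 for integrability at the origin. *)
pose rho := (1 + alpha) / 2.
have arho : alpha < rho by rewrite /rho; lra.
have rho01 : 0 < rho < 1 by rewrite /rho; lra.
have [C C0 dom] := regularly_varying_dominated alpha0 tail_ni tail_le1 sv tail_ell arho.
have [N _ HN] : \forall n \near \oo, 0 < b n /\ forall u, 0 < u ->
    0 <= t n /\ t n * tail (b n * u) <= C * (u `^ (- rho) + 1).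
  near=> n; split; last by near: n; exact: dom.
  by near: n; move/cvgryPgt : by_; exact.
(* The shift by [N] makes the domination hold at every index. *)
pose f n u := (t (n + N)%N * (quad_kernel 1 c u * tail (b (n + N)%N * (u / Num.sqrt r))))%:E.
pose g u := (C * (quad_kernel 1 c u * (u / Num.sqrt r) `^ (- rho) + quad_kernel 1 c u))%:E.
have mq := @measurable_quad_kernel R 1 c.
have mur : measurable_fun setT (fun u : R => u / Num.sqrt r) by exact: measurable_funM.
have mpow rh : measurable_fun setT (fun u : R => (u / Num.sqrt r) `^ (- rh)).
  exact: (measurableT_comp (measurable_powR (R := R) (- rh)) mur).
have mf (n : nat) : measurable_fun (`]0, +oo[%classic : set R) (f n).
  apply: measurable_funTS; apply/measurable_EFinP; apply: measurable_funM => //.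
  apply: measurable_funM => //; apply: (measurableT_comp measurable_tail).
  exact: measurable_funM.
have q0 u : 0 < u -> 0 <= quad_kernel 1 c u by move=> u0; rewrite quad_kernel_ge0// ltW.
have ig : mu.-integrable (`]0, +oo[%classic : set R) g.
  apply/integrableP; split.
    apply: measurable_funTS; apply/measurable_EFinP; apply: measurable_funM => //.
    exact: (measurable_funD (measurable_funM mq (mpow rho)) mq).
  have I1 := integral_quad_kernel_powR_lty sr0 c0 rho01.
  have I2 : (\int[mu]_(u in `]0%R, +oo[) (quad_kernel 1 c u)%:E < +oo)%E.
    by apply: integral_quad_kernel_lty => //; rewrite ltr_pwDl// mulr_ge0.
  have -> : (\int[mu]_(u in `]0%R, +oo[) `|g u| = \int[mu]_(u in `]0%R, +oo[)
      (C%:E * ((quad_kernel 1 c u * (u / Num.sqrt r) `^ (- rho))%:E + (quad_kernel 1 c u)%:E)))%E.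
    apply: eq_integral => u; rewrite inE/= in_itv/= andbT => u0.
    rewrite /g /= ger0_norm; first by rewrite EFinM EFinD.
    rewrite mulr_ge0 ?(ltW C0)// addr_ge0 ?q0//.
    by rewrite mulr_ge0 ?powR_ge0// q0.
  rewrite ge0_integralZl//=; last 3 first.
  - apply: measurable_funTS; apply: emeasurable_funD; apply/measurable_EFinP => //.
    exact: (measurable_funM mq (mpow rho)).
  - move=> u; rewrite in_itv/= andbT => u0; rewrite -EFinD lee_fin addr_ge0 ?q0//.
    by rewrite mulr_ge0 ?powR_ge0// q0.
  - by rewrite lee_fin ltW.
  rewrite lte_mul_pinfty ?lee_fin ?(ltW C0)// ge0_integralD//=.
  - exact: lte_add_pinfty.
  - by move=> u; rewrite in_itv/= andbT => u0; rewrite lee_fin mulr_ge0 ?powR_ge0// q0.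
  - apply: measurable_funTS; apply/measurable_EFinP.
    exact: (measurable_funM mq (mpow rho)).
  - by move=> u; rewrite in_itv/= andbT => u0; rewrite lee_fin q0.
  - by apply: measurable_funTS; apply/measurable_EFinP.
pose h u := (quad_kernel 1 c u * (u / Num.sqrt r) `^ (- alpha))%:E.
have mh : measurable_fun (`]0, +oo[%classic : set R) h.
  apply: measurable_funTS; apply/measurable_EFinP.
  exact: (measurable_funM mq (mpow alpha)).
have dN : \forall n \near \oo, 0 < b n /\ forall u, 0 < u ->
    0 <= t n /\ t n * tail (b n * u) <= C * (u `^ (- rho) + 1) by exists N.
have fh : {ae mu, forall u, `]0%R, +oo[%classic u -> f n u @[n --> \oo] --> h u}.
  apply: aeW => u; rewrite /= in_itv/= andbT => u0.
  have us0 : 0 < u / Num.sqrt r by rewrite divr_gt0.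
  apply: cvg_EFin; first exact: nearW.
  rewrite /f /comp /=.
  rewrite (cvg_shiftn N (fun n => t n * (quad_kernel 1 c u * tail (b n * (u / Num.sqrt r))))).
  under eq_fun do rewrite mulrCA.
  apply: cvgM; first exact: cvg_cst.
  exact: (regularly_varying_cvg tail_ni sv tail_ell by_ tG us0).
have fg : {ae mu, forall u n, `]0%R, +oo[%classic u -> (`|f n u| <= g u)%E}.
  apply: aeW => u n; rewrite /= in_itv/= andbT => u0.
  have us0 : 0 < u / Num.sqrt r by rewrite divr_gt0.
  have [_ /(_ _ us0)[t0 tb]] := HN _ (leq_addl n N).
  have := q0 u u0 => q0u.
  rewrite /f /g /= lee_fin ger0_norm; last by rewrite mulr_ge0// mulr_ge0// tail_ge0.
  rewrite mulrCA (_ : C * _ = quad_kernel 1 c u * (C * ((u / Num.sqrt r) `^ (- rho) + 1))).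
    exact: ler_wpM2l.
  by ring.
have [_ _ cv] := @dominated_convergence _ _ _ mu _ (measurable_itv _) f h g mf mh fh ig fg.
rewrite -(cvg_shiftn N).
move: cv; rewrite /h -(deltaE alpha01 r0 s0) => /fine_cvg.
apply: cvg_trans; apply: near_eq_cvg; apply: nearW => n /=.
have [bn0 _] := HN _ (leq_addl n N).
have [t0 _] := (HN _ (leq_addl n N)).2 1 ltr01.
have E := integral_mark_tail r0 s0 bn0.
rewrite /f; under eq_integral do rewrite EFinM.
rewrite ge0_integralZl//=; last 2 first.
- apply: measurable_funTS; apply/measurable_EFinP; apply: measurable_funM => //.
  by apply: (measurableT_comp measurable_tail); exact: measurable_funM.
- by move=> u; rewrite in_itv/= andbT => u0; rewrite lee_fin mulr_ge0 ?tail_ge0// q0.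
rewrite -E.
have im := integrable_mark (ltW r0) s0 bn0.
have i1 : P.-integrable setT (EFin \o cst 1) by exact: finite_measure_integrable_cst.
have -> : (\int[P]_w (1 - mark r s (b (n + N)%N) (X w))%:E =
    (1 - \int[P]_w mark r s (b (n + N)%N) (X w))%:E)%E.
  have := RintegralB measurableT i1 im.
  rewrite Rintegral_cst// mul1r (_ : fine _ = 1); last exact: (congr1 fine (probability_setT P)).
  move=> <-; rewrite /Rintegral fineK//.
  exact: (integrable_fin_num _ (integrableB measurableT i1 im)).
by rewrite -EFinM.
Unshelve. all: by end_near. Qed.

End mark_transform.

(** * Transforms of random sums *)

Section random_product.
Context {R : realType} {d : measure_display} {T : measurableType d}.
Variables (P : probability T R).

Lemma measurable_random_index d' (U : measurableType d') (f : nat -> T -> U)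
    (N : T -> nat) : measurable_fun setT N ->
  (forall n, measurable_fun setT (f n)) ->
  measurable_fun setT (fun w => f (N w) w).
Proof.
move=> mN mf.
have -> : [set: T] = \bigcup_n (N @^-1` [set n]).
  by apply/esym; rewrite -subTset => w _; exists (N w).
have mNn n : measurable (N @^-1` [set n]).
  by rewrite -[X in measurable X]setTI; exact: mN.
apply/measurable_fun_bigcup => // n.
apply: (eq_measurable_fun (f n)); last exact: measurable_funTS.
by move=> w; rewrite inE/= => ->.
Qed.

Lemma measurable_bigprod (I : Type) (s : seq I) (C : pred I) (f : I -> T -> R) :
  (forall i, measurable_fun setT (f i)) ->
  measurable_fun setT (fun w => \prod_(i <- s | C i) f i w).
Proof.
move=> mf; elim: s => [|i s IH].
  by under eq_fun do rewrite big_nil; exact: measurable_cst.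
under eq_fun do rewrite big_cons.
by case: (C i) => //; exact: measurable_funM.
Qed.

Lemma prod_indic_bigsetI m (A : nat -> set T) w :
  \prod_(i < m) \1_(A i) w = \1_(\big[setI/setT]_(i < m) A i) w :> R.
Proof.
elim: m => [|m IH]; first by rewrite !big_ord0 indicT.
by rewrite !big_ord_recr/= IH indicI.
Qed.

Lemma bigsetI_g_sigma_algebra (G : set (set T)) m (A : nat -> set T) :
  (forall i, G (A i)) -> <<s G >> (\big[setI/setT]_(i < m) A i).
Proof.
move=> GA.
have [G0 GC GU] := smallest_sigma_algebra setT G.
have GT := GC _ G0; rewrite setD0 in GT.
elim: m => [|m IH]; first by rewrite big_ord0.
rewrite big_ord_recr/=.
(* The intersection is written with complements and a countable union: index 0 carries the partial
   intersection, all the others [A m]. *)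
have -> : (\big[setI/setT]_(i < m) A i) `&` A m =
    setT `\` \bigcup_k (setT `\` (if k is 0%N then \big[setI/setT]_(i < m) A i else A m)).
  apply/seteqP; split => w /=.
    by move=> [w1 w2]; split => // -[k _]; case: k => [|k] /= [_].
  move=> [_ H]; split; apply: contrapT => nw; apply: H.
    by exists 0%N.
  by exists 1%N.
refine (GC _ (GU _ _)) => k; refine (GC _ _); case: k => // _.
exact: sub_sigma_algebra.
Qed.

Variables (X : {RV P >-> R}) (Xs : nat -> {RV P >-> R}) (N : R -> {RV P >-> nat}).
Hypothesis Xs_iid : iid_copies X Xs.
Hypothesis N_indep : process_independent N Xs.

(** Independence of the process from the sample detaches the count; mutual independence over the
    indices below [m] factors the rest. *)
Lemma prob_random_index_bigsetI t m (B : nat -> set R) : 0 <= t ->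
  (forall i, measurable (B i)) ->
  P (N t @^-1` [set m] `&` \big[setI/setT]_(i < m) (Xs i @^-1` B i)) =
  (fine (P (N t @^-1` [set m])) * \prod_(i < m) fine (P (X @^-1` B i)))%:E.
Proof.
move=> t0 mB; have [indep same] := Xs_iid.
rewrite N_indep; last 2 first.
- by apply: sub_sigma_algebra; exists t, [set m].
- apply: (@bigsetI_g_sigma_algebra _ m (fun i => Xs i @^-1` B i)) => i.
  by exists i, (B i).
have mNm : measurable (N t @^-1` [set m]).
  by rewrite -[X in measurable X]setTI; exact: measurable_funP.
rewrite EFinM fineK; last exact: fin_num_measure.
congr (_ * _)%E.
pose J : {fset nat} := [fset i in iota 0 m]%fset.
have JE : [set` J] = `I_m.
  by apply/seteqP; split => i /=; rewrite !inE /= mem_iota add0n.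
have := indep J B mB; rewrite JE bigcap_mkord => ->.
have pJ : perm_eq J (iota 0 m).
  apply: uniq_perm; [exact: fset_uniq|exact: iota_uniq|].
  by move=> i; rewrite !inE.
rewrite (perm_big _ pJ)/= -{1}[m]subn0 -/(index_iota 0 m) big_mkord.
rewrite -prodEFin; apply: eq_bigr => i _.
rewrite fineK; last by apply: fin_num_measure; rewrite -[X in measurable X]setTI; exact: measurable_funP.
exact: same.
Qed.

Section mark_product.
Variables (r s a : R).
Hypotheses (r0 : 0 < r) (s0 : 0 <= s) (a0 : 0 < a).

Let phi := \int[P]_w mark r s a (X w).

(** The layer cake formula writes [1 - mark] as an integral of indicators of rays, for which the
    factorization is the hypothesis; [S = setT] identifies [c] as the mean of [Y] and brings back
    [mark] itself. *)
Lemma integral_mark_indep (Y : T -> R) (c : R) i :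
  measurable_fun setT Y -> (forall w, 0 <= Y w <= 1) -> 0 <= c ->
  (forall S, measurable S ->
    (\int[P]_w (Y w * \1_S (Xs i w))%:E = (c * fine (P (X @^-1` S)))%:E)%E) ->
  (\int[P]_w (Y w * mark r s a (Xs i w))%:E = (c * phi)%:E)%E.
Proof.
move=> mY Y01 c0 H.
have Y0 w : 0 <= Y w by have /andP[] := Y01 w.
have cE : (\int[P]_w (Y w)%:E = c%:E)%E.
  have := H setT measurableT; rewrite preimage_setT probability_setT mulr1 => <-.
  by apply: eq_integral => w _; rewrite indicT mulr1.
have sr0 : 0 < Num.sqrt r by rewrite sqrtr_gt0.
have key : (\int[P]_w (Y w * (1 - mark r s a (Xs i w)))%:E =
    c%:E * \int[P]_w (1 - mark r s a (X w))%:E)%E.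
  rewrite (integral_mark_layer (Xs i) r0 s0 a0 mY Y0) integral_mark_tail//.
  rewrite -ge0_integralZl//; last 2 first.
  - apply: measurable_funTS; apply/measurable_EFinP; apply: measurable_funM.
      exact: measurable_quad_kernel.
    apply: (measurableT_comp (measurable_tail X)).
    by apply: measurable_funM => //; exact: measurable_funM.
  - move=> u /=; rewrite in_itv/= andbT => u0; rewrite lee_fin mulr_ge0 ?tail_ge0//.
    by rewrite quad_kernel_ge0 ?(ltW u0)// divr_ge0// mulr_ge0// ltW.
  apply: eq_integral => u _.
  transitivity ((quad_kernel 1 (s / (2 * Num.sqrt r)) u)%:E *
      (c * tail X (a * (u / Num.sqrt r)))%:E)%E; last by rewrite -!EFinM [in RHS]mulrCA.
  congr (_ * _)%E.
  have := H _ (measurable_itv `]a * (u / Num.sqrt r), +oo[).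
  rewrite (_ : fine _ = tail X (a * (u / Num.sqrt r))).
    move=> <-; apply: eq_integral => w _; congr ((_ * _)%:E).
    by rewrite !indicE; congr ((nat_of_bool _)%:R); apply/idP/idP; rewrite !inE/= in_itv/= andbT.
  apply: EFin_inj; rewrite /= fineK ?tailE; last first.
    apply: fin_num_measure; rewrite -[X in measurable X]setTI; exact: measurable_funP.
  by congr (P _); apply/seteqP; split => w /=; rewrite in_itv/= andbT.
have m01 i0 : 0 <= mark r s a i0 <= 1 by exact: mark_ge0_le1 (ltW r0) s0 a0.
have mm : measurable_fun setT (fun w => mark r s a (Xs i w)).
  by apply: measurableT_comp => //; exact: measurable_mark.
have iY : P.-integrable setT (EFin \o Y).
  apply: (@bounded_integrable _ _ _ _ _ 1) => // w.
  by have /andP[? ?] := Y01 w; rewrite ger0_norm.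
have iYm : P.-integrable setT (EFin \o (fun w => Y w * mark r s a (Xs i w))).
  apply: (@bounded_integrable _ _ _ _ _ 1); first exact: measurable_funM.
  move=> w; have /andP[? ?] := Y01 w; have /andP[? ?] := m01 (Xs i w).
  by rewrite ger0_norm ?mulr_ge0// mulr_ile1.
have imX := integrable_mark X (ltW r0) s0 a0.
have i1 : P.-integrable setT (EFin \o cst 1) by exact: finite_measure_integrable_cst.
have E1 : \int[P]_w (1 - mark r s a (X w)) = 1 - phi.
  have := RintegralB measurableT i1 imX => /= ->.
  by rewrite Rintegral_cst// mul1r (_ : fine _ = 1)//; exact: (congr1 fine (probability_setT P)).
have fE (f : T -> R) : P.-integrable setT (EFin \o f) ->
    (\int[P]_w (f w)%:E = (\int[P]_w f w)%:E)%E.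
  by move=> fi; rewrite /Rintegral fineK//; exact: (integrable_fin_num _ fi).
have i1X : P.-integrable setT (EFin \o (fun w => 1 - mark r s a (X w))).
  exact: (integrableB measurableT i1 imX).
have iY1 : P.-integrable setT (EFin \o (fun w => Y w * (1 - mark r s a (Xs i w)))).
  have := integrableB measurableT iY iYm; apply: eq_integrable => // w _ /=.
  by rewrite -EFinB mulrBr mulr1.
move: key; rewrite !fE// -EFinM E1 => -[key'].
move: cE; rewrite fE// => -[cE'].
congr (_%:E); have := RintegralB measurableT iY iYm.
have -> : \int[P]_w (Y w - Y w * mark r s a (Xs i w)) = \int[P]_w (Y w * (1 - mark r s a (Xs i w))).
  by apply: eq_Rintegral => w _; rewrite mulrBr mulr1.
rewrite key' cE' mulrBr mulr1 => H1.
have -> : \int[P]_w (Y w * mark r s a (Xs i w)) = c - (c - \int[P]_w (Y w * mark r s a (Xs i w))) by ring.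
by rewrite -H1; ring.
Qed.

(** Indicators are exchanged for marks one index at a time: [claim j] has marks below [j] and
    indicators of arbitrary Borel sets from [j] on. *)
Lemma integral_random_index_mark t m : 0 <= t ->
  (\int[P]_w (\1_(N t @^-1` [set m]) w * \prod_(i < m) mark r s a (Xs i w))%:E =
   (fine (P (N t @^-1` [set m])) * phi ^+ m)%:E)%E.
Proof.
move=> t0; set A := N t @^-1` [set m].
have mpre d' (U : measurableType d') (f : T -> U) C : measurable_fun setT f ->
    measurable C -> measurable (f @^-1` C).
  by move=> mf mC; rewrite -[X in measurable X]setTI; exact: mf.
have mA : measurable A by exact: mpre.
have m01 x : 0 <= mark r s a x <= 1 by exact: mark_ge0_le1 (ltW r0) s0 a0.
have phi0 : 0 <= phi by apply: Rintegral_ge0 => w _; have /andP[] := m01 (X w).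
pose h (B : nat -> set R) (j i : nat) w : R :=
  if (i < j)%N then mark r s a (Xs i w) else \1_(B i) (Xs i w).
pose q (B : nat -> set R) (j i : nat) : R := if (i < j)%N then phi else fine (P (X @^-1` B i)).
have h01 B j i w : 0 <= h B j i w <= 1.
  by rewrite /h; case: ifP => // _; rewrite indicE; case: (_ \in _); rewrite ?lexx ?ler01.
have q0 B j i : 0 <= q B j i by rewrite /q; case: ifP => // _; exact: fine_ge0.
have mh B j i : (forall i, measurable (B i)) -> measurable_fun setT (h B j i).
  move=> mB; rewrite /h; case: (i < j)%N.
    by apply: measurableT_comp => //; exact: measurable_mark.
  apply: (measurableT_comp (f := \1_(B i) : R -> R)) => //; exact: measurable_indic.
have claim j B : (j <= m)%N -> (forall i, measurable (B i)) ->
  (\int[P]_w (\1_A w * \prod_(i < m) h B j i w)%:E =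
   (fine (P A) * \prod_(i < m) q B j i)%:E)%E.
  elim: j B => [|j IH] B jm mB.
    have mI : measurable (A `&` \big[setI/setT]_(i < m) (Xs i @^-1` B i)).
      by apply: measurableI => //; apply: bigsetI_measurable => i _; exact: mpre.
    transitivity (P (A `&` \big[setI/setT]_(i < m) (Xs i @^-1` B i))); last first.
      by rewrite prob_random_index_bigsetI//; congr (_ * _)%:E; apply: eq_bigr.
    rewrite -[X in P X]setIT -integral_indic//.
    apply: eq_integral => w _; congr (_%:E).
    rewrite indicI; congr (_ * _); rewrite -(prod_indic_bigsetI m (fun i => Xs i @^-1` B i)).
    by apply: eq_bigr => i _; rewrite /h ltn0.
  pose o := Ordinal jm.
  pose Y w : R := \1_A w * \prod_(i < m | i != o) h B j.+1 i w.
  pose c := fine (P A) * \prod_(i < m | i != o) q B j.+1 i.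
  have -> : (fine (P A) * \prod_(i < m) q B j.+1 i) = c * phi.
    by rewrite (bigD1 o)//= {1}/q ltnSn mulrA mulrAC.
  have c0 : 0 <= c by rewrite mulr_ge0 ?fine_ge0// prodr_ge0.
  have Y01 w : 0 <= Y w <= 1.
    have p0 : 0 <= \prod_(i < m | i != o) h B j.+1 i w.
      by apply: prodr_ge0 => i _; have /andP[] := h01 B j.+1 i w.
    have p1 : \prod_(i < m | i != o) h B j.+1 i w <= 1.
      by apply: prodr_ile1 => i _; exact: h01.
    by rewrite /Y indicE; case: (_ \in _); rewrite ?mul1r ?mul0r ?p0 ?p1 ?lexx ?ler01.
  have mY : measurable_fun setT Y.
    apply: measurable_funM; first exact: measurable_indic.
    by apply: measurable_bigprod => i; exact: mh.
  rewrite -(@integral_mark_indep Y c j mY Y01 c0).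
    apply: eq_integral => w _; congr (_%:E).
    by rewrite (bigD1 o)//= {1}/h ltnSn mulrA mulrAC.
  move=> S mS.
  (* The induction hypothesis is used with the [j]-th set replaced by an arbitrary [S], as
     [integral_mark_indep] asks. *)
  pose B' i := if i == j then S else B i.
  have mB' i : measurable (B' i) by rewrite /B'; case: ifP.
  have neq (i : 'I_m) : i != o -> (i < j.+1)%N = (i < j)%N /\ B' i = B i.
    move=> io; have ij : (i : nat) != j by [].
    by rewrite /B' (negbTE ij) ltnS leq_eqVlt (negbTE ij).
  have qo : q B' j o = fine (P (X @^-1` S)) by rewrite /q ltnn /B' eqxx.
  have ho w : h B' j o w = \1_S (Xs j w) by rewrite /h ltnn /B' eqxx.
  have := IH B' (ltnW jm) mB'; rewrite (bigD1 o)//= qo.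
  have -> : \prod_(i < m | i != o) q B' j i = \prod_(i < m | i != o) q B j.+1 i.
    by apply: eq_bigr => i io; rewrite /q; have [-> ->] := neq i io.
  rewrite mulrA mulrAC -/c => <-.
  apply: eq_integral => w _; congr (_%:E).
  rewrite (bigD1 o)//= ho mulrA mulrAC; congr (_ * _ * _).
  by apply: eq_bigr => i io; rewrite /h; have [-> ->] := neq i io.
have := claim m (fun=> setT) (leqnn m) (fun=> measurableT).
rewrite (_ : \prod_(i < m) q _ m i = phi ^+ m); last first.
  by under eq_bigr => i _ do rewrite /q ltn_ord; rewrite prodr_const card_ord.
move=> <-; apply: eq_integral => w _; congr ((_ * _)%:E).
by apply: eq_bigr => i _; rewrite /h ltn_ord.
Qed.

Lemma measurable_random_product t :
  measurable_fun setT (fun w => \prod_(i < N t w) mark r s a (Xs i w)).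
Proof.
apply: (@measurable_random_index _ _ (fun n w => \prod_(i < n) mark r s a (Xs i w))) => //.
by move=> n; apply: measurable_bigprod => i; apply: measurableT_comp => //; exact: measurable_mark.
Qed.

(** Splitting over the values of [N t] reduces the random number of factors to a fixed one. *)
Lemma integral_random_product t : 0 <= t ->
  (\int[P]_w (\prod_(i < N t w) mark r s a (Xs i w))%:E =
   \int[P]_w (phi ^+ N t w)%:E)%E.
Proof.
move=> t0.
have m01 x : 0 <= mark r s a x <= 1 by exact: mark_ge0_le1 (ltW r0) s0 a0.
have phi0 : 0 <= phi by apply: Rintegral_ge0 => w _; have /andP[] := m01 (X w).
pose D n := N t @^-1` [set n].
have DT : \bigcup_n D n = setT by rewrite -subTset => w _; exists (N t w).
have mD n : measurable (D n).
  by rewrite -[X in measurable X]setTI; exact: measurable_funP.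
have tD : trivIset setT D.
  apply/trivIsetP => i j _ _ ij; apply/seteqP; split => // w [/= Ni Nj].
  by move: ij; rewrite -Ni -Nj eqxx.
have mphi : measurable_fun setT (fun w => phi ^+ N t w).
  exact: (@measurable_random_index _ _ (fun n (w : T) => phi ^+ n)).
have p0 w : 0 <= \prod_(i < N t w) mark r s a (Xs i w).
  by apply: prodr_ge0 => i _; have /andP[] := m01 (Xs i w).
rewrite -DT ge0_integral_bigcup//; last 2 first.
- by rewrite DT; apply/measurable_EFinP; exact: measurable_random_product.
- by move=> w _; rewrite lee_fin.
rewrite ge0_integral_bigcup//; last 2 first.
- by rewrite DT; apply/measurable_EFinP.
- by move=> w _; rewrite lee_fin exprn_ge0.
apply: eq_eseriesr => n _.
transitivity (\int[P]_w (\1_(D n) w * \prod_(i < n) mark r s a (Xs i w))%:E)%E.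
  rewrite integral_mkcond; apply: eq_integral => w _.
  rewrite patchE indicE; case: ifPn => [|_]; last by rewrite mul0r.
  by rewrite inE => /= ->; rewrite mul1r.
rewrite integral_random_index_mark//.
transitivity (\int[P]_(w in D n) (phi ^+ n)%:E)%E; last first.
  by apply: eq_integral => w; rewrite inE => /= ->.
rewrite integral_cst// mulrC EFinM fineK//; exact: (fin_num_measure P _ (mD n)).
Qed.

End mark_product.

End random_product.

(** * Laplace transforms under convergence in distribution *)

Section laplace_convergence.
Context {R : realType}.
Notation mu := (@lebesgue_measure R).

(** The left limit of the cdf is the probability of [X < x], which differs from [cdf X x] by the
    mass of the atom at [x]. *)
Lemma continuous_cdf {d} {T : measurableType d} (P : probability T R) (X : {RV P >-> R}) x :
  pmf X x = 0 -> {for x, continuous (cdf X)}.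
Proof.
move=> X0; apply/left_right_continuousP; split; last exact: cdf_right_continuous.
have mX (A : set R) : measurable A -> measurable (X @^-1` A).
  by move=> mA; rewrite -[X in measurable X]setTI; exact: measurable_funP.
have finc y : cdf X y \is a fin_num by rewrite /cdf fin_num_measure.
rewrite -(fineK (finc x)); apply/fine_cvgP; split; first exact: nearW.
pose E k := X @^-1` `]-oo, (x - k.+1%:R^-1)].
have EU : \bigcup_k E k = X @^-1` `]-oo, x[.
  apply/seteqP; split => w /=; rewrite in_itv/=.
    move=> [k _]; rewrite /E /= in_itv/= => /le_lt_trans; apply.
    by rewrite ltrBlDr ltrDl invr_gt0.
  move=> wx; have wx0 : 0 < x - X w by rewrite subr_gt0.
  exists (Num.truncn (x - X w)^-1) => //; rewrite /E /= in_itv/=.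
  rewrite lerBrDr -lerBrDl -[leRHS]invrK lef_pV2 ?posrE ?invr_gt0//.
  by rewrite ltW// truncnS_gt.
have PE : P (X @^-1` `]-oo, x[) = cdf X x.
  rewrite /cdf /distribution /pushforward -(@setUitv1 _ _ _ x true)//= preimage_setU.
  rewrite measureU; [|exact: mX|exact: mX|].
    rewrite [X in (_ + X)%E](_ : _ = 0%E) ?adde0//.
    transitivity ((pmf X x)%:E); last by rewrite X0.
    by rewrite /pmf fineK//; apply: fin_num_measure; exact: mX.
  by apply/seteqP; split => // w [/=]; rewrite in_itv/= => + Xx; rewrite Xx ltxx.
have cE : P (E k) @[k --> \oo] --> cdf X x.
  rewrite -PE -EU; apply: nondecreasing_cvg_mu.
  - by move=> k; exact: mX.
  - by rewrite EU; exact: mX.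
  - move=> m n mn; apply/subsetPset => w; rewrite /E /= !in_itv/= => /le_trans; apply.
    by rewrite lerD2l lerN2 lef_pV2 ?posrE// ler_nat.
rewrite -(fineK (finc x)) in cE; move/fine_cvg/cvgrPdist_lt : cE => cE.
apply/cvgrPdist_lt => e e0.
have [k _ /(_ k (leqnn k)) /= Hk] := cE e e0.
near=> y.
have yx : y < x by near: y; exact: nbhs_left_lt.
have ky : x - k.+1%:R^-1 < y by near: y; apply: nbhs_left_gt; rewrite ltrBlDr ltrDl invr_gt0.
have le1 : fine (cdf X (x - k.+1%:R^-1)) <= fine (cdf X y).
  by apply: fine_le => //; apply: cdf_nondecreasing; exact: ltW.
have le2 : fine (cdf X y) <= fine (cdf X x).
  by apply: fine_le => //; apply: cdf_nondecreasing; exact: ltW.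
move: Hk; rewrite -/(cdf X _) !ger0_norm ?subr_ge0 ?(le_trans le1)// => Hk.
by apply: le_lt_trans Hk; rewrite lerD2l lerN2.
Unshelve. all: by end_near. Qed.

Lemma integral_1BexpR {d} {T : measurableType d} (P : probability T R) (Z : T -> R) :
  measurable_fun setT Z -> (forall w, 0 <= Z w) ->
  (\int[P]_w (1 - expR (- Z w))%:E =
   \int[mu]_(u in `]0%R, +oo[) ((quad_kernel 0 2^-1 u)%:E * P [set w | u < Z w]%R))%E.
Proof.
move=> mZ Z0.
have h0 : 0 <= 2^-1 :> R by rewrite invr_ge0.
have m1 : measurable_fun setT (cst 1 : T -> R) by exact: measurable_cst.
have := laplace_layer_cake P (lexx 0) h0 m1 mZ (fun=> ler01) Z0.
under eq_integral do rewrite /= mul1r mul0r add0r mulfV// mul1r.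
move=> ->; apply: eq_integral => u _; congr (_ * _)%E.
under eq_integral do rewrite /= mul1r.
by rewrite integral_indic ?setIT//; exact: (measurable_ltr_set (f := cst _)).
Qed.

(** One minus the transform is the integral of the tail against the exponential density, which
    dominates; convergence of the tails at almost every level therefore suffices. *)
Lemma cvg_integral_expRN {d d'} {T : measurableType d} {T' : measurableType d'}
    (P : probability T R) (Q : probability T' R) (Z : nat -> T -> R) (Zl : T' -> R) :
  (forall n, measurable_fun setT (Z n)) -> (forall n w, 0 <= Z n w) ->
  measurable_fun setT Zl -> (forall w, 0 <= Zl w) ->
  {ae mu, forall u, 0 < u ->
    P [set w | u < Z n w] @[n --> \oo] --> Q [set w | u < Zl w]} ->
  \int[P]_w expR (- Z n w) @[n --> \oo] --> \int[Q]_w expR (- Zl w).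
Proof.
move=> mZ Z0 mZl Zl0 cvgZ.
have mq := @measurable_quad_kernel R 0 2^-1.
have h0 : 0 <= 2^-1 :> R by rewrite invr_ge0.
have q0 (u : R) : 0 < u -> 0 <= quad_kernel 0 2^-1 u by move=> u0; rewrite quad_kernel_ge0// ltW.
have mtail d1 (U : measurableType d1) (m : probability U R) (Y : U -> R) :
    measurable_fun setT Y -> measurable_fun setT (fun u : R => m [set w | u < Y w]).
  move=> mY; pose Y' : {RV m >-> R} := HB.pack Y (isMeasurableFun.Build _ _ _ _ Y mY).
  apply: (eq_measurable_fun (EFin \o tail Y')); last by apply/measurable_EFinP; exact: measurable_tail.
  by move=> u _ /=; rewrite tailE.
pose f n (u : R) := ((quad_kernel 0 2^-1 u)%:E * P [set w | (u < Z n w)%R])%E.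
pose h (u : R) := ((quad_kernel 0 2^-1 u)%:E * Q [set w | (u < Zl w)%R])%E.
have mf (n : nat) : measurable_fun (`]0, +oo[%classic : set R) (f n).
  apply: measurable_funTS; apply: emeasurable_funM; first exact/measurable_EFinP.
  exact: mtail.
have mh : measurable_fun (`]0, +oo[%classic : set R) h.
  apply: measurable_funTS; apply: emeasurable_funM; first exact/measurable_EFinP.
  exact: mtail.
have ig : mu.-integrable (`]0, +oo[%classic : set R) (EFin \o quad_kernel 0 2^-1).
  apply/integrableP; split; first by apply: measurable_funTS; exact/measurable_EFinP.
  have := @integral_quad_kernel_lty R 0 2^-1 (lexx 0) h0.
  rewrite add0r mulfV// => /(_ ltr01); apply: le_lt_trans.
  rewrite le_eqVlt; apply/orP; left; apply/eqP.
  by apply: eq_integral => u; rewrite inE/= in_itv/= andbT => u0; rewrite ger0_norm ?q0.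
have fh : {ae mu, forall u, `]0%R, +oo[%classic u -> f n u @[n --> \oo] --> h u}.
  have [A [mA A0 AN]] := cvgZ; exists A; split => // u /= Hu.
  apply: AN => /= H; apply: Hu; rewrite in_itv/= andbT => u0.
  by apply: cvgeZl => //; exact: H.
have fg : {ae mu, forall u n, `]0%R, +oo[%classic u -> (`|f n u| <= (quad_kernel 0 2^-1 u)%:E)%E}.
  apply: aeW => u n; rewrite /= in_itv/= andbT => u0.
  rewrite gee0_abs; last by rewrite mule_ge0// lee_fin q0.
  rewrite -[leRHS]mule1 lee_wpmul2l ?lee_fin ?q0// probability_le1//.
  exact: (measurable_ltr_set (f := cst _)).
have [_ _ cv] := @dominated_convergence _ _ _ mu _ (measurable_itv _) f h _ mf mh fh ig fg.
have conv d1 (U : measurableType d1) (m : probability U R) (Y : U -> R) :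
    measurable_fun setT Y -> (forall w, 0 <= Y w) ->
    (\int[mu]_(u in `]0%R, +oo[) ((quad_kernel 0 2^-1 u)%:E * m [set w | u < Y w]%R) =
     (1 - \int[m]_w expR (- Y w))%:E)%E.
  move=> mY Y0; rewrite -integral_1BexpR//.
  have mE : measurable_fun setT (fun w => expR (- Y w)).
    by apply: measurableT_comp => //; exact: measurableT_comp.
  have i1 : m.-integrable setT (EFin \o cst 1) by exact: finite_measure_integrable_cst.
  have iE : m.-integrable setT (EFin \o (fun w => expR (- Y w))).
    apply: (@bounded_integrable _ _ _ _ _ 1) => // w.
    by rewrite ger0_norm ?expR_ge0// expR_le1 oppr_le0.
  have := RintegralB measurableT i1 iE.
  rewrite Rintegral_cst// mul1r (_ : fine _ = 1); last exact: (congr1 fine (probability_setT m)).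
  move=> <-; rewrite /Rintegral fineK//.
  exact: (integrable_fin_num _ (integrableB measurableT i1 iE)).
move: cv; rewrite /h conv// => /fine_cvg cv.
have : 1 - fine (\int[mu]_(u in `]0%R, +oo[) f n u)%E @[n --> \oo] -->
    1 - (1 - \int[Q]_w expR (- Zl w)).
  by apply: cvgB; [exact: cvg_cst|exact: cv].
rewrite subKr; apply: cvg_trans; apply: near_eq_cvg; apply: nearW => n /=.
by rewrite /f conv// subKr.
Qed.

(** For [x <= y] the difference is at most (y - x) c exp(-x c), and v exp(-v) <= 1. The point is
    uniformity in the unbounded [c]. *)
Lemma expR_rate_dist (x y c : R) : 0 < x -> 0 < y -> 0 <= c ->
  `|expR (- (x * c)) - expR (- (y * c))| <= `|x - y| / Num.min x y.
Proof.
wlog xy : x y / x <= y.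
  move=> H x0 y0 c0; case/orP: (le_total x y) => [|yx]; first by move=> ?; exact: H.
  by rewrite distrC (distrC x) minC; exact: H.
move=> x0 y0 c0; rewrite (min_l xy).
have e : expR (- (y * c)) = expR (- (x * c)) * expR (- ((y - x) * c)).
  by rewrite -expRD; congr expR; ring.
have h1 : expR (- ((y - x) * c)) <= 1.
  by rewrite expR_le1 oppr_le0 mulr_ge0// subr_ge0.
rewrite (_ : `|x - y| = y - x); last by rewrite distrC ger0_norm ?subr_ge0.
rewrite e -{1}[expR (- (x * c))]mulr1 -mulrBr normrM !ger0_norm ?expR_ge0 ?subr_ge0//.
have h2 : 1 - expR (- ((y - x) * c)) <= (y - x) * c.
  by have := expR_ge1Dx (- ((y - x) * c)); lra.
apply: (le_trans (ler_wpM2l (expR_ge0 _) h2)).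
rewrite mulrCA ler_wpM2l ?subr_ge0//.
rewrite -(ler_pM2r x0) mulVf ?gt_eqF// mulrAC -mulrA mulrC.
rewrite -(ler_pM2r (expR_gt0 (x * c))) -mulrA -expRD addNr expR0 mulr1 mul1r.
by have := expR_ge1Dx (x * c); lra.
Qed.

(** The rate is first frozen at [D], where convergence of the tails applies; [expR_rate_dist]
    controls the replacement uniformly in [Y]. The positive part of [L] is used because [L] may be
    nonpositive on a null event. *)
Lemma laplace_cvg_in_distribution {d d'} {T : measurableType d} {T' : measurableType d'}
    (P : probability T R) (Q : probability T' R) (Y : R -> T -> R) (L : {RV Q >-> R})
    (t c : nat -> R) (D : R) :
  (forall x, measurable_fun setT (Y x)) -> (forall x w, 0 < x -> 0 <= Y x w) ->
  cvg_in_distribution P Y Q L -> Q [set w | 0 < L w] = 1%E ->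
  (forall n, 0 < t n) -> t n @[n --> \oo] --> +oo ->
  (forall n, 0 < c n) -> 0 < D -> c n * t n @[n --> \oo] --> D ->
  \int[P]_w expR (- (c n * (t n * Y (t n) w))) @[n --> \oo] -->
  \int[Q]_w expR (- (D * L w)).
Proof.
move=> mY Y0 cvgY L0 t0 ty c0 D0 ctD.
have mL : measurable_fun setT L by exact: measurable_funP.
pose L' w := Num.max 0 (L w).
have mL' : measurable_fun setT L' by exact: measurable_maxr.
have L'0 w : 0 <= L' w by rewrite le_max lexx.
have -> : \int[Q]_w expR (- (D * L w)) = \int[Q]_w expR (- (D * L' w)).
  congr fine; apply: ae_eq_integral => //.
  - by apply/measurable_EFinP; do 2 apply: measurableT_comp => //; exact: measurable_funM.
  - by apply/measurable_EFinP; do 2 apply: measurableT_comp => //; exact: measurable_funM.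
  - have mS : measurable [set w | 0 < L w] by exact: (measurable_ltr_set (f := cst _)).
    exists (~` [set w | 0 < L w]); split.
    + exact: measurableC.
    + by apply: (eq_trans (probability_setC Q mS)); rewrite L0 subee.
    + by move=> w /= H1 H2; apply: H1 => _; rewrite /L' max_r// ltW.
have main : \int[P]_w expR (- (D * Y (t n) w)) @[n --> \oo] -->
    \int[Q]_w expR (- (D * L' w)).
  apply: cvg_integral_expRN.
  - by move=> n; exact: measurable_funM.
  - by move=> n w; rewrite mulr_ge0 ?Y0// ltW.
  - exact: measurable_funM.
  - by move=> w; rewrite mulr_ge0// ltW.
  (* The exceptional levels are [D] times the atoms of [L]: countably many, hence Lebesgue-null. *)
  exists [set u : R | 0 < pmf L (u / D)]; split.
  - have mp : measurable_fun setT (fun u : R => pmf L (u / D)).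
      apply: (measurableT_comp (pmf_measurable L)); exact: measurable_funM.
    exact: (measurable_ltr_set (f := cst _)).
  - apply: countable_lebesgue_measure0.
    have : countable [set r | 0 < pmf L r] by exact: pmf_gt0_countable.
    have -> : [set u : R | 0 < pmf L (u / D)] = (fun r => r * D) @` [set r | 0 < pmf L r].
      apply/seteqP; split => [u /= uL|_ [r /= rL <-]]; last by rewrite /= mulfK ?gt_eqF.
      by exists (u / D) => //; rewrite divfK ?gt_eqF.
    by apply: sub_countable; exact: card_image_le.
  - move=> u /= Hu; rewrite lt_neqAle pmf_ge0 andbT; apply/eqP => /esym pL.
    apply: Hu => u0.
    have uD0 : 0 < u / D by rewrite divr_gt0.
    have /cvgY cL := continuous_cdf pL.
    have := cvg_comp _ _ ty cL.
    have QE : Q [set w | u < D * L' w] = (1 - pushforward Q L `]-oo, (u / D)%R])%E.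
      rewrite /pushforward -probability_setC; last first.
        by rewrite -[X in measurable X]setTI; exact: measurable_funP.
      congr (Q _); apply/seteqP; split => w /=; rewrite in_itv/= [D * _]mulrC -ltr_pdivrMr// /L' lt_max.
        by case/orP => [/(lt_trans uD0)|]; [rewrite ltxx|rewrite ltNge => /negP].
      by move=> /negP; rewrite -ltNge => ->; rewrite orbT.
    have PE n : P [set w | u < D * Y (t n) w] = (1 - pushforward P (Y (t n)) `]-oo, (u / D)%R])%E.
      rewrite /pushforward -probability_setC; last first.
        by rewrite -[X in measurable X]setTI; exact: mY.
      congr (P _); apply/seteqP; split => w /=; rewrite in_itv/= [D * _]mulrC -ltr_pdivrMr//.
        by rewrite ltNge => /negP.
      by move=> /negP; rewrite -ltNge.
    rewrite QE => cL'.
    have : (1 - pushforward P (Y (t n)) `]-oo, (u / D)%R])%E @[n --> \oo] -->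
        (1 - pushforward Q L `]-oo, (u / D)%R])%E.
      by apply: cvgeB; [exact: fin_num_adde_defr|exact: cvg_cst|exact: cL'].
    by apply: cvg_trans; apply: near_eq_cvg; apply: nearW => n; rewrite -PE.
apply/cvgrPdist_le => e e0.
(* The first bound keeps both rates above [D / 2]; the second, divided by [D / 2], is the wanted
   [e / 2]. *)
have d0 : 0 < Num.min (D / 2) (e * D / 4) by rewrite lt_min !divr_gt0// mulr_gt0.
have intE (f : T -> R) : measurable_fun setT f -> (forall w, 0 <= f w) ->
    P.-integrable setT (EFin \o (fun w => expR (- f w))).
  move=> mf f0; apply: (@bounded_integrable _ _ _ _ _ 1).
    by apply: measurableT_comp => //; exact: measurableT_comp.
  by move=> w; rewrite ger0_norm ?expR_ge0// expR_le1 oppr_le0.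
near=> n.
have c1 : `|D - c n * t n| <= Num.min (D / 2) (e * D / 4).
  by near: n; move/cvgrPdist_le : ctD; exact.
have c2 : `|\int[Q]_w expR (- (D * L' w)) - \int[P]_w expR (- (D * Y (t n) w))| <= e / 2.
  by near: n; move/cvgrPdist_le : main; apply; rewrite divr_gt0.
have i1 := intE _ (measurable_funM (measurable_cst (c n)) (measurable_funM (measurable_cst (t n)) (mY (t n))))
  (fun w => mulr_ge0 (ltW (c0 n)) (mulr_ge0 (ltW (t0 n)) (Y0 _ w (t0 n)))).
have i2 := intE _ (measurable_funM (measurable_cst D) (mY (t n)))
  (fun w => mulr_ge0 (ltW D0) (Y0 _ w (t0 n))).
have c3 : `|\int[P]_w expR (- (D * Y (t n) w)) -
    \int[P]_w expR (- (c n * (t n * Y (t n) w)))| <= e / 2.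
  rewrite -RintegralB//; apply: (le_trans (le_normr_Rintegral _ _)) => //.
    exact: (integrableB measurableT i2 i1).
  apply: (@le_trans _ _ (\int[P]_w (cst (e / 2) w))).
    apply: le_Rintegral => //.
    - by have := integrable_norm (integrableB measurableT i2 i1).
    - exact: finite_measure_integrable_cst.
    - move=> w _ /=; rewrite mulrA.
      apply: (le_trans (expR_rate_dist D0 (mulr_gt0 (c0 n) (t0 n)) (Y0 _ w (t0 n)))).
      move: c1; rewrite le_min => /andP[c11 c12].
      have m0 : D / 2 <= Num.min D (c n * t n).
        rewrite le_min; apply/andP; split; first lra.
        by move: c11; rewrite ler_norml => /andP[_]; lra.
      have m1 : 0 < Num.min D (c n * t n) by apply: lt_le_trans m0; rewrite divr_gt0.
      rewrite ler_pdivrMr//; apply: (le_trans c12).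
      by have := ler_wpM2l (ltW e0) m0; lra.
  rewrite Rintegral_cst// (_ : fine _ = 1) ?mulr1//; exact: (congr1 fine (probability_setT P)).
move: c2 c3; rewrite !ler_norml; lra.
Unshelve. all: by end_near. Qed.

End laplace_convergence.

(** * Sums over the points of a Poisson process *)

Lemma ln1B_le {R : realType} (e : R) : 0 < e <= 2^-1 -> 0 <= - ln (1 - e) <= 2 * e.
Proof.
move=> /andP[e0 e2]; have e1p : 0 < 1 - e by lra.
rewrite oppr_ge0 ln_le0 ?lerBlDr ?lerDl ?(ltW e0)//=.
rewrite -lnV ?posrE//; have -> : (1 - e)^-1 = 1 + e / (1 - e) by field; rewrite gt_eqF.
apply: (le_trans (le_ln1Dx _)).
  by apply: lt_le_trans (divr_ge0 (ltW e0) (ltW e1p)); rewrite ltrN10.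
by rewrite ler_pdivrMr//; nra.
Qed.

Section renewal_fixed_point.
Context {R : realType}.
Notation mu := (@lebesgue_measure R).
Variable g : R -> R.
Hypothesis g0 : forall y, 0 <= g y.
Hypothesis mg : measurable_fun setT g.
Hypothesis cg : forall y, 0 < y -> {for y, continuous g}.
Hypothesis ig : (\int[mu]_(y in `]0%R, +oo[) (1 - expR (- g y))%:E < +oo)%E.

Definition intensity_primitive x : R := \int[mu]_(t in `]0, x]) (1 - expR (- g t)).

Definition intensity_total : R := \int[mu]_(t in `]0, +oo[) (1 - expR (- g t)).

(* The Laplace functional of the points of a unit rate Poisson process lying
   beyond [x]. *)
Definition poisson_laplace x : R := expR (intensity_primitive x - intensity_total).

Let f t : R := 1 - expR (- g t).

Lemma intensity01 t : 0 <= f t <= 1.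
Proof.
by rewrite /f subr_ge0 expR_le1 oppr_le0 g0/= lerBlDr lerDl expR_ge0.
Qed.

Lemma measurable_intensity : measurable_fun setT f.
Proof.
by apply: measurable_funB => //; apply: measurableT_comp => //; exact: measurableT_comp.
Qed.

Lemma integrable_intensity : mu.-integrable (`]0, +oo[%classic : set R) (EFin \o f).
Proof.
apply/integrableP; split.
  by apply: measurable_funTS; apply/measurable_EFinP; exact: measurable_intensity.
apply: le_lt_trans ig; rewrite le_eqVlt; apply/orP; left; apply/eqP.
by apply: eq_integral => t _ /=; rewrite ger0_norm//; have /andP[] := intensity01 t.
Qed.

Lemma intensity_primitiveB x y : 0 <= x <= y ->
  0 <= intensity_primitive y - intensity_primitive x <= y - x.
Proof.
move=> /andP[x0 xy].
have i0y : mu.-integrable (`]0, y]%classic : set R) (EFin \o f).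
  apply: (integrableS _ _ _ integrable_intensity) => //.
  by move=> t /=; rewrite !in_itv/= andbT => /andP[].
rewrite /intensity_primitive Rintegral_itvB ?bnd_simp//.
have ixy : mu.-integrable (`]x, y]%classic : set R) (EFin \o f).
  apply: (integrableS _ _ _ i0y) => // t /=.
  by rewrite !in_itv/= => /andP[xt ->]; rewrite andbT (le_lt_trans x0).
apply/andP; split; first by apply: Rintegral_ge0 => t _; have /andP[] := intensity01 t.
apply: (@le_trans _ _ (\int[mu]_(t in `]x, y]) (cst 1 t))).
  apply: le_Rintegral => //.
  - apply/integrableP; split; first exact/measurable_EFinP.
    rewrite (eq_integral (cst 1%E)) ?integral_cst//=.
      by rewrite mul1e lebesgue_measure_itv/=; case: ifP => _; rewrite -?EFinB ltry.
    by move=> t _ /=; rewrite normr1.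
  - by move=> t _; have /andP[] := intensity01 t.
rewrite Rintegral_cst// mul1r /= lebesgue_measure_itv/= lte_fin.
by case: ifPn => //; rewrite -leNgt => yx; rewrite /= subr_ge0.
Qed.

Lemma intensity_primitive_le x : 0 <= x -> 0 <= intensity_total - intensity_primitive x.
Proof.
move=> x0; rewrite /intensity_total /intensity_primitive.
rewrite Rintegral_itvB ?bnd_simp//; last exact: integrable_intensity.
by apply: Rintegral_ge0 => t _; have /andP[] := intensity01 t.
Qed.

Lemma intensity_primitive_neg x : x <= 0 -> intensity_primitive x = 0.
Proof. by move=> x0; rewrite /intensity_primitive set_itv_ge ?Rintegral_set0// bnd_simp -leNgt. Qed.

Lemma poisson_laplace0 : poisson_laplace 0 = expR (- intensity_total).
Proof. by rewrite /poisson_laplace intensity_primitive_neg// sub0r. Qed.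

Lemma poisson_laplace01 x : 0 <= x -> 0 <= poisson_laplace x <= 1.
Proof.
move=> x0; rewrite expR_ge0 expR_le1 subr_le0 -subr_ge0.
exact: intensity_primitive_le.
Qed.

Lemma measurable_poisson_laplace : measurable_fun setT poisson_laplace.
Proof.
apply: measurableT_comp => //; apply: measurable_funB => //.
apply: nondecreasing_measurable => // x y xy.
have [x0|/ltW x0] := leP 0 x.
  by have := @intensity_primitiveB x y; rewrite x0 xy => /(_ isT) /andP[+ _]; rewrite subr_ge0.
rewrite (intensity_primitive_neg x0).
by apply: Rintegral_ge0 => t _; have /andP[] := intensity01 t.
Qed.

(** The intensity is at most 1 and so is the Laplace functional, whence the Lipschitz constant 1.
    The bound covers [x = 0], beyond the range of [is_derive_poisson_laplace]. *)
Lemma poisson_laplaceB x y : 0 <= x <= y ->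
  0 <= poisson_laplace y - poisson_laplace x <= y - x.
Proof.
move=> xy; have /andP[x0 xley] := xy; have y0 := le_trans x0 xley.
have /andP[h1 h2] := intensity_primitiveB xy.
rewrite subr_ge0 ler_expR lerD2r -subr_ge0 h1/=.
apply: le_trans h2; have /andP[hy0 hy1] := poisson_laplace01 y0.
have -> : poisson_laplace x = poisson_laplace y *
    expR (- (intensity_primitive y - intensity_primitive x)).
  by rewrite /poisson_laplace -expRD; congr expR; ring.
set D := _ - _ in h1 *.
have e1 := expR_ge1Dx (- D).
have : 0 <= poisson_laplace y * (expR (- D) - (1 - D)) by rewrite mulr_ge0 ?expR_ge0//; lra.
have : 0 <= (1 - poisson_laplace y) * D by rewrite mulr_ge0// subr_ge0.
lra.
Qed.

(** By 1 - exp(-v) <= v the gap is at most the tail of a convergent integral. *)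
Lemma poisson_laplace_cvg1 e : 0 < e ->
  exists2 A, 0 <= A & forall x, A <= x -> 1 - poisson_laplace x <= e.
Proof.
move=> e0.
pose F n t : \bar R := (f t * \1_(`]n%:R, +oo[%classic) t)%:E.
have cv : (\int[mu]_(t in `]0%R, +oo[) F n t)%E @[n --> \oo] --> (\int[mu]_(t in `]0%R, +oo[) (cst 0 t))%E.
  have [] := @dominated_convergence _ _ _ mu (`]0, +oo[%classic : set R) (measurable_itv _) F (cst 0%E) (EFin \o f).
  - move=> n; apply: measurable_funTS; apply/measurable_EFinP; apply: measurable_funM.
      exact: measurable_intensity.
    exact: measurable_indic.
  - exact: measurable_cst.
  - apply: aeW => t _; apply: cvg_near_cst; near=> n.
    rewrite /F indicE memNset ?mulr0//= in_itv/= andbT; apply/negP; rewrite -leNgt.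
    by near: n; exact: nbhs_infty_ger.
  - exact: integrable_intensity.
  - apply: aeW => t n _; have /andP[f0 f1] := intensity01 t.
    rewrite /F /= lee_fin indicE; case: (_ \in _); rewrite ?mulr1 ?mulr0 ?normr0// ger0_norm//.
  by [].
rewrite integral0 in cv; move/fine_cvgP : cv => [_ /cvgrPdist_le /(_ e e0)].
move=> [N _ /(_ N (leqnn N))] /=; rewrite sub0r normrN => HN.
exists N%:R => // x Nx; have x0 : 0 <= x by exact: le_trans Nx.
have H : intensity_total - intensity_primitive x <= e.
  have N0 : 0 <= (N%:R : R) <= x by rewrite ler0n.
  have /andP[h1 _] := intensity_primitiveB N0.
  apply: (@le_trans _ _ (intensity_total - intensity_primitive N%:R)); first lra.
  apply: le_trans (ler_norm _) _; apply: le_trans HN.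
  rewrite le_eqVlt; apply/orP; left; apply/eqP; congr (`|_|).
  rewrite /intensity_total /intensity_primitive.
  rewrite Rintegral_itvB ?bnd_simp ?ler0n//; last exact: integrable_intensity.
  rewrite /Rintegral; congr fine; rewrite integral_mkcond [RHS]integral_mkcond.
  apply: eq_integral => t _; rewrite /F !patchE indicE !mem_setE !in_itv/= !andbT.
  case: ifPn => [Nt|_]; last by case: ifP => // _; rewrite mulr0.
  by rewrite (le_lt_trans _ Nt)// mulr1.
by have := expR_ge1Dx (intensity_primitive x - intensity_total); rewrite -/(poisson_laplace x); lra.
Unshelve. all: by end_near. Qed.

Lemma is_derive_poisson_laplace (y : R) : 0 < y ->
  is_derive y (1 : R) poisson_laplace (f y * poisson_laplace y).
Proof.
move=> y0.
have cf : {for y, continuous f}.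
  apply: cvgB; first exact: cvg_cst.
  apply: continuous_comp; last exact: continuous_expR.
  by apply: cvgN; exact: cg.
have i1 : mu.-integrable [set` Interval (BRight 0) (BRight (y + 1))] (EFin \o f).
  apply: (integrableS _ _ _ integrable_intensity) => //.
  by move=> t /=; rewrite !in_itv/= andbT => /andP[].
have yy1 : y < y + 1 by rewrite ltrDl.
have ay : (BRight 0 < BRight y)%O by rewrite bnd_simp.
have [dI IE] := continuous_FTC1 yy1 i1 ay cf.
have isI : is_derive y (1 : R) intensity_primitive (f y).
  by apply: DeriveDef; [exact: dI|rewrite -derive1E; exact: IE].
by apply: is_derive_eq; rewrite /GRing.scale /= /poisson_laplace; ring.
Qed.

Let F x u : R := expR (- g (x - ln u)) * poisson_laplace (x - ln u).

Let M x u : R := u * poisson_laplace (x - ln u).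

(** This is conditioning on the first point after [x], located at [x - ln u]. Analytically, [M x] is
    a primitive of [F x] by [is_derive_poisson_laplace], with limits 0 at [u = 0] and
    [poisson_laplace x] at [u = 1]. The fundamental theorem is applied on [[e, 1 - e]], away from
    the singularity of [ln] and from the argument [x], which may be 0. *)
Lemma poisson_laplace_fixed_point (x : R) : 0 <= x ->
  \int[mu]_(u in `]0, 1[) (expR (- g (x - ln u)) * poisson_laplace (x - ln u)) =
  poisson_laplace x.
Proof.
move=> x0.
rewrite -/(Rintegral mu `]0%R, 1%R[%classic (F x)).
have y0 (u : R) : 0 < u < 1 -> x < x - ln u by move=> ?; rewrite ltrBrDr gtrDl ln_lt0.
have F01 (u : R) : 0 < u < 1 -> 0 <= F x u <= 1.
  move=> u01; have /ltW/(le_trans x0) xl := y0 u u01.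
  have /andP[? ?] := poisson_laplace01 xl.
  by rewrite mulr_ge0 ?expR_ge0//= mulr_ile1 ?expR_ge0// expR_le1 oppr_le0.
have mF : measurable_fun setT (F x).
  have mxl : measurable_fun setT (fun u : R => x - ln u).
    by apply: measurable_funB => //; exact: measurable_ln.
  apply: measurable_funM; last exact: (measurableT_comp measurable_poisson_laplace).
  apply: measurableT_comp => //; apply: measurableT_comp => //.
  exact: (measurableT_comp mg).
have iF : mu.-integrable (`]0, 1[%classic : set R) (EFin \o F x).
  apply: measurable_bounded_integrable => //.
  - by rewrite /= lebesgue_measure_itv/= lte_fin ltr01 -EFinB ltry.
  - exact: measurable_funTS.
  - exists 1; split => // K K1 u; rewrite /= in_itv/= => /F01/andP[? ?].
    by rewrite ger0_norm// (le_trans _ (ltW K1)).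
have small (a b : R) : 0 <= a -> a <= b -> b <= 1 -> forall s : bool,
    mu.-integrable [set` Interval (BRight a) (BSide s b)] (EFin \o F x) ->
    [set` Interval (BRight a) (BSide s b)] `<=` (`]0, 1[%classic : set R) ->
    0 <= \int[mu]_(u in [set` Interval (BRight a) (BSide s b)]) F x u <= b - a.
  move=> a0 ab b1 s iFab sub.
  have F01' u : [set` Interval (BRight a) (BSide s b)] u -> 0 <= F x u <= 1.
    by move=> /sub /=; rewrite in_itv/=; exact: F01.
  apply/andP; split; first by apply: Rintegral_ge0 => u /F01' /andP[].
  apply: (@le_trans _ _ (\int[mu]_(u in [set` Interval (BRight a) (BSide s b)]) (cst 1 u))).
    apply: le_Rintegral => //.
    - apply: measurable_bounded_integrable => //; last exact: bounded_cst.
      by rewrite /= lebesgue_measure_itv/=; case: ifP => _; rewrite -?EFinB ltry.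
    - by move=> u /F01' /andP[].
  rewrite Rintegral_cst// mul1r /= lebesgue_measure_itv/= lte_fin.
  by case: ifPn => //= _; rewrite subr_ge0.
have dM (u : R) : 0 < u < 1 -> is_derive u (1 : R) (M x) (F x u).
  move=> u01; have /andP[u0 u1] := u01.
  have dl := is_derive1_ln u0.
  have := y0 u u01 => /(le_lt_trans x0)/is_derive_poisson_laplace dh.
  have dk : is_derive u (1 : R) (fun u => x - ln u) (- u^-1).
    by have := is_deriveB (is_derive_cst x u 1) dl; rewrite sub0r.
  have dc := @is_derive1_comp _ poisson_laplace (fun u => x - ln u) u _ _ dh dk.
  apply: is_derive_eq.
  by rewrite /GRing.scale /= /F /f; field; rewrite gt_eqF.
(* Each end piece costs [e], and so do [M x e] and the factor [1 - e]; moving the argument by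
   [- ln (1 - e)] costs [2 * e]. *)
have main (e : R) : 0 < e < 2^-1 -> `|\int[mu]_(u in `]0, 1[) F x u - poisson_laplace x| <= 6 * e.
  move=> /andP[e0 e2].
  have e1 : e < 1 - e by lra.
  have l1 : 0 <= - ln (1 - e) <= 2 * e by apply: ln1B_le; rewrite e0 ltW.
  have e01 : 0 < e < 1 by rewrite e0; lra.
  have := @Rintegral_itvB _ (F x) (BRight 0) (BLeft 1) e iF.
  rewrite !bnd_simp => /(_ (ltW e0)) Ha.
  have iF1 : mu.-integrable (`]e, 1[%classic : set R) (EFin \o F x).
    apply: (integrableS _ _ _ iF) => // u /=; rewrite !in_itv/= => /andP[eu ->].
    by rewrite (lt_trans e0 eu).
  have := @Rintegral_itvB _ (F x) (BRight e) (BLeft 1) (1 - e) iF1.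
  rewrite !bnd_simp => /(_ (ltW e1)) Hb.
  have iF2 : mu.-integrable (`]e, 1 - e]%classic : set R) (EFin \o F x).
    apply: (integrableS _ _ _ iF1) => // u /=; rewrite !in_itv/= => /andP[-> ue].
    by rewrite (le_lt_trans ue)// ltrBlDr ltrDl.
  have elt1 : e < 1 by case/andP: e01.
  have e1p : 0 < 1 - e by rewrite subr_gt0.
  have sub1 : (`]0, e]%classic : set R) `<=` `]0, 1[.
    by move=> u /=; rewrite !in_itv/= => /andP[-> ue]; exact: (le_lt_trans ue elt1).
  have sub2 : (`](1 - e), 1[%classic : set R) `<=` `]0, 1[.
    by move=> u /=; rewrite !in_itv/= => /andP[ue ->]; rewrite andbT (lt_trans e1p ue).
  have s1 : 0 <= \int[mu]_(u in `]0, e]) F x u <= e - 0.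
    by apply: small => //; [exact: ltW|exact: ltW|apply: (integrableS _ _ _ iF) => //].
  have s2 : 0 <= \int[mu]_(u in `](1 - e), 1[) F x u <= 1 - (1 - e).
    by apply: small => //; [exact: ltW|rewrite lerBlDr lerDl ltW|apply: (integrableS _ _ _ iF) => //].
  have FTC : \int[mu]_(u in `]e, (1 - e)]) F x u = M x (1 - e) - M x e.
    rewrite Rintegral_itv_obnd_cbnd// /Rintegral (continuous_FTC2 e1 (F := M x)) //.
    - apply: continuous_in_subspaceT => u; rewrite inE/= in_itv/= => /andP[eu ue].
      have u01 : 0 < u < 1.
        by rewrite (lt_le_trans e0 eu)/= (le_lt_trans ue)// ltrBlDr ltrDl.
      have yu := le_lt_trans x0 (y0 u u01).
      have cl : {for u, continuous (fun u => x - ln u)}.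
        apply: cvgB; first exact: cvg_cst.
        by apply: continuous_ln; case/andP: u01.
      apply: cvgM; last first.
        apply: (continuous_comp cl); exact: is_derive_continuous (is_derive_poisson_laplace yu).
      apply: (@continuous_comp _ _ _ (fun u => - g (x - ln u)) expR); last exact: continuous_expR.
      by apply: cvgN; apply: (continuous_comp cl); exact: cg.
    - have dr (u : R) : e <= u <= 1 - e -> is_derive u (1 : R) (M x) (F x u).
        move=> /andP[eu ue]; apply: dM.
        by rewrite (lt_le_trans e0 eu)/= (le_lt_trans ue)// ltrBlDr ltrDl.
      split.
      + by move=> u; rewrite in_itv/= => /andP[/ltW eu /ltW ue]; have [] := dr u; rewrite ?eu ?ue.
      + by apply: cvg_at_right_filter; apply: is_derive_continuous (dr e _); rewrite lexx ltW.
      + by apply: cvg_at_left_filter; apply: is_derive_continuous (dr (1 - e) _); rewrite lexx ltW.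
    - move=> u; rewrite in_itv/= => /andP[eu ue]; rewrite derive1E.
      have u01 : 0 < u < 1 by rewrite (lt_trans e0 eu)/= (lt_trans ue)// ltrBlDr ltrDl.
      by have [] := dM u u01.
  have xy : 0 <= x <= x - ln (1 - e) by rewrite x0/= lerDl; case/andP: l1.
  have /andP[b1 b2] := poisson_laplaceB xy.
  have /andP[b3 b4] := poisson_laplace01 (le_trans x0 (andP xy).2).
  have xe : 0 <= x - ln e by rewrite (le_trans x0)// ltW// y0.
  have /andP[b5 b6] := poisson_laplace01 xe.
  have eh (h : R) : 0 <= h <= 1 -> 0 <= e * h <= e.
    by move=> /andP[h0 h1]; rewrite mulr_ge0 ?(ltW e0)//= ler_piMr// (ltW e0).
  have p1 := eh _ (poisson_laplace01 xe).
  have p2 := eh _ (poisson_laplace01 (le_trans x0 (andP xy).2)).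
  rewrite /M in FTC.
  move: (Hb ltac:(by rewrite ltrBlDr ltrDl)) (Ha elt1) => {Hb}Hb {Ha}Ha.
  move: Hb Ha s1 s2 FTC p1 p2 b1 b2 l1; rewrite ler_norml; clear.
  move: (Rintegral _ _ _) (Rintegral _ _ _) (Rintegral _ _ _) (Rintegral _ _ _) (Rintegral _ _ _) => I1 I2 I3 I4 I5.
  move: (poisson_laplace (x - ln (1 - e))) (poisson_laplace (x - ln e)) (poisson_laplace x) (ln _) => h1 h2 h3 l.
  move=> Hb Ha /andP[s1 s1'] /andP[s2 s2'] FTC /andP[p1 p1'] /andP[p2 p2'] b1 b2 /andP[l1 l2].
  by apply/andP; split; lra.
apply/eqP; rewrite -subr_eq0 -normr_le0; apply/ler_addgt0Pr => e e0; rewrite add0r.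
pose e' := Num.min (e / 6) (4^-1).
have e'0 : 0 < e' by rewrite lt_min; apply/andP; split; lra.
have e'2 : e' < 2^-1 by rewrite gt_min; apply/orP; right; lra.
have e'6 : e' <= e / 6 by rewrite ge_min lexx.
have := main e'; rewrite e'0 e'2 => /(_ isT) /le_trans; apply; lra.
Qed.

End renewal_fixed_point.

(** * Laplace transforms of sums over finitely many Poisson points *)

Section point_sum.
Context {R : realType}.
Notation mu := (@lebesgue_measure R).
Notation U := (@uniform01 R).

(* Sum of [psi] over the [n] points of a unit rate Poisson process following
   [x]; the gaps [- ln u] are exponential variables read off the digits of [w]. *)
Fixpoint point_sum (psi : R -> R) (n : nat) (w x : R) : R :=
  if n is m.+1 then
    psi (x - ln (digits1 w)) + point_sum psi m (digits2 w) (x - ln (digits1 w))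
  else 0.

Lemma point_sum_ge0 (psi : R -> R) n w x : (forall y, 0 <= psi y) ->
  0 <= point_sum psi n w x.
Proof.
by move=> psi0; elim: n w x => //= n IH w x; rewrite addr_ge0.
Qed.

Lemma point_sum_le (psi : R -> R) m n w x : (forall y, 0 <= psi y) -> (m <= n)%N ->
  point_sum psi m w x <= point_sum psi n w x.
Proof.
move=> psi0; elim: m n w x => [|m IH] [|n] w x //= mn; last by rewrite lerD2l IH.
by rewrite addr_ge0// point_sum_ge0.
Qed.

Lemma point_sum_linear (psi1 psi2 : R -> R) (r s : R) n w x :
  point_sum (fun y => r * psi1 y + s * psi2 y) n w x =
  r * point_sum psi1 n w x + s * point_sum psi2 n w x.
Proof. by elim: n w x => [|n IH] w x /=; rewrite ?IH; ring. Qed.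

Lemma measurable_point_sum (psi : R -> R) n : measurable_fun setT psi ->
  measurable_fun setT (fun p : R * R => point_sum psi n p.1 p.2).
Proof.
move=> mpsi; elim: n => [|n IH] /=; first exact: measurable_cst.
have my : measurable_fun setT (fun p : R * R => p.2 - ln (digits1 p.1)).
  apply: measurable_funB => //; apply: (measurableT_comp (@measurable_ln R)) => //.
  exact: (measurableT_comp measurable_digits1).
apply: measurable_funD; first exact: (measurableT_comp mpsi).
have mq : measurable_fun setT (fun p : R * R => (digits2 p.1, p.2 - ln (digits1 p.1))).
  by apply: measurable_fun_pair => //; exact: (measurableT_comp measurable_digits2).
exact: (measurableT_comp IH mq).
Qed.

Lemma measurable_point_sum_at (psi : R -> R) n x : measurable_fun setT psi ->
  measurable_fun setT (fun w => point_sum psi n w x).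
Proof.
move=> mpsi; have mq : measurable_fun setT (fun w : R => (w, x)) by exact: measurable_fun_pair.
exact: (measurableT_comp (measurable_point_sum n mpsi) mq).
Qed.

Section laplace.
Variable g : R -> R.
Hypothesis g0 : forall y, 0 <= g y.
Hypothesis mg : measurable_fun setT g.
Hypothesis cg : forall y, 0 < y -> {for y, continuous g}.
Hypothesis ig : (\int[mu]_(y in `]0%R, +oo[) (1 - expR (- g y))%:E < +oo)%E.

Let H n x := (\int[U]_w (expR (- point_sum g n w x))%:E)%E.

Let h := poisson_laplace g.

Let measurable_laplace n : measurable_fun setT (H n).
Proof.
have := @measurable_fun_fubini_tonelli_F _ _ _ _ R U
  (fun p : R * R => (expR (- point_sum g n p.2 p.1))%:E).
apply; last by move=> p; rewrite lee_fin expR_ge0.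
apply/measurable_EFinP; apply: measurableT_comp => //; apply: measurableT_comp => //.
have mq : measurable_fun setT (fun p : R * R => (p.2, p.1)) by exact: measurable_fun_pair.
exact: (measurableT_comp (measurable_point_sum n mg) mq).
Qed.

Let laplace_ge0 n x : (0 <= H n x)%E.
Proof. by apply: integral_ge0 => w _; rewrite lee_fin expR_ge0. Qed.

Let measurable_gap x : measurable_fun setT (fun u : R => x - ln u).
Proof. by apply: measurable_funB => //; exact: measurable_ln. Qed.

Let measurable_gap_weight x : measurable_fun setT (fun u : R => expR (- g (x - ln u))).
Proof.
apply: measurableT_comp => //; apply: measurableT_comp => //.
exact: (measurableT_comp mg (measurable_gap x)).
Qed.

(** [integral_digits] separates the first gap from the digits feeding the later points, and the sum
    restarts at the first point. *)
Let laplaceS n x : H n.+1 x =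
  (\int[mu]_(u in `]0%R, 1%R[) ((expR (- g (x - ln u)))%:E * H n (x - ln u)))%E.
Proof.
pose F (p : R * R) := (expR (- (g (x - ln p.1) + point_sum g n p.2 (x - ln p.1))))%:E.
have mF : measurable_fun setT F.
  apply/measurable_EFinP; apply: measurableT_comp => //; apply: measurableT_comp => //.
  have mx : measurable_fun setT (fun p : R * R => x - ln p.1).
    exact: (measurableT_comp (measurable_gap x)).
  apply: measurable_funD; first exact: (measurableT_comp mg mx).
  have mq : measurable_fun setT (fun p : R * R => (p.2, x - ln p.1)).
    exact: measurable_fun_pair.
  exact: (measurableT_comp (measurable_point_sum n mg) mq).
have F0 p : (0 <= F p)%E by rewrite lee_fin expR_ge0.
rewrite /H (integral_digits mF F0).
have FE u : (\int[U]_y F (u, y) = (expR (- g (x - ln u)))%:E * H n (x - ln u))%E.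
  rewrite /F /H /= -ge0_integralZl//.
  - by apply: eq_integral => y _; rewrite opprD expRD EFinM.
  - apply/measurable_EFinP; apply: measurableT_comp => //; apply: measurableT_comp => //.
    exact: measurable_point_sum_at.
rewrite (eq_integral _ _ (fun u _ => FE u)).
have mK : measurable_fun setT (fun u => (expR (- g (x - ln u)))%:E * H n (x - ln u))%E.
  apply: emeasurable_funM; first by apply/measurable_EFinP; exact: measurable_gap_weight.
  exact: (measurableT_comp (measurable_laplace n) (measurable_gap x)).
rewrite integral_uniform01//; last first.
  by move=> u; apply: mule_ge0; [rewrite lee_fin expR_ge0|exact: laplace_ge0].
by rewrite integral_itv_obnd_cbnd//; exact: measurable_funTS.
Qed.

Let renewalE x : 0 <= x ->
  (\int[mu]_(u in `]0%R, 1%R[) (expR (- g (x - ln u)) * h (x - ln u))%:E = (h x)%:E)%E.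
Proof.
move=> x0; rewrite /h -[in RHS](poisson_laplace_fixed_point g0 mg cg ig x0)// /Rintegral.
rewrite fineK//; apply: integrable_fin_num => //.
apply: measurable_bounded_integrable => //.
- by rewrite /= lebesgue_measure_itv/= lte_fin ltr01 -EFinB ltry.
- apply: measurable_funTS; apply: measurable_funM; first exact: measurable_gap_weight.
  exact: (measurableT_comp (measurable_poisson_laplace g0 mg ig) (measurable_gap x)).
- exists 1; split => // A A1 u; rewrite /= in_itv/= => /andP[u0 u1].
  have lu : 0 <= x - ln u by rewrite subr_ge0 (le_trans _ x0)// ltW// ln_lt0// u0.
  have /andP[h0 h1] := poisson_laplace01 g0 mg ig lu.
  rewrite ger0_norm ?mulr_ge0 ?expR_ge0//; apply: le_trans (ltW A1).
  by rewrite mulr_ile1 ?expR_ge0// expR_le1 oppr_le0.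
Qed.

Let integral_id01 : (\int[mu]_(u in `]0%R, 1%R[) u%:E <= (2^-1)%:E)%E.
Proof.
have d (u : R) : is_derive u (1 : R) (fun u : R => u ^+ 2 / 2) u.
  by apply: is_derive_eq; rewrite /GRing.scale /=; field.
have E : (\int[mu]_(u in `[0%R, 1%R]) u%:E = (2^-1)%:E)%E.
  rewrite (@continuous_FTC2 _ _ (fun u : R => u ^+ 2 / 2))//.
  - by rewrite -EFinB; congr EFin; field.
  - by apply: continuous_subspaceT => u; exact: cvg_id.
  - split.
    + by move=> u _; have [] := d u.
    + by apply: cvg_at_right_filter; exact: is_derive_continuous (d 0).
    + by apply: cvg_at_left_filter; exact: is_derive_continuous (d 1).
  - by move=> u _; rewrite derive1E; have [] := d u.
rewrite -E; apply: ge0_subset_integral => //.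
- by move=> u /=; rewrite in_itv/= => /andP[u0 _]; rewrite lee_fin.
- by move=> u /=; rewrite !in_itv/= => /andP[/ltW-> /ltW->].
Qed.

(** [H] is generated from the constant 1 by the renewal operator that fixes [h]. This operator need
    not contract the sup norm, but crossing a gap turns [expR (- x)] into [u * expR (- x)], and the
    mean of [u] is 1/2: the weighted part of the error is halved, while [eps] does not grow. *)
Lemma laplace_point_sum_bounds (eps C : R) n x : 0 <= eps -> 0 <= C ->
  (forall y, 0 <= y -> 1 - h y <= eps + C * expR (- y)) -> 0 <= x ->
  ((h x)%:E <= H n x <= (h x + (eps + C * expR (- x) / 2 ^+ n))%:E)%E.
Proof.
move=> eps0 C0 hC; elim: n x => [|n IH] x x0.
  rewrite /H (eq_integral (cst 1%E)); last by move=> w _ /=; rewrite oppr0 expR0.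
  rewrite integral_cst//= mul1e probability_setT !lee_fin.
  have /andP[_ ->] := poisson_laplace01 g0 mg ig x0.
  by have := hC x x0; rewrite divr1 lerBlDl.
have mk : measurable_fun setT (fun u => (expR (- g (x - ln u)) * h (x - ln u))%:E).
  apply/measurable_EFinP; apply: measurable_funM; first exact: measurable_gap_weight.
  exact: (measurableT_comp (measurable_poisson_laplace g0 mg ig) (measurable_gap x)).
have mK : measurable_fun setT (fun u => (expR (- g (x - ln u)))%:E * H n (x - ln u))%E.
  apply: emeasurable_funM; first by apply/measurable_EFinP; exact: measurable_gap_weight.
  exact: (measurableT_comp (measurable_laplace n) (measurable_gap x)).
have hu0 (u : R) : 0 <= (expR (- g (x - ln u)) * h (x - ln u)).
  by rewrite mulr_ge0 ?expR_ge0.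
have gap0 (u : R) : 0 < u < 1 -> 0 <= x - ln u.
  by move=> /andP[u0 u1]; rewrite subr_ge0 (le_trans _ x0)// ltW// ln_lt0// u0.
rewrite laplaceS -(renewalE x0); apply/andP; split.
  apply: ge0_le_integral => //.
  - by move=> u _; rewrite lee_fin.
  - exact: measurable_funTS.
  - exact: measurable_funTS.
  - move=> u /=; rewrite in_itv/= => /gap0/IH /andP[H1 _].
    by rewrite EFinM lee_pmul2l// lte_fin expR_gt0.
set c := C * expR (- x) / 2 ^+ n.
have c0 : 0 <= c by rewrite divr_ge0 ?exprn_ge0// mulr_ge0 ?expR_ge0.
apply: (@le_trans _ _ (\int[mu]_(u in `]0%R, 1%R[)
    ((expR (- g (x - ln u)) * h (x - ln u))%:E + (eps%:E + c%:E * u%:E)))%E).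
  apply: ge0_le_integral => //.
  - by move=> u _; apply: mule_ge0; [rewrite lee_fin expR_ge0|exact: laplace_ge0].
  - exact: measurable_funTS.
  - apply: measurable_funTS; apply: emeasurable_funD => //.
    by apply/measurable_EFinP; apply: measurable_funD => //; exact: measurable_funM.
  - move=> u /=; rewrite in_itv/= => u01; have [u0 _] := andP u01.
    have /andP[_ H2] := IH _ (gap0 u u01).
    apply: (le_trans (lee_wpmul2l _ H2)); first by rewrite lee_fin expR_ge0.
    rewrite -!EFinM -!EFinD lee_fin mulrDr lerD2l.
    have -> : c * u = C * expR (- (x - ln u)) / 2 ^+ n.
      by rewrite opprB expRD lnK ?posrE// /c; ring.
    rewrite -[leRHS]mul1r ler_wpM2r// ?expR_le1 ?oppr_le0//.
    by rewrite addr_ge0// divr_ge0 ?exprn_ge0// mulr_ge0 ?expR_ge0.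
have u0 (u : R) : `]0%R, 1%R[%classic u -> 0 <= u.
  by rewrite /= in_itv/= => /andP[/ltW].
rewrite ge0_integralD//; last 4 first.
- by move=> u _; rewrite lee_fin.
- exact: measurable_funTS.
- by move=> u /u0 ?; rewrite -EFinM -EFinD lee_fin addr_ge0// mulr_ge0.
- apply: measurable_funTS; apply/measurable_EFinP.
  by apply: measurable_funD => //; exact: measurable_funM.
rewrite (renewalE x0) [leRHS]EFinD leeD2l//.
rewrite ge0_integralD//; last 2 first.
- by move=> u /u0 ?; rewrite -EFinM lee_fin mulr_ge0.
- by apply: measurable_funTS; apply/measurable_EFinP; exact: measurable_funM.
rewrite integral_cst//= lebesgue_measure_itv/= lte_fin ltr01 sube0 mule1.
rewrite [leRHS]EFinD leeD2l// ge0_integralZl//.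
have -> : C * expR (- x) / 2 ^+ n.+1 = c * 2^-1.
  by rewrite /c exprS invfM; ring.
by rewrite [leRHS]EFinM; apply: lee_wpmul2l; [rewrite lee_fin|exact: integral_id01].
Qed.

Lemma cvg_laplace_point_sum :
  (\int[U]_w (expR (- point_sum g n w 0))%:E)%E @[n --> \oo] -->
  (expR (- intensity_total g))%:E.
Proof.
have h01 := poisson_laplace01 g0 mg ig.
have bd (eps : R) : 0 < eps -> exists2 C, 0 <= C &
    forall n, ((expR (- intensity_total g))%:E <= H n 0 <=
      (expR (- intensity_total g) + (eps + C / 2 ^+ n))%:E)%E.
  move=> eps0; have [A A0 HA] := poisson_laplace_cvg1 g0 mg ig eps0.
  (* Beyond [A] the gap [1 - h y] is at most [eps]; before [A] it is at most 1, hence at most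
     [expR A * expR (- y)]. *)
  exists (expR A); first exact: expR_ge0.
  move=> n; rewrite -poisson_laplace0.
  have := @laplace_point_sum_bounds eps (expR A) n 0 (ltW eps0) (expR_ge0 _) _ (lexx 0).
  rewrite oppr0 expR0 mulr1; apply => y y0.
  have [Ay|yA] := leP A y.
    by apply: (le_trans (HA y Ay)); rewrite lerDl mulr_ge0 ?expR_ge0.
  have /andP[hy0 _] := h01 y y0.
  have : 1 <= expR A * expR (- y) by rewrite -expRD -expR0 ler_expR subr_ge0 (ltW yA).
  by rewrite -/h in hy0 *; lra.
have fin n : H n 0 \is a fin_num.
  have [C C0 /(_ n)/andP[h1 h2]] := bd 1 ltr01.
  by rewrite fin_numElt (lt_le_trans _ h1) ?ltNyr//= (le_lt_trans h2) ?ltry.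
apply/fine_cvgP; split; first exact: nearW.
apply/cvgrPdist_le => e e0.
have [C C0 HC] := bd (e / 2) ltac:(by rewrite divr_gt0).
have cv : C / 2 ^+ n @[n --> \oo] --> (0 : R).
  under eq_fun do rewrite -exprVn.
  by apply: (@cvg_geometric R C (2^-1)); rewrite ger0_norm ?invf_lt1// ltr1n.
near=> n.
have cn : C / 2 ^+ n <= e / 2.
  by near: n; apply: (cvgr_le _ cv); rewrite divr_gt0.
have /andP[] := HC n; rewrite -{1 2}(fineK (fin n)) !lee_fin /= => h1 h2.
rewrite distrC ger0_norm ?subr_ge0//; rewrite /H in h1 h2 *; lra.
Unshelve. all: by end_near. Qed.

End laplace.
End point_sum.

Section point_series.
Context {R : realType} (psi : R -> R).
Hypothesis psi0 : forall y, 0 <= psi y.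
Hypothesis mpsi : measurable_fun setT psi.

(* [expR (- S)] where [S] is the possibly infinite sum over all the points. *)
Definition exp_point_series (w : R) : R :=
  limn (fun n => expR (- point_sum psi n w 0)).

Lemma cvg_exp_point_series w :
  expR (- point_sum psi n w 0) @[n --> \oo] --> exp_point_series w.
Proof.
apply: nonincreasing_is_cvgn.
  by move=> m n mn; rewrite ler_expR lerN2 point_sum_le.
by exists 0 => _ [n _ <-]; exact: expR_ge0.
Qed.

Lemma exp_point_series_le n w : exp_point_series w <= expR (- point_sum psi n w 0).
Proof.
apply: nonincreasing_cvgn_ge; last exact: (cvgP _ (cvg_exp_point_series (w := w))).
by move=> k l kl; rewrite ler_expR lerN2 point_sum_le.
Qed.

Lemma exp_point_series_ge0 w : 0 <= exp_point_series w.
Proof. by apply: (cvgr_to_ge (cvg_exp_point_series (w := w))); apply: nearW => n; exact: expR_ge0. Qed.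

Lemma exp_point_series_le1 w : exp_point_series w <= 1.
Proof. by have := exp_point_series_le 0 w; rewrite /= oppr0 expR0. Qed.

Lemma measurable_exp_point_series : measurable_fun setT exp_point_series.
Proof.
apply: (measurable_fun_cvg (h := fun n w => expR (- point_sum psi n w 0))).
  move=> n; apply: measurableT_comp => //; apply: measurableT_comp => //.
  exact: measurable_point_sum_at.
by move=> w _; exact: cvg_exp_point_series.
Qed.

Lemma exp_point_series_gt0 b w : (forall n, point_sum psi n w 0 <= b) ->
  0 < exp_point_series w.
Proof.
move=> H; apply: (lt_le_trans (expR_gt0 (- b))).
apply: (cvgr_to_ge (cvg_exp_point_series (w := w))); apply: nearW => n.
by rewrite ler_expR lerN2.
Qed.

Lemma cvg_point_series w : 0 < exp_point_series w ->
  point_sum psi n w 0 @[n --> \oo] --> - ln (exp_point_series w).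
Proof.
move=> k0.
have H : ln (expR (- point_sum psi n w 0)) @[n --> \oo] --> ln (exp_point_series w).
  by apply: continuous_cvg; [exact: continuous_ln|exact: cvg_exp_point_series].
have -> : (fun n => point_sum psi n w 0) = (fun n => - ln (expR (- point_sum psi n w 0))).
  by apply/funext => n; rewrite expRK opprK.
exact: cvgN H.
Qed.

Hypothesis cpsi : forall y, 0 < y -> {for y, continuous psi}.
Hypothesis ipsi :
  (\int[lebesgue_measure]_(y in `]0%R, +oo[) (1 - expR (- psi y))%:E < +oo)%E.

Lemma integral_exp_point_series :
  (\int[uniform01]_w (exp_point_series w)%:E = (expR (- intensity_total psi))%:E)%E.
Proof.
have mk n : measurable_fun setT (fun w => (expR (- point_sum psi n w 0))%:E).
  apply/measurable_EFinP; apply: measurableT_comp => //; apply: measurableT_comp => //.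
  exact: measurable_point_sum_at.
have H1 := cvg_laplace_point_sum psi0 mpsi cpsi ipsi.
have H2 := @dominated_cvg _ _ _ (@uniform01 R) setT measurableT
  (fun n w => (expR (- point_sum psi n w 0))%:E) (fun w => (exp_point_series w)%:E) (cst 1%E) mk.
have {H2} := H2 _ (fun _ _ => isT) _ _.
move=> H2; apply: (cvg_unique _ _ H1) => //; apply: H2.
- by move=> w _; apply: cvg_EFin; [exact: nearW|exact: cvg_exp_point_series].
- by apply: finite_measure_integrable_cst.
- move=> n w _ /=; rewrite lee_fin ger0_norm ?expR_ge0// expR_le1 oppr_le0.
  exact: point_sum_ge0.
Qed.

End point_series.

(** * The stable pair: almost sure convergence and joint transform *)

Section stable_pair.
Context {R : realType} (alpha : R).
Hypothesis alpha01 : 0 < alpha < 1.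
Notation mu := (@lebesgue_measure R).
Notation U := (@uniform01 R).

Let psi1 (y : R) := y `^ (- alpha^-1).

Let psi2 (y : R) := psi1 y ^+ 2.

Let psi1_ge0 y : 0 <= psi1 y. Proof. exact: powR_ge0. Qed.

Let psi2_ge0 y : 0 <= psi2 y. Proof. exact: sqr_ge0. Qed.

Let measurable_psi1 : measurable_fun setT psi1. Proof. exact: measurable_powR. Qed.

Let measurable_psi2 : measurable_fun setT psi2. Proof. exact: (measurable_funX 2 measurable_psi1). Qed.

Let jumpE r s : jump_weight alpha r s = fun y => r * psi2 y + s * psi1 y.
Proof. by []. Qed.

Let jump_ge0 r s : 0 <= r -> 0 <= s -> forall y, 0 <= jump_weight alpha r s y.
Proof. by move=> r0 s0 y; rewrite addr_ge0 ?mulr_ge0 ?sqr_ge0 ?powR_ge0. Qed.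

Let measurable_jump r s : measurable_fun setT (jump_weight alpha r s).
Proof.
by apply: measurable_funD; apply: measurable_funM => //; exact: measurable_psi2.
Qed.

Let continuous_jump r s y : 0 < y -> {for y, continuous (jump_weight alpha r s)}.
Proof.
move=> y0; rewrite jumpE.
have c1 : {for y, continuous psi1} := is_derive_continuous (is_derive1_powR (- alpha^-1) y0).
apply: cvgD; apply: cvgM; [exact: cvg_cst| |exact: cvg_cst|exact: c1].
exact: (cvgM c1 c1).
Qed.

Let integral_jump r s : 0 < r -> 0 <= s ->
  (\int[mu]_(y in `]0%R, +oo[) (1 - expR (- jump_weight alpha r s y))%:E < +oo)%E.
Proof. by move=> r0 s0; rewrite -(delta_jump_weight alpha01 r0 s0) ltry. Qed.

Let intensity_jump r s : 0 < r -> 0 <= s ->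
  intensity_total (jump_weight alpha r s) = delta alpha r s.
Proof.
move=> r0 s0; rewrite /intensity_total /Rintegral -(delta_jump_weight alpha01 r0 s0).
by move: (delta _ _ _).
Qed.

(** On []0, 1]] the jump y^(-1/alpha) is at least 1, so the integrand is at least
    [1 - expR (- r)]. *)
Lemma delta_gt0 r s : 0 < r -> 0 <= s -> 0 < delta alpha r s.
Proof.
move=> r0 s0; rewrite -lte_fin (delta_jump_weight alpha01 r0 s0).
have sub : (`]0, 1]%classic : set R) `<=` `]0, +oo[.
  by move=> y /=; rewrite !in_itv/= andbT => /andP[].
have f0 y : (0 <= (1 - expR (- jump_weight alpha r s y))%:E)%E.
  by rewrite lee_fin subr_ge0 expR_le1 oppr_le0 jump_ge0// ltW.
have mf : measurable_fun setT (fun y => (1 - expR (- jump_weight alpha r s y))%:E).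
  apply/measurable_EFinP; apply: measurable_funB => //.
  apply: measurableT_comp => //; apply: measurableT_comp => //.
apply: (@lt_le_trans _ _ (\int[mu]_(y in `]0%R, 1%R]) (1 - expR (- r))%:E)%E).
  rewrite integral_cst//= lebesgue_measure_itv/= lte_fin ltr01 sube0 mule1 lte_fin.
  by rewrite subr_gt0 expR_lt1 oppr_lt0.
apply: (@le_trans _ _ (\int[mu]_(y in `]0%R, 1%R]) (1 - expR (- jump_weight alpha r s y))%:E)%E).
  apply: ge0_le_integral => //.
  - by move=> y _; rewrite lee_fin subr_ge0 expR_le1 oppr_le0 ltW.
  - exact: measurable_funTS.
  - move=> y /=; rewrite in_itv/= => /andP[y0 y1].
    rewrite lee_fin lerD2l lerN2 ler_expR lerN2 /jump_weight.
    have p1 : 1 <= psi1 y.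
      have a0 : 0 < alpha^-1 by rewrite invr_gt0; case/andP: alpha01.
      rewrite /psi1 powRN invf_ge1 ?powR_gt0//.
      by have := @ge0_ler_powR R _ (ltW a0) y 1; rewrite !nnegrE powR1; apply => //; exact: ltW.
    apply: (@le_trans _ _ (r * psi2 y)).
      by rewrite -[leLHS]mulr1 ler_wpM2l ?(ltW r0)// /psi2 exprn_ege1.
    by rewrite lerDl mulr_ge0// powR_ge0.
by apply: ge0_subset_integral => //; exact: measurable_funTS.
Qed.

Let k r s w := exp_point_series (jump_weight alpha r s) w.

Let integral_k r s : 0 < r -> 0 <= s ->
  (\int[U]_w (k r s w)%:E = (expR (- delta alpha r s))%:E)%E.
Proof.
move=> r0 s0; rewrite -(intensity_jump r0 s0); apply: integral_exp_point_series => //.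
- exact: (jump_ge0 (ltW r0)).
- exact: continuous_jump.
- exact: integral_jump.
Qed.

Let k1 := exp_point_series psi1.

Let k2 := exp_point_series psi2.

Let F := [set w | 0 < k1 w] `&` [set w | 0 < k2 w].

(** A positive value bounds the weighted partial sums, and both weights being positive, it bounds
    each of the two series. *)
Let k_gt0 r s w : 0 < r -> 0 < s -> 0 < k r s w -> F w.
Proof.
move=> r0 s0 k0; have kn n : r * point_sum psi2 n w 0 + s * point_sum psi1 n w 0 <= - ln (k r s w).
  have := exp_point_series_le (jump_ge0 (ltW r0) (ltW s0)) n w.
  rewrite jumpE point_sum_linear -jumpE -/(k r s w) => H.
  by rewrite lerNr -ler_expR lnK.
have p1 n := point_sum_ge0 n w 0 psi1_ge0; have p2 n := point_sum_ge0 n w 0 psi2_ge0.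
split.
- apply: (@exp_point_series_gt0 R psi1 psi1_ge0 (- ln (k r s w) / s) w) => n.
  rewrite ler_pdivlMr//; apply: le_trans (kn n).
  by rewrite mulrC lerDr mulr_ge0// ltW.
- apply: (@exp_point_series_gt0 R psi2 psi2_ge0 (- ln (k r s w) / r) w) => n.
  rewrite ler_pdivlMr//; apply: le_trans (kn n).
  by rewrite mulrC lerDl mulr_ge0// ltW.
Qed.

Let measurable_F : measurable F.
Proof.
apply: measurableI; apply: measurable_ltr_set => //.
- exact: (measurable_exp_point_series psi1_ge0).
- exact: (measurable_exp_point_series psi2_ge0).
Qed.

(** By [delta_scale], the weights lam^(2/alpha) and lam^(1/alpha) give [k] the mean exp(-lam D). As
    [k] is at most the indicator of [F], a small [lam] brings the probability of [F] as close to 1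
    as desired. *)
Let prob_F : U F = 1%E.
Proof.
apply/eqP; rewrite eq_le probability_le1//=; apply/lee_addgt0Pr => e e0.
have d0 := delta_gt0 ltr01 (@ler01 R); set D := delta alpha 1 1 in d0.
pose lam := e / D; have lam0 : 0 < lam by rewrite divr_gt0.
have r0 : 0 < lam `^ alpha^-1 ^+ 2 by rewrite exprn_gt0// powR_gt0.
have s0 : 0 < lam `^ alpha^-1 by rewrite powR_gt0.
have := integral_k r0 (ltW s0).
have := delta_scale alpha01 ltr01 ler01 lam0; rewrite !mul1r => ->.
rewrite -/D divfK ?gt_eqF// => kE.
have : ((expR (- e))%:E <= U F)%E.
  rewrite -kE -[F]setIT -integral_indic//; apply: ge0_le_integral => //.
  - by move=> w _; rewrite lee_fin; apply: exp_point_series_ge0 => //; apply: jump_ge0; exact: ltW.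
  - apply/measurable_EFinP; apply: measurable_exp_point_series => //; apply: jump_ge0; exact: ltW.
  - by apply/measurable_EFinP/measurable_indic.
  - move=> w _; rewrite lee_fin indicE.
    have kw0 : 0 <= k (lam `^ alpha^-1 ^+ 2) (lam `^ alpha^-1) w.
      by apply: exp_point_series_ge0 => //; apply: jump_ge0; exact: ltW.
    have [k0|] := ltP 0 (k (lam `^ alpha^-1 ^+ 2) (lam `^ alpha^-1) w); last first.
      by move=> /le_trans; apply; rewrite ler0n.
    rewrite mem_set; last exact: k_gt0 k0.
    by apply: exp_point_series_le1 => //; apply: jump_ge0; exact: ltW.
move=> H; apply: (@le_trans _ _ ((expR (- e))%:E + e%:E)%E); last exact: leeD2r.
by rewrite -EFinD lee_fin; have := expR_ge1Dx (- e); lra.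
Qed.

(** The condition on [digits1] puts the first point strictly to the right of 0, so that neither sum
    vanishes. *)
Let G := F `&` [set w | 0 < digits1 w < 1].

Let measurable_digit : measurable [set w : R | 0 < digits1 w < 1].
Proof.
have -> : [set w : R | 0 < digits1 w < 1] = [set w | 0 < digits1 w] `&` [set w | digits1 w < 1].
  by apply/seteqP; split => w /=; [move=> /andP[]|case=> -> ->].
by apply: measurableI; apply: measurable_ltr_set => //;
  exact: measurable_digits1.
Qed.

Let measurable_G : measurable G. Proof. exact: measurableI. Qed.

Let prob_digit : U [set w | 0 < digits1 w < 1] = 1%E.
Proof.
have mI : measurable_fun setT (fun u : R => (\1_(`]0, 1[%classic) u)%:E : \bar R).
  by apply/measurable_EFinP/measurable_indic.
have I0 (u : R) : (0 <= (\1_(`]0%R, 1%R[%classic : set R) u)%:E :> \bar R)%E by rewrite lee_fin.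
have mF : measurable_fun setT (fun p : R * R => (\1_(`]0, 1[%classic) p.1)%:E : \bar R).
  exact: (measurableT_comp mI measurable_fst).
have := @integral_digits R _ mF (fun p => I0 p.1); rewrite /=.
have -> : (fun x : R => (\1_(`]0, 1[%classic : set R) (digits1 x))%:E : \bar R) =
    (fun x => (\1_[set w | 0 < digits1 w < 1] x)%:E).
  by apply/funext => x; rewrite !indicE; congr (_%:R%:E); apply/idP/idP; rewrite !inE/= in_itv.
rewrite integral_indic// setIT => ->.
under eq_integral do rewrite integral_cst//= probability_setT mule1.
rewrite integral_uniform01// integral_indic//.
have -> : (`]0, 1[%classic : set R) `&` `[0, 1[ = `]0, 1[%classic.
  by apply/setIidPl => u /=; rewrite !in_itv/= => /andP[/ltW-> ->].
by rewrite /= lebesgue_measure_itv/= lte_fin ltr01 sube0.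
Qed.

Let ae_G : {ae U, forall w, G w}.
Proof.
by apply: filterI; apply: ae_prob1.
Qed.

Let inG w := [&& 0 < k1 w, 0 < k2 w, 0 < digits1 w & digits1 w < 1].

Let inGP w : reflect (G w) (inG w).
Proof. by apply: (iffP and4P) => [[]|[[]? ? /andP[]]]; split=> //; apply/andP. Qed.

Let measurable_inG : measurable_fun setT inG.
Proof.
apply: (measurable_fun_bool true); rewrite setTI.
rewrite (_ : _ @^-1` _ = G)//; apply/seteqP; split => w /=; first by move/inGP.
by move=> ?; apply/inGP.
Qed.

(** The sums are read off as minus the logarithms of the two functionals and set to 1 off the almost
    sure event [G]; positivity then holds everywhere and the transform is unaffected. *)
Lemma stable_pair_exists : exists U1 V1 : R -> R,
  [/\ measurable_fun setT U1, measurable_fun setT V1,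
      (forall w, 0 < U1 w), (forall w, 0 < V1 w) &
      forall r s, 0 < r -> 0 <= s ->
        (\int[U]_w (expR (- (r * U1 w + s * V1 w)))%:E = (expR (- delta alpha r s))%:E)%E].
Proof.
have lnk_gt0 psi w : (forall y, 0 <= psi y) -> (forall y, 0 < y -> 0 < psi y) ->
    0 < digits1 w < 1 -> 0 < exp_point_series psi w -> 0 < - ln (exp_point_series psi w).
  move=> psi_ge0 psi_gt0 dw kw; rewrite oppr_gt0 ln_lt0// kw/=.
  apply: (le_lt_trans (exp_point_series_le psi_ge0 1 w)) => /=.
  by rewrite expR_lt1 oppr_lt0 addr0 psi_gt0// sub0r oppr_gt0 ln_lt0.
have mln psi : measurable_fun setT (exp_point_series psi) ->
    measurable_fun setT (fun w => if inG w then - ln (exp_point_series psi w) else 1).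
  move=> mk; apply: measurable_fun_ifT => //.
  apply: measurableT_comp => //; exact: (measurableT_comp (@measurable_ln R)).
exists (fun w => if inG w then - ln (k2 w) else 1), (fun w => if inG w then - ln (k1 w) else 1).
split.
- by apply: mln; exact: (measurable_exp_point_series psi2_ge0).
- by apply: mln; exact: (measurable_exp_point_series psi1_ge0).
- move=> w; case: ifPn => // /inGP[[_ ?] ?]; apply: lnk_gt0 => // y y0.
  by rewrite /psi2 exprn_gt0// powR_gt0.
- move=> w; case: ifPn => // /inGP[[? _] ?]; apply: lnk_gt0 => // y y0.
  by rewrite powR_gt0.
- move=> r s r0 s0; rewrite -(integral_k r0 s0).
  have mk : measurable_fun setT (k r s).
    exact: (measurable_exp_point_series (jump_ge0 (ltW r0) s0) (measurable_jump r s)).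
  have mU := mln _ (measurable_exp_point_series psi2_ge0 measurable_psi2).
  have mV := mln _ (measurable_exp_point_series psi1_ge0 measurable_psi1).
  apply: ae_eq_integral => //.
  + apply/measurable_EFinP; apply: measurableT_comp => //; apply: measurableT_comp => //.
    exact: (measurable_funD (measurable_funM (measurable_cst r) mU) (measurable_funM (measurable_cst s) mV)).
  + exact/measurable_EFinP.
  + apply: filterS ae_G => w Gw _; have [[h1 h2] _] := Gw.
    have -> : inG w by exact/inGP.
    congr EFin; apply: (cvg_unique _ _ (cvg_exp_point_series (jump_ge0 (ltW r0) s0) (w := w))) => //.
    apply: continuous_cvg; first exact: continuous_expR.
    apply: cvgN; rewrite jumpE.
    under eq_fun do rewrite point_sum_linear.
    apply: cvgD; apply: cvgM; (try exact: cvg_cst).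
      exact: cvg_point_series.
    exact: cvg_point_series.
Qed.

End stable_pair.

(** * The limit law and its uniqueness *)

Section mixture.
Context {R : realType} {d : measure_display} {T : measurableType d} (Q : probability T R)
  (Lambda : {RV Q >-> R}) (alpha : R).
Hypothesis alpha01 : 0 < alpha < 1.
Hypothesis Lambda_gt0 : Q [set w | 0 < Lambda w] = 1%E.

(** On the product space, the pair is rescaled by powers of the first coordinate; given that
    coordinate, [delta_scale] multiplies the exponent by the value of [Lambda]. *)
Lemma mixture_exists : exists (d1 : measure_display) (T1 : measurableType d1)
    (P1 : probability T1 R) (U V : {RV P1 >-> R}),
  [/\ has_UV_transform alpha Lambda U V, forall w, 0 < U w & forall w, 0 < V w].
Proof.
have [U1 [V1 [mU1 mV1 U1_gt0 V1_gt0 UV1]]] := stable_pair_exists alpha01.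
(* A version of [Lambda] positive everywhere, so that its real powers are positive scaling
   factors. *)
pose L w := if 0 < Lambda w then Lambda w else 1.
have L0 w : 0 < L w by rewrite /L; case: ifPn.
have mL : measurable_fun setT L.
  by apply: measurable_fun_ifT => //; exact: measurable_fun_ltr.
pose q w := L w `^ alpha^-1.
have q0 w : 0 < q w by rewrite powR_gt0.
have mq : measurable_fun setT q by exact: (measurableT_comp (measurable_powR alpha^-1) mL).
have mq1 : measurable_fun setT (fun p : T * R => q p.1) by exact: (measurableT_comp mq).
have mU : measurable_fun setT (fun p : T * R => q p.1 ^+ 2 * U1 p.2).
  by apply: measurable_funM; [exact: (measurable_funX 2 mq1)|exact: (measurableT_comp mU1)].
have mV : measurable_fun setT (fun p : T * R => q p.1 * V1 p.2).
  by apply: measurable_funM => //; exact: (measurableT_comp mV1).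
pose P1 : probability (T * R)%type R := (Q \x @uniform01 R)%E.
pose U : {RV P1 >-> R} := HB.pack (fun p : T * R => q p.1 ^+ 2 * U1 p.2)
  (isMeasurableFun.Build _ _ _ _ _ mU).
pose V : {RV P1 >-> R} := HB.pack (fun p : T * R => q p.1 * V1 p.2)
  (isMeasurableFun.Build _ _ _ _ _ mV).
exists _, _, P1, U, V; split => [r s r0 s0|w|w]; last 2 first.
- by rewrite /U /= mulr_gt0// exprn_gt0.
- by rewrite /V /= mulr_gt0.
pose f (p : T * R) := (expR (- (r * U p + s * V p)))%:E.
have mf : measurable_fun setT f.
  apply/measurable_EFinP; apply: measurableT_comp => //; apply: measurableT_comp => //.
  exact: (measurable_funD (measurable_funM (measurable_cst r) mU) (measurable_funM (measurable_cst s) mV)).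
have f0 p : (0 <= f p)%E by rewrite lee_fin expR_ge0.
have fE w : (fubini_F (@uniform01 R) f w = (expR (- delta alpha r s * L w))%:E)%E.
  rewrite mulNr [X in - X]mulrC -(delta_scale alpha01 r0 s0 (L0 w)) -UV1.
  - by apply: eq_integral => u _; rewrite /f /U /V /=; rewrite -!mulrA.
  - by apply: mulr_gt0 => //; apply: exprn_gt0; exact: q0.
  - by apply: mulr_ge0 => //; apply: ltW; exact: q0.
transitivity (\int[P1]_p f p)%E.
  by rewrite unlock; apply: eq_integral => p _ /=; rewrite /f opprD -!mulNr.
rewrite /P1 fubini_tonelli1// (eq_integral _ _ (fun w _ => fE w)) unlock.
have md (g : T -> R) : measurable_fun setT g ->
    measurable_fun setT (fun w => (expR (- delta alpha r s * g w))%:E).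
  move=> mg; apply/measurable_EFinP; apply: measurableT_comp => //.
  exact: (measurable_funM (measurable_cst _) mg).
apply: ae_eq_integral => //; [exact: md|exact: md|].
apply: filterS (ae_prob1 _ Lambda_gt0); last exact: (measurable_ltr_set (f := cst _)).
by move=> w /= Lw _; rewrite /L Lw.
Qed.

End mixture.

(** Bernoulli's inequality gives n (m - 1)^+ <= m^n, so the mean of (m - 1)^+ is at most 1/n for
    every n. *)
Lemma ae_le1_moments {d} {T : measurableType d} {R : realType} (P : probability T R)
    (m : T -> R) : measurable_fun setT m -> (forall w, 0 <= m w) ->
  (forall n, (0 < n)%N -> (\int[P]_w (m w ^+ n)%:E <= 1)%E) -> {ae P, forall w, m w <= 1}.
Proof.
move=> mm m0 mom; pose g w := Num.max (m w - 1) 0.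
have g0 w : 0 <= g w by rewrite /g le_max lexx orbT.
have mg : measurable_fun setT (fun w => (g w)%:E).
  by apply/measurable_EFinP; apply: measurable_maxr => //; exact: measurable_funB.
have bernoulli n w : n%:R * g w <= m w ^+ n.
  have [m1|/ltW m1] := leP (m w) 1.
    by rewrite /g max_r ?subr_le0// mulr0 exprn_ge0.
  rewrite /g max_l ?subr_ge0//; elim: n => [|n IH]; first by rewrite mul0r ler01.
  have h1 : 1 <= m w ^+ n by rewrite exprn_ege1.
  have h2 : 0 <= (m w ^+ n - 1) * (m w - 1) by rewrite mulr_ge0 ?subr_ge0.
  by rewrite exprS -natr1; nra.
have I0 : (\int[P]_w (g w)%:E = 0)%E.
  have Ig n : ((n.+1)%:R%:E * \int[P]_w (g w)%:E <= 1)%E.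
    rewrite -ge0_integralZl//; last by move=> w _; rewrite lee_fin.
    apply: le_trans (mom n.+1 isT); apply: ge0_le_integral => //.
    - by move=> w _; rewrite -EFinM lee_fin mulr_ge0.
    - by apply: emeasurable_funM => //; exact: measurable_cst.
    - by apply/measurable_EFinP; exact: measurable_funX.
    - by move=> w _; rewrite -EFinM lee_fin.
  have Ipos : (0 <= \int[P]_w (g w)%:E)%E by apply: integral_ge0 => w _; rewrite lee_fin.
  have fin : (\int[P]_w (g w)%:E)%E \is a fin_num.
    by rewrite ge0_fin_numE//; have := Ig 0; rewrite mul1e => /le_lt_trans; apply; rewrite ltry.
  apply/eqP; rewrite eq_le Ipos andbT; move: fin Ig => /fineK <- Ig.
  rewrite lee_fin; apply/ler_addgt0Pr => e e0; rewrite add0r.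
  have [n ne] : exists n, e^-1 < n.+1%:R.
    by exists (Num.trunc e^-1); rewrite truncnS_gt.
  have := Ig n; rewrite -EFinM lee_fin => H.
  by rewrite -(ler_pM2l (ltr0Sn _ n)) (le_trans H)// -ler_pdivrMr// mul1r ltW.
have : ae_eq P setT (fun w => (g w)%:E) (cst 0%E).
  apply/ae_eq_integral_abs => //; rewrite -[RHS]I0; apply: eq_integral => w _.
  by rewrite gee0_abs// lee_fin.
apply: filterS => w /(_ I) /= [] gw.
have : m w - 1 <= g w by rewrite le_max lexx.
by rewrite gw subr_le0.
Qed.

(** * Consequences of the transform identity *)

Section transform.
Context {R : realType} {d d' : measure_display} {T : measurableType d} {T' : measurableType d'}
  (P : probability T R) (Q : probability T' R) (Lambda : {RV Q >-> R}) (alpha : R)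
  (U V : {RV P >-> R}).
Hypothesis alpha01 : 0 < alpha < 1.
Hypothesis Lambda_gt0 : Q [set w | 0 < Lambda w] = 1%E.
Hypothesis UV : has_UV_transform alpha Lambda U V.

(** The transform forces [U] and [U + V] to be nonnegative almost surely only; the cap keeps the
    coordinates in the unit interval everywhere. *)
Definition exp_clip (x : R) : R := Num.min 1 (expR (- x)).

Lemma exp_clip01 x : 0 <= exp_clip x <= 1.
Proof. by rewrite /exp_clip le_min ge_min lexx ler01 expR_ge0. Qed.

Lemma measurable_exp_clip (f : T -> R) : measurable_fun setT f ->
  measurable_fun setT (fun w => exp_clip (f w)).
Proof.
by move=> mf; apply: measurable_minr => //; apply: measurableT_comp => //; exact: measurableT_comp.
Qed.

(* The value at [i = j = 0] is singled out since [delta alpha 0 0] is junk. *)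
Definition mixed_moment i j : R :=
  if (i + j == 0)%N then 1
  else \int[Q]_w expR (- delta alpha (i + j)%:R j%:R * Lambda w).

Let transform r s : 0 < r -> 0 <= s ->
  (\int[P]_w (expR (- (r * U w + s * V w)))%:E =
   \int[Q]_w (expR (- delta alpha r s * Lambda w))%:E)%E.
Proof.
move=> r0 s0; have := UV r0 s0; rewrite unlock => <-.
by apply: eq_integral => w _; rewrite /= opprD -!mulNr.
Qed.

Let transform_le1 r s : 0 < r -> 0 <= s ->
  (\int[Q]_w (expR (- delta alpha r s * Lambda w))%:E <= 1)%E.
Proof.
move=> r0 s0; have D0 := delta_ge0 alpha01 r0 s0.
have mI : measurable_fun setT (fun w => (expR (- delta alpha r s * Lambda w))%:E).
  apply/measurable_EFinP; apply: measurableT_comp => //.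
  exact: (measurable_funM (measurable_cst _)).
apply: (@le_trans _ _ (\int[Q]_w (cst 1%E w))%E); last first.
  by rewrite integral_cst//= mul1e probability_setT.
apply: ae_ge0_le_integral => //.
apply: filterS (ae_prob1 _ Lambda_gt0); last exact: (measurable_ltr_set (f := cst _)).
by move=> w /= Lw _; rewrite lee_fin expR_le1 mulNr oppr_le0 mulr_ge0// ltW.
Qed.

(** The [n]-th moments of exp(-U) and exp(-(U + V)) are the values of the transform at [(n, 0)] and
    [(n, n)], hence at most 1, and [ae_le1_moments] applies. *)
Lemma transform_exp_clip :
  {ae P, forall w, exp_clip (U w) = expR (- U w) /\
    exp_clip (U w + V w) = expR (- (U w + V w))}.
Proof.
have H (f : T -> R) : measurable_fun setT f ->
    (forall n, (0 < n)%N -> (\int[P]_w (expR (- (n%:R * f w)))%:E <= 1)%E) ->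
    {ae P, forall w, exp_clip (f w) = expR (- f w)}.
  move=> mf Hf; have := @ae_le1_moments _ _ _ P (fun w => expR (- f w)).
  have mef : measurable_fun setT (fun w => expR (- f w)).
    by apply: measurableT_comp => //; exact: measurableT_comp.
  move=> /(_ mef (fun _ => expR_ge0 _)) ae.
  have {ae}: {ae P, forall w, expR (- f w) <= 1}.
    apply: ae => n n0; have := Hf n n0; congr (_ <= _)%E; apply: eq_integral => w _.
    by rewrite -expRM_natl mulrN.
  by apply: filterS => w h; rewrite /exp_clip min_r.
have a1 : {ae P, forall w, exp_clip (U w) = expR (- U w)}.
  apply: H => // n n0; have nn : 0 < n%:R :> R by rewrite ltr0n.
  have := transform_le1 nn (lexx 0); rewrite -(transform nn (lexx 0)); congr (_ <= _)%E; apply: eq_integral => w _.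
  by rewrite mul0r addr0.
have a2 : {ae P, forall w, exp_clip (U w + V w) = expR (- (U w + V w))}.
  apply: H => [|n n0]; first exact: measurable_funD.
  have nn : 0 < n%:R :> R by rewrite ltr0n.
  have := transform_le1 nn (ltW nn); rewrite -(transform nn (ltW nn)); congr (_ <= _)%E; apply: eq_integral => w _.
  by rewrite mulrDr.
by apply: filterS2 a1 a2 => w.
Qed.

Lemma transform_moments i j :
  \int[P]_w (exp_clip (U w) ^+ i * exp_clip (U w + V w) ^+ j) = mixed_moment i j.
Proof.
rewrite /mixed_moment; case: ifPn => [|ij].
  rewrite addn_eq0 => /andP[/eqP-> /eqP->].
  rewrite /Rintegral; under eq_integral do rewrite !expr0 mulr1.
  by rewrite integral_cst//= mul1e probability_setT.
have ij0 : 0 < (i + j)%:R :> R by rewrite ltr0n lt0n.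
rewrite /Rintegral -transform//; congr fine; apply: ae_eq_integral => //.
- apply/measurable_EFinP; apply: measurable_funM.
    by apply: measurable_funX; exact: measurable_exp_clip.
  by apply: measurable_funX; apply: measurable_exp_clip; exact: measurable_funD.
- apply/measurable_EFinP; apply: measurableT_comp => //; apply: measurableT_comp => //.
  exact: (measurable_funD (measurable_funM (measurable_cst _) (@measurable_funPT _ _ _ _ U))
    (measurable_funM (measurable_cst _) (@measurable_funPT _ _ _ _ V))).
- apply: filterS transform_exp_clip => w [-> ->] _; congr EFin.
  by rewrite -!expRM_natl -expRD natrD; congr expR; ring.
Qed.

End transform.

(** The transform fixes all the moments of the clipped exponentials, hence their joint law;
    logarithms recover [(U, V)] from them almost surely. *)
Lemma transform_unique {R : realType} {d d1 d2 : measure_display} {T : measurableType d}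
    {T1 : measurableType d1} {T2 : measurableType d2} (Q : probability T R)
    (Lambda : {RV Q >-> R}) (alpha : R) (P1 : probability T1 R) (P2 : probability T2 R)
    (U1 V1 : {RV P1 >-> R}) (U2 V2 : {RV P2 >-> R}) (B : set (R * R)) :
  0 < alpha < 1 -> Q [set w | 0 < Lambda w] = 1%E ->
  has_UV_transform alpha Lambda U1 V1 -> has_UV_transform alpha Lambda U2 V2 ->
  measurable B -> pushforward P2 (fun w => (U2 w, V2 w)) B = pushforward P1 (fun w => (U1 w, V1 w)) B.
Proof.
move=> alpha01 L0 H1 H2 mB.
pose back (p : R * R) : R * R := (- ln p.1, ln p.1 - ln p.2).
have mback : measurable_fun setT back.
  have ml1 : measurable_fun setT (fun p : R * R => ln p.1) by exact: (measurableT_comp (@measurable_ln R)).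
  have ml2 : measurable_fun setT (fun p : R * R => ln p.2) by exact: (measurableT_comp (@measurable_ln R)).
  by apply: measurable_fun_pair; [exact: measurableT_comp|exact: measurable_funB].
have mC : measurable (back @^-1` B) by rewrite -[X in measurable X]setTI; exact: mback.
have E d0 (T0 : measurableType d0) (P : probability T0 R) (U V : {RV P >-> R}) :
    has_UV_transform alpha Lambda U V ->
    pushforward P (fun w => (U w, V w)) B =
    P [set w | (back @^-1` B) (exp_clip (U w), exp_clip (U w + V w))].
  move=> H; have mU : measurable_fun setT (fun w => exp_clip (U w)) by exact: measurable_exp_clip.
  have mV : measurable_fun setT (fun w => exp_clip (U w + V w)).
    by apply: measurable_exp_clip; exact: measurable_funD.
  have mUV : measurable_fun setT (fun w => (U w, V w)) by exact: measurable_fun_pair.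
  have mE : measurable_fun setT (fun w => (exp_clip (U w), exp_clip (U w + V w))).
    exact: measurable_fun_pair.
  have mA : measurable ((fun w => (U w, V w)) @^-1` B).
    by rewrite -[X in measurable X]setTI; exact: mUV.
  have mA' : measurable [set w | (back @^-1` B) (exp_clip (U w), exp_clip (U w + V w))].
    by rewrite -[X in measurable X]setTI; exact: mE.
  rewrite /pushforward -[X in P X]setIT -[in RHS](setIT [set w | _]) -!integral_indic//.
  apply: ae_eq_integral => //; [exact/measurable_EFinP/measurable_indic| |].
    exact/measurable_EFinP/measurable_indic.
  apply: filterS (transform_exp_clip alpha01 L0 H) => w [hU hV] _.
  congr EFin; rewrite !indicE; congr ((nat_of_bool _)%:R); apply/idP/idP; rewrite !inE /= hU hV /back /= !expRK;
    by rewrite !opprK addrA addNr add0r.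
rewrite (E _ _ _ _ _ H1) (E _ _ _ _ _ H2).
apply: eq_joint_distribution_moments => //; try by move=> t; exact: exp_clip01.
- exact: measurable_exp_clip.
- by apply: measurable_exp_clip; exact: measurable_funD.
- exact: measurable_exp_clip.
- by apply: measurable_exp_clip; exact: measurable_funD.
- by move=> i j; rewrite (transform_moments alpha01 L0 H1) (transform_moments alpha01 L0 H2).
Qed.

(** * Convergence of the statistics *)

Lemma pushforward_ray {d} {T : measurableType d} {R : realType} (P : probability T R)
    (Y : T -> R) x : pushforward P Y `]-oo, x] = P [set w | Y w <= x].
Proof. by rewrite /pushforward; congr (P _); apply/seteqP; split => w; rewrite /= in_itv. Qed.

(** The complement of [x < Y] turns the second bound into a lower bound for the cdf, and continuity
    at [x] absorbs both the slack [eta] and the possible atom. *)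
Lemma cvg_cdf_bounds {d d'} {T : measurableType d} {T' : measurableType d'} {R : realType}
    (P : probability T R) (P1 : probability T' R) (Y : nat -> T -> R) (W : T' -> R) :
  (forall n, measurable_fun setT (Y n)) -> measurable_fun setT W -> (forall w, 0 < W w) ->
  (forall x eta e : R, 0 <= x -> 0 < eta -> 0 < e -> \forall n \near \oo,
    (P [set w | (Y n w <= x)%R] <= P1 [set w | (W w <= x + eta)%R] + e%:E)%E) ->
  (forall x e : R, 0 < x -> 0 < e -> \forall n \near \oo,
    (P [set w | (x < Y n w)%R] <= P1 [set w | (x <= W w)%R] + e%:E)%E) ->
  (forall n x, x < 0 -> P [set w | Y n w <= x] = 0%E) ->
  forall x : R, {for x, continuous (fun y : R => pushforward P1 W `]-oo, y])} ->
  pushforward P (Y n) `]-oo, x] @[n --> \oo] --> pushforward P1 W `]-oo, x].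
Proof.
move=> mY mW W0 up low neg x; rewrite pushforward_ray => cx.
under eq_fun do rewrite pushforward_ray.
have mle y : measurable [set w | W w <= y] by exact: (measurable_ler_set (g := cst _)).
have mlt y : measurable [set w | W w < y] by exact: (measurable_ltr_set (g := cst _)).
have mYle n y : measurable [set w | Y n w <= y] by exact: (measurable_ler_set (g := cst _)).
have F0 y : y <= 0 -> P1 [set w | W w <= y] = 0%E.
  move=> y0; rewrite (_ : [set w | _] = set0) ?measure0//; apply/seteqP; split => w //=.
  by move/le_trans => /(_ _ y0); rewrite leNgt W0.
have [x0|x0] := ltP x 0.
  rewrite F0 ?(ltW x0)//; under eq_fun do rewrite neg//; exact: cvg_cst.
pose F y := fine (P1 [set w | W w <= y]).
have FE y : P1 [set w | W w <= y] = (F y)%:E by rewrite fineK// fin_num_measure.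
have F_le y z : y <= z -> F y <= F z.
  move=> yz; rewrite -lee_fin -!FE; apply: le_measure; rewrite ?inE//.
  by move=> w /= /le_trans; apply.
have cF e : 0 < e -> exists2 eta, 0 < eta & F (x + eta) <= F x + e /\ F x - e <= F (x - eta).
  move=> e0; have cF : F y @[y --> x] --> F x.
    apply: fine_cvg; rewrite -FE.
    have : (fun y : R => pushforward P1 W `]-oo, y]) @ x --> pushforward P1 W `]-oo, x] by exact: cx.
    rewrite pushforward_ray => H; apply: cvg_trans H; apply: near_eq_cvg; apply: nearW => y.
    by rewrite pushforward_ray.
  move/cvgrPdist_le : cF => /(_ e e0) [r /= r0 Hr]; exists (r / 2); first by rewrite divr_gt0.
  have r2 : r / 2 < r by rewrite ltr_pdivrMr// mulr2n mulrDr mulr1 ltrDl.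
  have := Hr (x + r / 2); have := Hr (x - r / 2).
  rewrite /ball_ /= opprB addrC subrK opprD addNKr normrN ger0_norm ?divr_ge0 ?(ltW r0)//.
  by move=> /(_ r2) + /(_ r2); rewrite !ler_norml; lra.
have pE n y : P [set w | Y n w <= y] = (fine (P [set w | Y n w <= y]))%:E.
  by rewrite fineK// fin_num_measure.
rewrite FE; under eq_fun do rewrite pE.
apply: cvg_EFin; first exact: nearW.
apply/cvgrPdist_le => e e0; have e2 : 0 < e / 2 by rewrite divr_gt0.
have [eta eta0 [eta1 eta2]] := cF _ e2.
have L : \forall n \near \oo, F x - e <= fine (P [set w | Y n w <= x]).
  have [xp|x00] := ltP 0 x; last first.
    apply: nearW => n; have -> : F x = 0 by rewrite /F F0.
    by rewrite sub0r (@le_trans _ _ 0) ?oppr_le0 ?(ltW e0)// fine_ge0.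
  apply: filterS (low x _ xp e2) => n.
  have -> : [set w | x < Y n w] = ~` [set w | Y n w <= x].
    by apply/seteqP; split => w /=; [rewrite ltNge => /negP|move/negP; rewrite -ltNge].
  have -> : [set w | x <= W w] = ~` [set w | W w < x].
    by apply/seteqP; split => w /=; [rewrite leNgt => /negP|move/negP; rewrite -leNgt].
  rewrite !probability_setC// pE -[P1 _]fineK ?fin_num_measure// -!EFinB -EFinD lee_fin.
  have : F (x - eta) <= fine (P1 [set w | W w < x]).
    rewrite fine_le ?fin_num_measure//; apply: le_measure; rewrite ?inE//.
    by move=> w /= /le_lt_trans; apply; rewrite ltrBlDr ltrDl.
  lra.
near=> n.
have h1 : F x - e <= fine (P [set w | Y n w <= x]) by near: n.
have h2 : (P [set w | (Y n w <= x)%R] <= P1 [set w | (W w <= x + eta)%R] + (e / 2)%:E)%E.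
  by near: n; exact: up.
rewrite pE FE -EFinD lee_fin in h2.
by rewrite /= ler_norml; lra.
Unshelve. all: by end_near. Qed.
Lemma prob_le_ae {d} {T : measurableType d} {R : realType} (P : probability T R) (A B : set T) :
  measurable A -> measurable B -> {ae P, forall w, A w -> B w} -> (P A <= P B)%E.
Proof.
move=> mA mB AB; rewrite -[A]setIT -[B]setIT -!integral_indic//.
apply: ae_ge0_le_integral => //.
- by apply/measurable_EFinP; exact: measurable_indic.
- by apply/measurable_EFinP; exact: measurable_indic.
- apply: filterS AB => w ABw _; rewrite lee_fin !indicE ler_nat.
  by have [/set_mem/ABw/mem_set->//|] := boolP (w \in A).
Qed.

(** Mean value theorem, with [y = 0] apart because the derivative formula holds for positive
    arguments. It serves for the exponent [1 + x^-1] of the curve bounding the event on [C]. *)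
Lemma powR_lipschitz {R : realType} (k x y : R) : 1 <= k -> 0 <= x <= 1 -> 0 <= y <= 1 ->
  `|x `^ k - y `^ k| <= k * `|x - y|.
Proof.
move=> k1; have k0 : 0 < k by exact: lt_le_trans k1.
wlog: x y / y <= x.
  move=> H x01 y01; have [yx|/ltW xy] := leP y x; first exact: H.
  by rewrite distrC [X in k * X]distrC; exact: H.
move=> yx /andP[x0 x1] /andP[y0 y1].
have := @ge0_ler_powR R k (ltW k0) y x; rewrite !nnegrE => /(_ y0 x0 yx) pyx.
rewrite !ger0_norm ?subr_ge0//.
have [/eqP y00|yn0] := boolP (y == 0).
  rewrite y00 powR0 ?gt_eqF// !subr0.
  have [/eqP ->|xn0] := boolP (x == 0); first by rewrite powR0 ?gt_eqF// mulr0.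
  have xp : 0 < x by rewrite lt_def xn0.
  apply: (@le_trans _ _ x); last by rewrite ler_peMl.
  have := @ger_powR _ x _ _ _ k1; rewrite powRr1//; apply; by rewrite xp.
have yp : 0 < y by rewrite lt_def yn0.
have [xy|xy] := eqVneq x y; first by rewrite xy !subrr mulr0.
have yx' : y < x by rewrite lt_def xy.
have dp (z : R) : 0 < z -> is_derive z (1 : R) (fun z => z `^ k) (k * z `^ (k - 1)).
  by move=> z0; exact: is_derive1_powR.
have [||c] := @MVT R (fun z => z `^ k) (fun z => k * z `^ (k - 1)) y x yx'.
- by move=> z; rewrite in_itv/= => /andP[yz _]; apply: dp; exact: lt_trans yz.
- apply: continuous_in_subspaceT => z; rewrite inE/= in_itv/= => /andP[yz _].
  exact: is_derive_continuous (dp z (lt_le_trans yp yz)).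
rewrite in_itv/= => /andP[yc cx] ->; rewrite ler_wpM2r ?subr_ge0//.
rewrite -[leRHS]mulr1 ler_wpM2l ?(ltW k0)//.
have c0 : 0 < c by exact: lt_trans yc.
have := @ge0_ler_powR R (k - 1) _ c 1; rewrite subr_ge0 !nnegrE powR1; apply => //; first exact: ltW.
exact: le_trans (ltW cx) x1.
Qed.

Lemma measurable_funV {d} {T : measurableType d} {R : realType} (f : T -> R) :
  measurable_fun setT f -> measurable_fun setT (fun x => (f x)^-1).
Proof.
move=> mf; suff mV : measurable_fun setT (fun x : R => x^-1) by exact: (measurableT_comp mV mf).
(* Powers give the inverse after reflection of negative arguments; at 0 both sides take the default
   value 0. *)
have -> : (fun x : R => x^-1) = fun x => if 0 <= x then x `^ (-1) else - (- x) `^ (-1).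
  apply/funext => x; case: (leP 0 x) => x0; first by rewrite powR_inv1.
  by rewrite powR_inv1 ?oppr_ge0 ?(ltW x0)// invrN opprK.
apply: measurable_fun_ifT; first exact: measurable_fun_ler.
  exact: measurable_powR.
by apply: measurableT_comp => //; apply: (measurableT_comp (measurable_powR _)).
Qed.

(** * The random sample along a sequence of times *)

Section random_sample.
Context {R : realType} {d d' : measure_display} {T : measurableType d} {T' : measurableType d'}
  (P : probability T R) (X : {RV P >-> R}) (Xs : nat -> {RV P >-> R})
  (N : R -> {RV P >-> nat}) (Q : probability T' R) (Lambda : {RV Q >-> R})
  (alpha : R) (ell : R -> R).
Hypothesis alpha01 : 0 < alpha < 1.
Hypothesis X_pos : P [set w | 0 < X w] = 1%E.
Hypothesis Xs_iid : iid_copies X Xs.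
Hypothesis N_indep : process_independent N Xs.
Hypothesis X_pareto : pareto_type X alpha ell.
Hypothesis N_average : D_averages_in_time N Lambda.
Variables t b : nat -> R.
Hypothesis t0 : forall n, 0 < t n.
Hypothesis b0 : forall n, 0 < b n.
Hypothesis t_infty : t n @[n --> \oo] --> +oo.
Hypothesis b_infty : b n @[n --> \oo] --> +oo.
Hypothesis t_tail : t n * tail X (b n) @[n --> \oo] --> (1 : R).

Let N_measurable s : measurable_fun setT (N s).
Proof. exact: measurable_funPT. Qed.

Lemma measurable_index s : measurable_fun setT (fun w => (N s w)%:R : R).
Proof.
by apply: (measurable_random_index (f := fun n _ => n%:R : R)) => //; exact: N_measurable.
Qed.

Lemma cvg_laplace_index (c : nat -> R) (D : R) : (forall n, 0 < c n) -> 0 < D ->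
  c n * t n @[n --> \oo] --> D ->
  \int[P]_w expR (- (c n * (N (t n) w)%:R)) @[n --> \oo] --> \int[Q]_w expR (- (D * Lambda w)).
Proof.
move=> c0 D0 ct; have [N_cvg L0] := N_average.
have := @laplace_cvg_in_distribution R _ _ _ _ P Q (fun s w => (N s w)%:R / s) Lambda t c D.
have mY x : measurable_fun setT (fun w => (N x w)%:R / x : R).
  by apply: measurable_funM; [exact: measurable_index|exact: measurable_cst].
have Y0 x w : 0 < x -> 0 <= (N x w)%:R / x :> R by move=> x0; rewrite divr_ge0// ltW.
move=> /(_ mY Y0 N_cvg L0 t0 t_infty c0 D0 ct).
apply: cvg_trans; apply: near_eq_cvg; apply: nearW => n; apply: eq_Rintegral => w _.
by rewrite [X in c n * X]mulrC divfK// gt_eqF.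
Qed.

Definition mark_product r s n w : R :=
  \prod_(i < N (t n) w) mark r s (b n) (Xs i w).

Lemma measurable_mark_product r s n : measurable_fun setT (mark_product r s n).
Proof. exact: measurable_random_product. Qed.

Lemma mark_product01 r s n w : 0 <= r -> 0 <= s -> 0 <= mark_product r s n w <= 1.
Proof.
move=> r0 s0; apply/andP; split.
  by apply: prodr_ge0 => i _; have /andP[] := mark_ge0_le1 (Xs i w) r0 s0 (b0 n).
by apply: prodr_ile1 => i _; exact: mark_ge0_le1.
Qed.

(** The mean of phi^N is that of exp(-c N) with c = - ln phi, and c t has the same limit as t (1 -
    phi); convergence in distribution of N / t then gives the limit. *)
Lemma cvg_integral_mark_product r s : 0 < r -> 0 <= s ->
  \int[P]_w mark_product r s n w @[n --> \oo] -->
  \int[Q]_w expR (- (delta alpha r s * Lambda w)).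
Proof.
move=> r0 s0; have D0 := delta_gt0 alpha01 r0 s0.
have [sv tail_ell] := X_pareto.
have H := mark_transform_cvg alpha01 r0 s0 sv tail_ell b_infty t_tail.
pose phi n := \int[P]_w mark r s (b n) (X w).
move: D0 H; set D := delta alpha r s => D0; rewrite -/phi => H.
have tV : (t n)^-1 @[n --> \oo] --> (0 : R).
  by apply/gtr0_cvgV0 => //; exact: nearW.
have phi1 : phi n @[n --> \oo] --> (1 : R).
  have -> : phi = (fun n => 1 - (t n * (1 - phi n)) * (t n)^-1).
    by apply/funext => n; field; rewrite gt_eqF.
  rewrite -[X in _ --> X](subr0 1); apply: cvgB; first exact: cvg_cst.
  by rewrite -(mulr0 D); exact: cvgM.
have near01 : \forall n \near \oo, 2^-1 < phi n < 1.
  near=> n; apply/andP; split.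
    by near: n; apply: (cvgr_gt _ phi1); rewrite invf_lt1// ltr1n.
  have : 0 < t n * (1 - phi n) by near: n; exact: (cvgr_gt _ H).
  by rewrite pmulr_rgt0// subr_gt0.
(* The default 1 makes [c] positive at every index; the first branch is taken eventually. *)
pose c n := if 2^-1 < phi n < 1 then - ln (phi n) else 1.
have c0 n : 0 < c n.
  rewrite /c; case: ifPn => // /andP[p0 p1]; rewrite oppr_gt0 ln_lt0// p1 andbT.
  by apply: lt_trans p0; rewrite invr_gt0.
have ct : c n * t n @[n --> \oo] --> D.
  have H' : t n * (1 - phi n) / phi n @[n --> \oo] --> D.
    by rewrite -[X in _ --> X]divr1; apply: cvgM => //; apply: cvgV => //; exact: oner_neq0.
  (* The enclosure is 1 - p <= - ln p <= (1 - p) / p. *)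
  apply: (squeeze_cvgr _ H H'); near=> n; have p01 : 2^-1 < phi n < 1 by near: n.
  rewrite /c p01; have /andP[p0 p1] := p01.
  have pp : 0 < phi n by apply: lt_trans p0; rewrite invr_gt0.
  apply/andP; split.
    rewrite mulrC ler_wpM2r ?(ltW (t0 n))//.
    have := @le_ln1Dx R (phi n - 1); rewrite addrCA subrr addr0 => h.
    by rewrite lerNr opprB h// ltrBrDr addNr.
  rewrite -mulrA [leRHS]mulrC ler_wpM2r ?(ltW (t0 n))// -lnV ?posrE//.
  have := @le_ln1Dx R ((phi n)^-1 - 1); rewrite addrCA subrr addr0 => h.
  have -> : (1 - phi n) / phi n = (phi n)^-1 - 1 by field; rewrite gt_eqF.
  by rewrite h// ltrBrDr addNr invr_gt0.
have := cvg_laplace_index c0 D0 ct; apply: cvg_trans; apply: near_eq_cvg.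
near=> n; have p01 : 2^-1 < phi n < 1 by near: n.
rewrite /Rintegral; congr fine.
rewrite (integral_random_product Xs_iid N_indep r0 s0 (b0 n) (ltW (t0 n))).
apply: eq_integral => w _; rewrite /c p01 mulNr opprK mulrC expRM_natl lnK// posrE.
by have /andP[+ _] := p01; apply: lt_trans; rewrite invr_gt0.
Unshelve. all: by end_near. Qed.

Lemma mark_product_monomial i j n w : (0 < i + j)%N ->
  mark_product 1 0 n w ^+ i * mark_product 1 1 n w ^+ j =
  mark_product (i + j)%:R j%:R n w.
Proof.
move=> ij; rewrite /mark_product -!prodrXl -big_split /=; apply: eq_bigr => k _.
by rewrite /mark -!expRM_natl -expRD natrD; congr expR; ring.
Qed.

Lemma cvg_mark_product_moments i j :
  \int[P]_w (mark_product 1 0 n w ^+ i * mark_product 1 1 n w ^+ j) @[n --> \oo] -->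
  mixed_moment Lambda alpha i j.
Proof.
rewrite /mixed_moment; case: ifPn => [|ij].
  rewrite addn_eq0 => /andP[/eqP-> /eqP->].
  rewrite [X in X @ _ --> _](_ : _ = cst 1); first exact: cvg_cst.
  apply/funext => n; rewrite /Rintegral; under eq_integral do rewrite !expr0 mulr1.
  by rewrite integral_cst//= mul1e probability_setT.
rewrite -lt0n in ij.
have := @cvg_integral_mark_product (i + j)%:R j%:R; rewrite ltr0n ij => /(_ isT (ler0n _ _)).
under eq_Rintegral do rewrite -mulNr.
apply: cvg_trans; apply: near_eq_cvg; apply: nearW => n; apply: eq_Rintegral => w _.
by rewrite mark_product_monomial.
Qed.

Lemma ae_sample_gt0 : {ae P, forall w, forall i, 0 < Xs i w}.
Proof.
apply: ae_foralln => i; apply: ae_prob1; first exact: (measurable_ltr_set (f := cst _)).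
have [_ Xs_dist] := Xs_iid; have := Xs_dist i `]0, +oo[%classic (measurable_itv _).
rewrite /distribution /pushforward.
have E (Z : T -> R) : Z @^-1` `]0, +oo[ = [set w | 0 < Z w].
  by apply/seteqP; split => w; rewrite /= in_itv/= andbT.
by rewrite !E X_pos.
Qed.

Let S1 n w : R := (\sum_(i < N (t n) w) Xs i w) / b n.

Let S2 n w : R := (\sum_(i < N (t n) w) Xs i w ^+ 2) / b n ^+ 2.

Lemma mark_productE n w : (forall i, 0 < Xs i w) ->
  mark_product 1 0 n w = expR (- S2 n w) /\
  mark_product 1 1 n w = expR (- (S2 n w + S1 n w)).
Proof.
move=> Xs0; rewrite /mark_product /S1 /S2 !big_distrl/= -big_split/= -!sumrN !expR_sum.
by split; apply: eq_bigr => i _; rewrite /mark max_r ?(ltW (Xs0 i))// expr_div_n; congr expR; ring.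
Qed.

Lemma measurable_sum_sample (f : R -> R) s : measurable_fun setT f ->
  measurable_fun setT (fun w => \sum_(i < N s w) f (Xs i w)).
Proof.
move=> mf; apply: (measurable_random_index (f := fun n w => \sum_(i < n) f (Xs i w))); first exact: N_measurable.
move=> n.
by apply: measurable_sum => i; exact: measurableT_comp.
Qed.

Let measurable_S1 n : measurable_fun setT (S1 n).
Proof. by apply: measurable_funM => //; exact: (measurable_sum_sample _ (@measurable_id _ _ setT)). Qed.

Lemma measurable_C_stat s : measurable_fun setT (C_stat Xs N s).
Proof.
apply: (measurable_random_index (f := fun n w => if (1 <= n)%N then
  (\sum_(i < n) Xs i w ^+ 2) / (\sum_(i < n) Xs i w) else 0)); first exact: N_measurable.
move=> n /=.
case: (0 < n)%N; last exact: measurable_cst.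
have m1 : measurable_fun setT (fun w => \sum_(i < n) Xs i w) by exact: measurable_sum.
have m2 : measurable_fun setT (fun w => \sum_(i < n) Xs i w ^+ 2).
  by apply: measurable_sum => i; exact: measurable_funX.
by apply: measurable_funM => //; exact: measurable_funV.
Qed.

Lemma measurable_sample_dispersion s : measurable_fun setT (sample_dispersion Xs N s).
Proof.
apply: (measurable_random_index (f := fun n w => if (1 <= n)%N then
  sample_variance Xs n w / sample_mean Xs n w else 0)); first exact: N_measurable.
move=> n /=.
case: (0 < n)%N; last exact: measurable_cst.
have m1 : measurable_fun setT (sample_mean Xs n).
  by apply: measurable_funM => //; exact: measurable_sum.
apply: measurable_funM; last exact: measurable_funV.
apply: measurable_funM => //; apply: measurable_sum => i; apply: measurable_funX.
exact: measurable_funB.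
Qed.

(** The division by a positive sum is cleared. For [N = 0] everything vanishes and both inequalities
    hold, since [x >= 0]. *)
Lemma C_stat_le n w x : (forall i, 0 < Xs i w) -> 0 <= x ->
  ((b n)^-1 * C_stat Xs N (t n) w <= x) = (S2 n w <= x * S1 n w).
Proof.
move=> Xs0 x0; rewrite /C_stat /S1 /S2; case: ifPn => [N1|]; last first.
  by rewrite -ltnNge ltnS leqn0 => /eqP->; rewrite !big_ord0 !mul0r !mulr0 lexx x0.
have S0 : 0 < \sum_(i < N (t n) w) Xs i w.
  by rewrite (bigD1 (Ordinal N1))//= ltr_wpDr// sumr_ge0// => i _; exact: ltW.
rewrite mulrA ler_pdivrMr// -(ler_pM2r (x := (b n)^-1)) ?invr_gt0//.
by congr (_ <= _); rewrite ?expr2 ?invfM; ring.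
Qed.

(** Expansion of the squares. For [N = 0] the empty sum makes the mean 0, so the identity
    persists. *)
Lemma sample_dispersionE n w : (forall i, 0 < Xs i w) ->
  sample_dispersion Xs N n w = C_stat Xs N n w - sample_mean Xs (N n w) w /\
  0 <= sample_dispersion Xs N n w.
Proof.
move=> Xs0; rewrite /sample_dispersion /C_stat; case: ifPn => [N1|]; last first.
  by rewrite -ltnNge ltnS leqn0 => /eqP->; rewrite /sample_mean big_ord0 mulr0 subrr.
have S0 : 0 < \sum_(i < N n w) Xs i w.
  by rewrite (bigD1 (Ordinal N1))//= ltr_wpDr// sumr_ge0// => i _; exact: ltW.
set k := N n w in N1 S0 *; have k0 : 0 < k%:R :> R by rewrite ltr0n.
split; last first.
  rewrite divr_ge0// mulr_ge0 ?invr_ge0 ?(ltW k0) ?(ltW S0)//.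
  by rewrite sumr_ge0// => i _; exact: sqr_ge0.
rewrite /sample_variance; set m := sample_mean _ _ _.
have -> : \sum_(i < k) (Xs i w - m) ^+ 2 =
    \sum_(i < k) Xs i w ^+ 2 - 2 * m * (\sum_(i < k) Xs i w) + k%:R * m ^+ 2.
  have -> : k%:R * m ^+ 2 = \sum_(i < k) m ^+ 2 by rewrite sumr_const card_ord mulr_natl.
  rewrite mulr_sumr -sumrB -big_split/=.
  by apply: eq_bigr => i _; ring.
rewrite /m /sample_mean -/k; field.
by rewrite !gt_eqF.
Qed.

(** Exponential Markov inequality: on [N <= K] one has exp(-D N / t) >= 1 - K D / t >= 1/2, so the
    probability is at most twice a transform tending to that of [Lambda] at [D], which is small for
    large [D] because [Lambda] is positive almost surely. *)
Lemma index_prob_le K e : 0 < e ->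
  \forall n \near \oo, (P [set w | (N (t n) w <= K)%N] <= e%:E)%E.
Proof.
move=> e0; have [_ L0] := N_average.
have mL D : measurable_fun setT (fun w => expR (- (D * Lambda w))).
  apply: measurableT_comp => //; apply: measurableT_comp => //.
  exact: (measurable_funM (measurable_cst D) (@measurable_funPT _ _ _ _ Lambda)).
pose L w := if 0 < Lambda w then Lambda w else 1.
have L_gt0 w : 0 < L w by rewrite /L; case: ifPn.
have lim0 : (\int[Q]_w (expR (- (n.+1%:R * L w)))%:E)%E @[n --> \oo] --> (\int[Q]_w (cst 0 w))%E.
  have mLn n : measurable_fun setT (fun w => (expR (- (n.+1%:R * L w)))%:E).
    apply/measurable_EFinP; apply: measurableT_comp => //; apply: measurableT_comp => //.
    apply: measurable_funM => //; apply: measurable_fun_ifT => //.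
    by apply: measurable_fun_ltr => //; exact: measurable_funPT.
  apply: (dominated_cvg (g := cst 1%E) measurableT mLn) => //.
  - move=> w _; apply: cvg_EFin; first exact: nearW.
    have LN : n.+1%:R * L w @[n --> \oo] --> +oo.
      apply/cvgryPge => A; near=> n.
      rewrite -ler_pdivrMr//; apply: (@le_trans _ _ n%:R); last by rewrite ler_nat.
      by near: n; exact: nbhs_infty_ger.
    apply: (@cvg_comp _ _ _ (fun n => n.+1%:R * L w) (fun x => expR (- x)) _ (pinfty_nbhs R)) => //.
    exact: cvgr_expR.
  - exact: finite_measure_integrable_cst.
  - by move=> n w _ /=; rewrite lee_fin ger0_norm ?expR_ge0// expR_le1 oppr_le0 mulr_ge0// ltW.
rewrite integral0 in lim0.
have e8 : 0 < e / 8 by rewrite divr_gt0.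
move/fine_cvgP : lim0 => [_ /cvgrPdist_le /(_ _ e8) [m _ /(_ m (leqnn m))]] /=.
rewrite sub0r normrN => Hm; set D : R := m.+1%:R in Hm.
have D0 : 0 < D by rewrite ltr0n.
have EL : \int[Q]_w expR (- (D * Lambda w)) <= e / 8.
  apply: le_trans Hm; rewrite ger0_norm; last first.
    by apply: fine_ge0; apply: integral_ge0 => w _; rewrite lee_fin expR_ge0.
  rewrite le_eqVlt; apply/orP; left; apply/eqP; rewrite /Rintegral; congr fine.
  apply: ae_eq_integral => //.
  - by apply/measurable_EFinP; exact: mL.
  - apply/measurable_EFinP; apply: measurableT_comp => //; apply: measurableT_comp => //.
    apply: measurable_funM => //; apply: measurable_fun_ifT => //.
    by apply: measurable_fun_ltr => //; exact: measurable_funPT.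
  - apply: filterS (ae_prob1 _ L0); last exact: (measurable_ltr_set (f := cst _)).
    by move=> w /= Lw _; rewrite /L Lw.
have c0 n : 0 < D / t n by rewrite divr_gt0.
have ct : D / t n * t n @[n --> \oo] --> D.
  by under eq_fun do rewrite divfK ?gt_eqF//; exact: cvg_cst.
have tV : (t n)^-1 @[n --> \oo] --> (0 : R) by apply/gtr0_cvgV0 => //; exact: nearW.
have cv := cvg_laplace_index c0 D0 ct.
have cK : K%:R * (D / t n) @[n --> \oo] --> (0 : R).
  by rewrite -[X in _ --> X](mulr0 (K%:R * D)); under eq_fun do rewrite mulrA; apply: cvgM => //; exact: cvg_cst.
near=> n.
have h1 : \int[P]_w expR (- (D / t n * (N (t n) w)%:R)) <= e / 4.
  apply: ltW; near: n; apply: (cvgr_lt _ cv); apply: (le_lt_trans EL).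
  by rewrite ltr_pM2l// ltf_pV2 ?posrE// ltr_nat.
have h2 : K%:R * (D / t n) <= 2^-1 by near: n; apply: (cvgr_le _ cK); rewrite invr_gt0.
have mA : measurable [set w | (N (t n) w <= K)%N].
  rewrite -[X in measurable X]setTI.
  exact: (@N_measurable (t n) measurableT [set k | (k <= K)%N]).
have mI : measurable_fun setT (fun w => expR (- (D / t n * (N (t n) w)%:R))).
  apply: measurableT_comp => //; apply: measurableT_comp => //.
  by apply: measurable_funM => //; exact: measurable_index.
have iI : P.-integrable setT (EFin \o (fun w => expR (- (D / t n * (N (t n) w)%:R)))).
  apply: (@bounded_integrable _ _ _ _ _ 1) => // w.
  by rewrite ger0_norm ?expR_ge0// expR_le1 oppr_le0 mulr_ge0// ltW.
rewrite -[X in P X]setIT -integral_indic//.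
apply: (@le_trans _ _ (\int[P]_w (2 * expR (- (D / t n * (N (t n) w)%:R)))%:E)%E).
  apply: ge0_le_integral => //.
  - by apply/measurable_EFinP; exact: measurable_indic.
  - by apply/measurable_EFinP; exact: measurable_funM.
  - move=> w _; rewrite lee_fin indicE; have [/set_mem /= NK|_] := boolP (w \in _); last first.
      by rewrite mulr_ge0 ?expR_ge0.
    have : D / t n * (N (t n) w)%:R <= 2^-1.
      by apply: le_trans h2; rewrite mulrC ler_wpM2r ?(ltW (c0 n))// ler_nat.
    have := expR_ge1Dx (- (D / t n * (N (t n) w)%:R)); rewrite /=; lra.
under eq_integral do rewrite EFinM.
rewrite integralZl// -[X in (_ * X)%E]fineK ?integrable_fin_num// -EFinM lee_fin.
by move: h1; rewrite /Rintegral /=; lra.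
Unshelve. all: by end_near. Qed.

Section limit.
Variables (d1 : measure_display) (T1 : measurableType d1) (P1 : probability T1 R).
Variables U V : {RV P1 >-> R}.
Hypothesis UV : has_UV_transform alpha Lambda U V.
Hypothesis U0 : forall w, 0 < U w.
Hypothesis V0 : forall w, 0 < V w.

Let W w := U w / V w.

Let measurable_W : measurable_fun setT W.
Proof. by apply: measurable_funM => //; exact: measurable_funV. Qed.

Let C n w := (b n)^-1 * C_stat Xs N (t n) w.

Let D n w := (b n)^-1 * sample_dispersion Xs N (t n) w.

Let measurable_C n : measurable_fun setT (C n).
Proof. exact: (measurable_funM (measurable_cst _) (measurable_C_stat (t n))). Qed.

Let measurable_D n : measurable_fun setT (D n).
Proof. exact: (measurable_funM (measurable_cst _) (measurable_sample_dispersion (t n))). Qed.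

Let mean_ge0 n w : (forall i, 0 < Xs i w) -> 0 <= sample_mean Xs n w.
Proof.
by move=> Xs0; rewrite mulr_ge0 ?invr_ge0// sumr_ge0// => i _; exact: ltW.
Qed.

Let D_ge0_le_C n w : (forall i, 0 < Xs i w) -> 0 <= D n w <= C n w.
Proof.
move=> Xs0; have [E D0] := sample_dispersionE (t n) Xs0.
have bV0 : 0 <= (b n)^-1 by rewrite invr_ge0 ltW.
rewrite mulr_ge0//= ler_wpM2l// E lerBlDr lerDl; exact: mean_ge0.
Qed.

(** Almost surely the sample is positive, so that the mark products are the exponentials of the
    normalized sums; on the limit side [U] and [V] are positive, so that clipping changes
    nothing. *)
Lemma limsup_sample_prob (G : R -> R -> R) (M e : R) (S : nat -> set T) :
  0 <= M -> 0 < e -> measurable_fun setT (fun p : R * R => G p.1 p.2) ->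
  (forall a b x y : R, 0 <= a <= 1 -> 0 <= b <= 1 -> 0 <= x <= 1 -> 0 <= y <= 1 ->
     `|G a b - G x y| <= M * (`|a - x| + `|b - y|)) ->
  (forall n, measurable (S n)) ->
  (forall n w, (forall i, 0 < Xs i w) -> S n w ->
     0 <= G (expR (- S2 n w)) (expR (- (S2 n w + S1 n w)))) ->
  \forall n \near \oo,
    (P (S n) <= P1 [set w | (0 <= G (expR (- U w)) (expR (- (U w + V w))))%R] + e%:E)%E.
Proof.
move=> M0 e0 mG GM mS SG; have [_ L0] := N_average.
have mGz n : measurable [set w | 0 <= G (mark_product 1 0 n w) (mark_product 1 1 n w)].
  apply: (measurable_ler_set (f := cst _)) => //.
  have mq : measurable_fun setT (fun w => (mark_product 1 0 n w, mark_product 1 1 n w)).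
    by apply: measurable_fun_pair; exact: measurable_mark_product.
  exact: (measurableT_comp mG mq).
have ec (x : R) : 0 < x -> exp_clip x = expR (- x).
  by move=> x0; rewrite /exp_clip min_r// expR_le1 oppr_le0 ltW.
have mU : measurable_fun setT (fun w => exp_clip (U w)) by exact: measurable_exp_clip.
have mV : measurable_fun setT (fun w => exp_clip (U w + V w)).
  by apply: measurable_exp_clip; exact: measurable_funD.
have := @limsup_prob_ge0 R _ _ T T1 P P1 (mark_product 1 0) (mark_product 1 1)
  (fun w => exp_clip (U w)) (fun w => exp_clip (U w + V w))
  (measurable_mark_product 1 0) (measurable_mark_product 1 1) mU mV
  (fun n w => mark_product01 n w ler01 (lexx 0)) (fun n w => mark_product01 n w ler01 ler01)
  (fun w => exp_clip01 _) (fun w => exp_clip01 _).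
have mom i j : \int[P]_w (mark_product 1 0 n w ^+ i * mark_product 1 1 n w ^+ j) @[n --> \oo] -->
    \int[P1]_w (exp_clip (U w) ^+ i * exp_clip (U w + V w) ^+ j).
  by rewrite (transform_moments alpha01 L0 UV); exact: cvg_mark_product_moments.
move=> /(_ mom G M e M0 e0 mG GM); apply: filterS => n H.
have -> : [set w | 0 <= G (expR (- U w)) (expR (- (U w + V w)))] =
    [set w | 0 <= G (exp_clip (U w)) (exp_clip (U w + V w))].
  by apply/seteqP; split => w /=; rewrite !ec// addr_gt0.
apply: le_trans H; apply: prob_le_ae => //.
by apply: filterS ae_sample_gt0 => w Xs0 Sw /=; have [-> ->] := mark_productE n Xs0; exact: SG.
Qed.

Let exp_ratio_le (A B x : R) : 0 < x ->
  (0 <= expR (- A) `^ (1 + x^-1) - expR (- (A + B))) = (A <= x * B).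
Proof.
move=> x0; rewrite subr_ge0 -expRM ler_expR mulrDr mulr1 opprD lerD2l mulNr lerN2.
by rewrite ler_pdivrMr// mulrC.
Qed.

Let exp_ratio_ge (A B x : R) : 0 < x ->
  (0 <= expR (- (A + B)) - expR (- A) `^ (1 + x^-1)) = (x * B <= A).
Proof.
move=> x0; rewrite subr_ge0 -expRM ler_expR mulrDr mulr1 opprD lerD2l mulNr lerN2.
by rewrite ler_pdivlMr// mulrC.
Qed.

Let ratio_lipschitz (x a b' y z : R) : 0 < x ->
  0 <= a <= 1 -> 0 <= y <= 1 ->
  `|(a `^ (1 + x^-1) - b') - (y `^ (1 + x^-1) - z)| <= (1 + x^-1) * (`|a - y| + `|b' - z|).
Proof.
move=> x0 a01 y01; have xV : 0 < x^-1 by rewrite invr_gt0.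
have k1 : 1 <= 1 + x^-1 by rewrite lerDl ltW.
have h1 := powR_lipschitz k1 a01 y01.
have h2 : `|b' - z| <= (1 + x^-1) * `|b' - z| by rewrite ler_peMl.
rewrite mulrDr; apply: le_trans (lerD h1 h2).
have -> : a `^ (1 + x^-1) - b' - (y `^ (1 + x^-1) - z) =
    (a `^ (1 + x^-1) - y `^ (1 + x^-1)) - (b' - z) by ring.
exact: ler_normB.
Qed.

Let measurable_ratio x : measurable_fun setT (fun p : R * R => p.1 `^ (1 + x^-1) - p.2).
Proof.
apply: measurable_funB => //.
exact: (measurableT_comp (measurable_powR _) measurable_fst).
Qed.

Let W_le x w : (W w <= x) = (U w <= x * V w). Proof. by rewrite ler_pdivrMr. Qed.

Let W_ge x w : (x <= W w) = (x * V w <= U w). Proof. by rewrite ler_pdivlMr. Qed.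

Let prob_C_le x e : 0 < x -> 0 < e -> \forall n \near \oo,
  (P [set w | (C n w <= x)%R] <= P1 [set w | (W w <= x)%R] + e%:E)%E.
Proof.
move=> x0 e0; have k0 : 0 <= 1 + x^-1 by rewrite addr_ge0// invr_ge0 ltW.
have -> : [set w | W w <= x] =
    [set w | 0 <= expR (- U w) `^ (1 + x^-1) - expR (- (U w + V w))].
  by apply/seteqP; split => w /=; rewrite exp_ratio_le// W_le.
apply: (@limsup_sample_prob (fun z w => z `^ (1 + x^-1) - w) (1 + x^-1) e
  (fun n => [set w | C n w <= x]) k0 e0 (measurable_ratio x)).
- by move=> a b' y z a01 _ y01 _; exact: ratio_lipschitz.
- by move=> n; exact: (measurable_ler_set (measurable_C n) (measurable_cst x)).
- by move=> n w Xs0 /=; rewrite exp_ratio_le// C_stat_le// ltW.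
Qed.

(** Stated for any [Y] below [C], to serve both the quotient itself and the dispersion. *)
Let prob_C_gt (Y : nat -> T -> R) x e : (forall n, measurable_fun setT (Y n)) ->
  (forall n w, (forall i, 0 < Xs i w) -> Y n w <= C n w) ->
  0 < x -> 0 < e -> \forall n \near \oo,
  (P [set w | (x < Y n w)%R] <= P1 [set w | (x <= W w)%R] + e%:E)%E.
Proof.
move=> mY YC x0 e0; have k0 : 0 <= 1 + x^-1 by rewrite addr_ge0// invr_ge0 ltW.
have mG : measurable_fun setT (fun p : R * R => p.2 - p.1 `^ (1 + x^-1)).
  apply: measurable_funB => //.
  exact: (measurableT_comp (measurable_powR _) measurable_fst).
have -> : [set w | x <= W w] =
    [set w | 0 <= expR (- (U w + V w)) - expR (- U w) `^ (1 + x^-1)].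
  by apply/seteqP; split => w /=; rewrite exp_ratio_ge// W_ge.
apply: (@limsup_sample_prob (fun z w => w - z `^ (1 + x^-1)) (1 + x^-1) e
  (fun n => [set w | x < Y n w]) k0 e0 mG).
- move=> a b' y z a01 _ y01 _; rewrite -normrN.
  have -> : - (b' - a `^ (1 + x^-1) - (z - y `^ (1 + x^-1))) =
    (a `^ (1 + x^-1) - b') - (y `^ (1 + x^-1) - z) by ring.
  exact: ratio_lipschitz.
- by move=> n; exact: (measurable_ltr_set (f := cst _)).
- move=> n w Xs0 /= /lt_le_trans /(_ (YC n w Xs0)); rewrite exp_ratio_ge// ltNge C_stat_le ?(ltW x0)//.
  by rewrite -ltNge => /ltW.
Qed.

(** In the coordinates of the square, [M <= V] reads [w <= expR (- M) * z], a linear condition. *)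
Let prob_S1_ge M e : 0 <= M -> 0 < e -> \forall n \near \oo,
  (P [set w | (M <= S1 n w)%R] <= P1 [set w | (M <= V w)%R] + e%:E)%E.
Proof.
move=> M0 e0; have mG : measurable_fun setT (fun p : R * R => expR (- M) * p.1 - p.2).
  by apply: measurable_funB => //; exact: (measurable_funM (measurable_cst _) measurable_fst).
have GE (A B : R) : (0 <= expR (- M) * expR (- A) - expR (- (A + B))) = (M <= B).
  by rewrite subr_ge0 -expRD ler_expR [A + B]addrC opprD lerD2r lerN2.
have -> : [set w | M <= V w] =
    [set w | 0 <= expR (- M) * expR (- U w) - expR (- (U w + V w))].
  by apply/seteqP; split => w /=; rewrite GE.
apply: (@limsup_sample_prob (fun z w => expR (- M) * z - w) 1 e
  (fun n => [set w | M <= S1 n w]) ler01 e0 mG).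
- move=> a b' y z _ _ _ _; rewrite mul1r.
  have -> : expR (- M) * a - b' - (expR (- M) * y - z) = expR (- M) * (a - y) - (b' - z) by ring.
  apply: (le_trans (ler_normB _ _)); rewrite lerD2r normrM ger0_norm ?expR_ge0//.
  by rewrite ler_piMl// expR_le1 oppr_le0.
- by move=> n; exact: (measurable_ler_set (measurable_cst M) (measurable_S1 n)).
- by move=> n w _ /=; rewrite GE.
Qed.

Let V_tail eta e : 0 < eta -> 0 < e ->
  exists K : nat, (P1 [set w | (eta * K%:R <= V w)%R] <= e%:E)%E.
Proof.
move=> eta0 e0.
have : fine (cdf V x) @[x --> +oo] --> (1 : R) by apply: fine_cvg; exact: cvg_cdfy1.
move/cvgrPdist_le => /(_ e e0) [A [_ HA]].
pose x := A + 1; have /HA Hx : A < x by rewrite ltrDl.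
have [K Kx] : exists K : nat, x / eta < K%:R.
  by exists (Num.trunc (x / eta)).+1; rewrite truncnS_gt.
exists K; apply: (@le_trans _ _ (tail V x)%:E).
  rewrite tailE; apply: le_measure; rewrite ?inE.
  - exact: (measurable_ler_set (f := cst _)).
  - exact: (measurable_ltr_set (f := cst _)).
  - by move=> w /=; apply: lt_le_trans; rewrite mulrC -ltr_pdivrMr.
by rewrite lee_fin; apply: le_trans Hx; exact: ler_norm.
Qed.

(** If [D <= x] while [C > x + eta], the scaled sample mean exceeds [eta]; with more than [K]
    observations the scaled sum [S1] is then at least [eta * K]. Few observations are unlikely by
    [index_prob_le], a large sum by the tail of [V]. *)
Let prob_D_le x eta e : 0 <= x -> 0 < eta -> 0 < e -> \forall n \near \oo,
  (P [set w | (D n w <= x)%R] <= P1 [set w | (W w <= x + eta)%R] + e%:E)%E.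
Proof.
move=> x0 eta0 e0; have e4 : 0 < e / 4 by rewrite divr_gt0.
have [K HK] := V_tail eta0 e4.
have M0 : 0 <= eta * K%:R by rewrite mulr_ge0// ltW.
have xeta : 0 < x + eta by rewrite ltr_wpDl.
near=> n.
have h1 : (P [set w | (C n w <= x + eta)%R] <= P1 [set w | (W w <= x + eta)%R] + (e / 4)%:E)%E.
  by near: n; exact: prob_C_le.
have h2 : (P [set w | (N (t n) w <= K)%N] <= (e / 4)%:E)%E by near: n; exact: index_prob_le.
have h3 : (P [set w | (eta * K%:R <= S1 n w)%R] <= P1 [set w | (eta * K%:R <= V w)%R] + (e / 4)%:E)%E.
  by near: n; exact: prob_S1_ge.
have m1 : measurable [set w | C n w <= x + eta].
  exact: (measurable_ler_set (measurable_C n) (measurable_cst _)).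
have m2 : measurable [set w | (N (t n) w <= K)%N].
  rewrite -[X in measurable X]setTI.
  exact: (@N_measurable (t n) measurableT [set k | (k <= K)%N]).
have m3 : measurable [set w | eta * K%:R <= S1 n w].
  exact: (measurable_ler_set (measurable_cst _) (measurable_S1 n)).
apply: (@le_trans _ _ (P ([set w | C n w <= x + eta] `|`
    ([set w | (N (t n) w <= K)%N] `|` [set w | eta * K%:R <= S1 n w])))).
  apply: prob_le_ae.
  - exact: (measurable_ler_set (measurable_D n) (measurable_cst _)).
  - by apply: measurableU => //; exact: measurableU.
  - apply: filterS ae_sample_gt0 => w Xs0 /= Dx.
    have [Cx|Cx] := leP (C n w) (x + eta); [by left|right].
    have [NK|NK] := leqP (N (t n) w) K; [by left|right].
    have [DE _] := sample_dispersionE (t n) Xs0.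
    have Nn0 : 0 < (N (t n) w)%:R :> R by rewrite ltr0n (leq_ltn_trans _ NK).
    have SE : S1 n w = (N (t n) w)%:R * ((b n)^-1 * sample_mean Xs (N (t n) w) w).
      by rewrite /S1 /sample_mean; field; rewrite !gt_eqF.
    have mE : D n w = C n w - (b n)^-1 * sample_mean Xs (N (t n) w) w.
      by rewrite /D /C DE mulrBr.
    rewrite SE mulrC; apply: ler_pM => //; first exact: ltW.
      by rewrite ler_nat ltnW.
    by move: Dx Cx; rewrite mE; lra.
apply: le_trans (measureU2 _ m1 (measurableU _ _ m2 m3)) _.
apply: le_trans (leeD h1 (le_trans (measureU2 _ m2 m3) (leeD h2 (le_trans h3 (leeD2r _ HK))))) _.
by rewrite -addeA leeD2l// -!EFinD lee_fin; lra.
Unshelve. all: by end_near. Qed.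

Let prob_neg (Y : nat -> T -> R) n x : (forall n, measurable_fun setT (Y n)) ->
  (forall n w, (forall i, 0 < Xs i w) -> 0 <= Y n w) -> x < 0 -> P [set w | Y n w <= x] = 0%E.
Proof.
move=> mY Y0 x0; apply/eqP; rewrite eq_le measure_ge0 andbT -(measure0 P).
apply: prob_le_ae => //; first exact: (measurable_ler_set (g := cst _)).
apply: filterS ae_sample_gt0 => w Xs0 /= Yx.
by have := le_lt_trans (le_trans (Y0 n w Xs0) Yx) x0; rewrite ltxx.
Qed.

Let W0 w : 0 < W w. Proof. by rewrite divr_gt0. Qed.

Lemma cvg_C_stat_cdf x : {for x, continuous (fun y : R => pushforward P1 W `]-oo, y])} ->
  pushforward P (fun w => (b n)^-1 * C_stat Xs N (t n) w) `]-oo, x] @[n --> \oo] -->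
  pushforward P1 W `]-oo, x].
Proof.
apply: (cvg_cdf_bounds measurable_C measurable_W W0).
- move=> y eta e y0 eta0 e0; have yeta : 0 < y + eta by rewrite ltr_wpDl.
  apply: filterS (prob_C_le yeta e0) => n; apply: le_trans.
  apply: le_measure; rewrite ?inE; [exact: (measurable_ler_set (measurable_C n) (measurable_cst _))..|].
  by move=> w /= /le_trans; apply; rewrite lerDl ltW.
- by move=> y e; apply: (prob_C_gt measurable_C).
- by move=> n y; apply: (prob_neg n measurable_C) => k w /(D_ge0_le_C k) /andP[]; exact: le_trans.
Qed.

Lemma cvg_sample_dispersion_cdf x :
  {for x, continuous (fun y : R => pushforward P1 W `]-oo, y])} ->
  pushforward P (fun w => (b n)^-1 * sample_dispersion Xs N (t n) w) `]-oo, x] @[n --> \oo] -->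
  pushforward P1 W `]-oo, x].
Proof.
apply: (cvg_cdf_bounds measurable_D measurable_W W0).
- exact: prob_D_le.
- by move=> y e; apply: (prob_C_gt measurable_D) => n w /(D_ge0_le_C n) /andP[].
- by move=> n y; apply: (prob_neg n measurable_D) => k w /(D_ge0_le_C k) /andP[].
Qed.

End limit.

End random_sample.

(** * The norming function and the passage to continuous time *)

Lemma cvg_tail_norming {R : realType} {d : measure_display} {T : measurableType d}
    (P : probability T R) (X : {RV P >-> R}) (alpha : R) (ell a : R -> R) :
  pareto_type X alpha ell -> a t @[t --> +oo] --> +oo ->
  t * a t `^ (- alpha) * ell (a t) @[t --> +oo] --> (1 : R) ->
  t * tail X (a t) @[t --> +oo] --> (1 : R).
Proof.
move=> [[[A [_ ell_gt0]] _] tail_ell] ay a_norm.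
have H : (1 - fine (cdf X (a t))) / (a t `^ (- alpha) * ell (a t)) @[t --> +oo] --> (1 : R).
  exact: (cvg_comp a _ ay tail_ell).
have {}H : (1 - fine (cdf X (a t))) / (a t `^ (- alpha) * ell (a t)) *
    (t * a t `^ (- alpha) * ell (a t)) @[t --> +oo] --> (1 : R).
  by rewrite -[X in _ --> X]mulr1; exact: cvgM.
apply: cvg_trans H; apply: near_eq_cvg; near=> t.
have aA : A <= a t by near: t; move/cvgryPge : ay; apply.
have a0 : 0 < a t by near: t; move/cvgryPgt : ay; apply.
rewrite /= /tail; field.
by apply/andP; split; rewrite gt_eqF ?powR_gt0 ?ell_gt0.
Unshelve. all: by end_near. Qed.

(** A limit at infinity is tested on sequences; dropping finitely many terms makes both [t] and
    [a t] positive from the start. *)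
Lemma cvg_pinfty_shift {R : realType} (a : R -> R) (f : R -> \bar R) (l : \bar R) :
  a t @[t --> +oo] --> +oo ->
  (forall t : nat -> R, (forall n, 0 < t n) -> (forall n, 0 < a (t n)) ->
    t n @[n --> \oo] --> +oo -> f (t n) @[n --> \oo] --> l) ->
  f t @[t --> +oo] --> l.
Proof.
move=> ay H; apply/cvge_pinftyP => u uy.
have [n0 _ Hn0] : \forall n \near \oo, 0 < u n /\ 0 < a (u n).
  near=> n; split; near: n.
    by move/cvgryPgt : uy; apply.
  by have := cvg_comp _ _ uy ay; move/cvgryPgt; apply.
rewrite -(cvg_shiftn n0); apply: (H (fun n => u (n + n0)%N)).
- by move=> n; have [] := Hn0 (n + n0)%N (leq_addl _ _).
- by move=> n; have [] := Hn0 (n + n0)%N (leq_addl _ _).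
- by rewrite (cvg_shiftn n0).
Unshelve. all: by end_near. Qed.


Theorem mainTheorem13 (R : realType)
    (d : measure_display) (T : measurableType d) (P : probability T R)
    (X : {RV P >-> R}) (Xs : nat -> {RV P >-> R}) (N : R -> {RV P >-> nat})
    (d' : measure_display) (T' : measurableType d') (Q : probability T' R)
    (Lambda : {RV Q >-> R})
    (alpha : R) (ell a : R -> R)
    (X_pos : P [set w | 0 < X w] = 1%E)
    (Xs_iid : iid_copies X Xs)
    (N_counting : counting_process N)
    (N_indep : process_independent N Xs)
    (alpha_gt0 : 0 < alpha) (alpha_lt1 : alpha < 1)
    (X_pareto : pareto_type X alpha ell)
    (N_average : D_averages_in_time N Lambda)
    (a_infty : a t @[t --> +oo] --> +oo)
    (a_norm : t * a t `^ (- alpha) * ell (a t) @[t --> +oo] --> (1 : R)) :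
  exists (d1 : measure_display) (T1 : measurableType d1)
         (P1 : probability T1 R) (U V : {RV P1 >-> R}),
    [/\ has_UV_transform alpha Lambda U V,
        (* the joint law of (U, V) is determined by the transform *)
        forall (d2 : measure_display) (T2 : measurableType d2)
               (P2 : probability T2 R) (U2 V2 : {RV P2 >-> R}),
          has_UV_transform alpha Lambda U2 V2 ->
          forall B : set (R * R)%type, measurable B ->
            pushforward P2 (fun w => (U2 w, V2 w)) B =
            pushforward P1 (fun w => (U w, V w)) B,
        cvg_in_distribution P (fun t w => (a t)^-1 * C_stat Xs N t w)
                            P1 (fun w => U w / V w)
      & cvg_in_distribution P (fun t w => (a t)^-1 * sample_dispersion Xs N t w)
                            P1 (fun w => U w / V w)].
Proof.
have alpha01 : 0 < alpha < 1 by rewrite alpha_gt0.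
have [_ L0] := N_average.
have [d1 [T1 [P1 [U [V [UV U0 V0]]]]]] := mixture_exists alpha01 L0.
have lim t : t n @[n --> \oo] --> +oo ->
    a (t n) @[n --> \oo] --> +oo /\ t n * tail X (a (t n)) @[n --> \oo] --> (1 : R).
  move=> ty; split; first exact: (cvg_comp t a ty a_infty).
  exact: (cvg_comp t (fun s => s * tail X (a s)) ty (cvg_tail_norming X_pareto a_infty a_norm)).
exists d1, T1, P1, U, V; split => //.
- by move=> d2 T2 P2 U2 V2 UV2 B; exact: transform_unique alpha01 L0 UV UV2.
- move=> x cx; apply: (cvg_pinfty_shift a_infty) => t t0 at0 ty; have [aty tt] := lim t ty.
  exact: (cvg_C_stat_cdf (b := fun n => a (t n)) alpha01 X_pos Xs_iid N_indep X_pareto N_average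
    t0 at0 ty aty tt UV U0 V0 cx).
- move=> x cx; apply: (cvg_pinfty_shift a_infty) => t t0 at0 ty; have [aty tt] := lim t ty.
  exact: (cvg_sample_dispersion_cdf (b := fun n => a (t n)) alpha01 X_pos Xs_iid N_indep X_pareto
    N_average t0 at0 ty aty tt UV U0 V0 cx).
Qed.
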